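(* Let $d\ge2$ and, for $0\le a<R<\infty$, let $A_{a,R}:=\{x\in\mathbb{R}^d: a\le|x|\le R\}$. Let $\mu,\rho\in\mathcal{P}(\mathbb{R}^d)\cap L^\infty(\mathbb{R}^d)$ be radial probability densities such that (i) $\operatorname{supp}\mu=A_{a,R}$ for some $0\le a<R<\infty$; (ii) $\operatorname{supp}\rho\subset\operatorname{supp}\mu$; (iii) there exist constants $A,\lambda>0$ such that $A\ge\mu\ge\lambda$ almost everywhere on $\operatorname{supp}\mu$. Then $$\mathrm{MMD}^2(\rho,\mu)\le C_{d,\lambda,A}\,\mathsf{D}(\rho\mid\mu),\qquad C_{d,\lambda,A}:=\max\Big\{\frac1\lambda,\frac{d^2A}{2\lambda^2}\Big\}.$$ In particular, if $\operatorname{supp}\mu=B_R$ (the closed ball of radius $R$ centered at the origin) and $0<\lambda\le\mu\le A$ almost everywhere on $B_R$, then this inequality holds for every radial probability density $\rho\in\mathcal{P}(\mathbb{R}^d)\cap L^\infty(\mathbb{R}^d)$ supported in $B_R$.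
   Context: $\mathcal{P}(\mathbb{R}^d)$ is the set of Borel probability measures on $\mathbb{R}^d$, identified with densities when absolutely continuous. $g$ is the Coulomb kernel on $\mathbb{R}^d$, $-\Delta g=\delta_0$: $g(x)=-\frac1{2\pi}\log|x|$ for $d=2$, $g(x)=\frac1{(d-2)\sigma_d}|x|^{2-d}$ for $d\ge3$, $\sigma_d=|\mathbb{S}^{d-1}|$. $\mathrm{MMD}^2(\rho,\mu):=\frac12\int_{\mathbb{R}^d}g*(\rho-\mu)\,d(\rho-\mu)$, and $\mathsf{D}(\rho\mid\mu):=\int_{\mathbb{R}^d}|\nabla g*(\rho-\mu)|^2\,d\rho$. *)

(* Defs.v *)
From HB Require Import structures.
From mathcomp Require Import all_boot all_order all_algebra.
From mathcomp Require Import all_classical all_reals all_analysis.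

Set Implicit Arguments.
Unset Strict Implicit.
Unset Printing Implicit Defensive.

Import Order.TTheory GRing.Theory Num.Theory.
Import numFieldNormedType.Exports.

Local Open Scope classical_set_scope.
Local Open Scope ring_scope.

(* R^d as d-tuples with the library's product sigma-algebra (the Borel sets).
   'rV[R]_d is avoided because its library norm is the sup norm;
   measurableTypeR R is R with the sigma-algebra that carries lebesgue_measure. *)
Notation Rn R d := (d.-tuple (measurableTypeR R)).

Section lebesgue_Rn.
Context {R : realType}.

Definition Rn_cons n (p : measurableTypeR R * Rn R n) : Rn R n.+1 :=
  [tuple of p.1 :: p.2].

Lemma measurable_Rn_cons n : measurable_fun setT (@Rn_cons n).
Proof. exact: measurable_cons. Qed.

Section lebesgue_Rn_succ.
Variables (n : nat) (m : {sigma_finite_measure set (Rn R n) -> \bar R}).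

Definition lebesgue_Rn_succ : set (Rn R n.+1) -> \bar R :=
  pushforward (@lebesgue_measure R \x m)%E (@Rn_cons n).

Let m1 : {measure set (Rn R n.+1) -> \bar R} :=
  measure_function_pushforward__canonical__measure_function_Measure
    (@lebesgue_measure R \x m)%E (@measurable_Rn_cons n).

Let succ0 : lebesgue_Rn_succ set0 = 0%E.
Proof. exact: (measure0 m1). Qed.

Let succ_ge0 A : (0 <= lebesgue_Rn_succ A)%E.
Proof. exact: (measure_ge0 m1). Qed.

Let succ_sigma_additive : semi_sigma_additive lebesgue_Rn_succ.
Proof. exact: (@measure_semi_sigma_additive _ _ _ m1). Qed.

HB.instance Definition _ := isMeasure.Build _ _ _
  lebesgue_Rn_succ succ0 succ_ge0 succ_sigma_additive.

Let succ_sigma_finite : sigma_finite setT lebesgue_Rn_succ.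
Proof.
have [F TF Foo] := isSigmaFinite.sigma_finiteT
  (lebesgue_integral_fubini.measure_function_Measure_isSigmaFinite__to__measure_function_isSigmaFinite
     (@lebesgue_measure R) m).
pose g (x : Rn R n.+1) : measurableTypeR R * Rn R n :=
  (thead x, [tuple of behead x]).
have gK p : g (Rn_cons p) = p.
  by case: p => a t; rewrite /g /Rn_cons /=; congr pair; apply/val_inj.
have mg : measurable_fun setT g.
  by apply/measurable_fun_pairP; split;
    [exact: measurable_tnth|exact: measurable_behead].
exists (fun k => g @^-1` F k).
  by rewrite -preimage_bigcup -TF preimage_setT.
move=> k; have [mF Fk] := Foo k; split.
  by rewrite -[X in measurable X]setTI; exact: mg.
rewrite /lebesgue_Rn_succ /pushforward.
suff -> : @Rn_cons n @^-1` (g @^-1` F k) = F k by [].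
by apply/seteqP; split => p /=; rewrite gK.
Qed.

HB.instance Definition _ := Measure_isSigmaFinite.Build _ _ _
  lebesgue_Rn_succ succ_sigma_finite.

End lebesgue_Rn_succ.

Fixpoint lebesgue_Rn (d : nat) : {sigma_finite_measure set (Rn R d) -> \bar R} :=
  if d is n.+1 then lebesgue_Rn_succ (lebesgue_Rn n) else \d_([tuple]).

End lebesgue_Rn.

Section euclidean_space.
Context {R : realType} {d : nat}.
Implicit Types (x y : Rn R d) (i : 'I_d).

Definition coord x i : R := tnth x i.

Definition subv x y : Rn R d := [tuple coord x i - coord y i | i < d].

Definition scalev (t : R) x : Rn R d := [tuple t * coord x i | i < d].

Definition normv x : R := Num.sqrt (\sum_(i < d) coord x i ^+ 2).

(* x + t e_i, with e_i the i-th vector of the standard basis *)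
Definition translate x i (t : R) : Rn R d :=
  [tuple coord x j + t *+ (i == j) | j < d].

Definition partial (f : Rn R d -> R) i x : R := derive1 (fun t => f (translate x i t)) 0.

Definition open_ballv x (r : R) : set (Rn R d) :=
  [set y | normv (subv y x) < r].

Definition annulus (a r : R) : set (Rn R d) := [set x | a <= normv x <= r].

Definition centered_ball (r : R) : set (Rn R d) := [set x | normv x <= r].

Definition unit_sphere : set (Rn R d) := [set u | normv u = 1].

Definition cone (S : set (Rn R d)) : set (Rn R d) :=
  [set x | exists t u, [/\ 0 < t <= 1, S u & x = scalev t u]].

(* Surface measure on the unit sphere, in the normalization of integration in
   polar coordinates: d times the volume of the truncated cone over S. *)
Definition surface_measure (S : set (Rn R d)) : \bar R :=
  (d%:R%:E * lebesgue_Rn d (cone S))%E.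

End euclidean_space.

Definition sphere_area (R : realType) (d : nat) : R := fine (@surface_measure R d unit_sphere).

(* Real-valued, so the value at the singularity x = 0 is a convention (it is 0);
   the origin is a null set. Only used for 2 <= d. *)
Definition coulomb {R : realType} {d : nat} (x : Rn R d) : R :=
  if d == 2%N then - (2 * pi)^-1 * ln (normv x)
  else ((d - 2)%N%:R * sphere_area R d)^-1 * normv x ^- (d - 2)%N.

Section densities.
Context {R : realType} {d : nat}.
Local Notation leb := (@lebesgue_Rn R d).
Implicit Types f k mu rho : Rn R d -> R.

Definition prob_density f :=
  [/\ measurable_fun setT f, {ae leb, forall x, 0 <= f x}
    & (\int[leb]_x (f x)%:E = 1)%E].

(* Densities are a.e. classes: the class must have a radial representative. *)
Definition radial f :=
  exists h, [/\ measurable_fun setT h, {ae leb, forall x, f x = h x}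
    & forall x y, normv x = normv y -> h x = h y].

Definition bounded_radial_density f :=
  [/\ prob_density f, f \in Lfun leb +oo%E & radial f].

(* Support of the measure f dx: the points all of whose neighbourhoods have
   positive mass. *)
Definition supp f : set (Rn R d) :=
  [set x | forall r : R, 0 < r ->
     (0 < \int[leb]_(y in open_ballv x r) (f y)%:E)%E].

Definition convolution k f (x : Rn R d) : R := (\int[leb]_y (k (subv x y) * f y))%R.

Definition MMD2 rho mu : \bar R :=
  (2^-1%:E * \int[leb]_x (convolution coulomb (rho \- mu) x * (rho x - mu x))%:E)%E.

Definition dissipation rho mu : \bar R :=
  (\int[leb]_x
     ((\sum_(i < d) convolution (partial coulomb i) (rho \- mu) x ^+ 2) * rho x)%:E)%E.

End densities.

Definition constC {R : realType} (d : nat) (lam A : R) : R :=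
  Num.max lam^-1 (d%:R ^+ 2 * A / (2 * lam ^+ 2)).

(* Main.v *)
From HB Require Import structures.
From mathcomp Require Import all_boot all_order all_algebra.
From mathcomp Require Import ring lra.
From mathcomp Require Import all_classical all_reals all_analysis measurable_realfun ess_sup_inf.
Require Import Defs.

Set Implicit Arguments.
Unset Strict Implicit.
Unset Printing Implicit Defensive.

Import Order.TTheory GRing.Theory Num.Theory.
Import numFieldNormedType.Exports.

Local Open Scope classical_set_scope.
Local Open Scope ring_scope.

(** Let [rho] and [mu] be radial with profiles p and q, put n = d - 1, and let
    f s and F s be the integrals over 0 < u <= s of p u u^n and q u u^n. Times
    the area sigma of the unit sphere, these are the masses inside radius s, and
    N = f - F vanishes from the outer radius r on. By Gauss' law the gradient of
    g * (rho - mu) at a point of norm s is radial, of size |N s| s^(-n).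
    Therefore
      2 MMD2 = sigma * int N^2 s^(-n) ds   and
      dissipation = sigma * int p N^2 s^(-n) ds,
    and the theorem is the one-dimensional inequality
      int N^2 s^(-n) ds <= 2 C int p N^2 s^(-n) ds.

    The difficulty is that p may vanish on a set where N does not. But there f is
    constant while F grows at a rate at least lambda s^n, so N cannot stay large
    and positive for long after the last mass of rho, nor can it have been large
    and negative long before its next mass. To quantify this, write the square of
    the positive part of N s as the integral over u <= s of
    2 (f u - F s)_+ df(u), and that of the negative part as the integral over
    s < u <= r of 2 (F s - f u)_+ df(u), where equality of the total masses is
    used. After multiplication by s^(-n) and exchange of the integrals, the
    measure df(u) = p u u^n du is outside, and the integral over s is at most a
    constant times N u^2 u^(-2 n), because the integrand is supported in an
    interval of length of order |N u| u^(-n). For the positive part s^(-n)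
    is at most u^(-n) and the constant is 1 / lambda ([inner_bound_above]). For
    the negative part s^(-n) is larger than u^(-n), which the upper bound A
    compensates, and the constant is A (d / lambda)^2 ([inner_bound_below]).
    [mass_defect_le] combines the two.

    The passage to radial quantities uses Gauss' law in weak form ([gauss_law]),
    for the pairing of the field of a point charge with a vector field
    alpha(|x|) x. It is proved in polar coordinates centred at the charge and
    gives, by Fubini's theorem, the pairing of the whole field with such a
    vector field ([flux_pairing]). The dissipation only has to be bounded from
    below, which that pairing and the Cauchy-Schwarz inequality do
    ([dissipation_lower_bound]). For the energy, the difference of the potential
    between two points of a ray is the integral of the field along the ray, and
    an integration by parts brings in N ([energy_formula]).

    It remains to go from almost everywhere classes to profiles. A density
    vanishes almost everywhere off its support ([ae_eq0_off_supp]), so both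
    profiles can be truncated to satisfy their bounds at every radius of the
    interval [a, r] and to vanish outside it ([radial_profile]). *)

(** * Integration of real-valued functions *)

Section weighted_image.
Context d1 d2 (X : measurableType d1) (Y : measurableType d2) (R : realType).
Variables (mu : {measure set X -> \bar R}) (nu : {measure set Y -> \bar R}).

(** [mu] is the image under [Phi] of the measure with density [W] with respect
    to [nu]. Changes of variables are put in this form because it passes from
    nonnegative functions to integrable ones once and for all. *)
Definition weighted_image (Phi : Y -> X) (W : Y -> R) :=
  [/\ measurable_fun setT Phi, measurable_fun setT W, forall y, 0 <= W y &
    forall F : X -> \bar R, measurable_fun setT F -> (forall x, (0 <= F x)%E) ->
      (\int[mu]_x F x = \int[nu]_y (F (Phi y) * (W y)%:E))%E].

Import HBNNSimple.

(** Both sides are linear and continuous along increasing sequences, so that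
    simple functions, hence indicators, are enough. *)
Lemma weighted_image_indic (Phi : Y -> X) (W : Y -> R) :
  measurable_fun setT Phi -> measurable_fun setT W -> (forall y, 0 <= W y) ->
  (forall A, measurable A -> mu A = \int[nu]_(y in Phi @^-1` A) (W y)%:E)%E ->
  weighted_image Phi W.
Proof.
move=> mPhi mW W0 muW; split=> // F mF F0.
pose h := nnsfun_approx measurableT mF.
have -> : (\int[mu]_x F x = lim (\int[mu]_x (EFin \o h n) x @[n --> \oo]))%E.
  have FE x : F x = lim ((EFin \o h n) x @[n --> \oo]).
    by apply/esym/cvg_lim => //; exact: cvg_nnsfun_approx.
  under eq_integral => x _ do rewrite FE.
  apply: monotone_convergence => //.
  - by move=> n; apply/measurable_EFinP/measurable_funP.
  - by move=> n x _ /=; rewrite lee_fin.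
  - by move=> x _ a b ab; rewrite lee_fin; exact/lefP/nd_nnsfun_approx.
have -> : (\int[nu]_y (F (Phi y) * (W y)%:E) =
    lim (\int[nu]_y ((h n (Phi y))%:E * (W y)%:E) @[n --> \oo]))%E.
  have FE y : (F (Phi y) * (W y)%:E =
     lim (((h n (Phi y))%:E * (W y)%:E) @[n --> \oo]))%E.
    apply/esym/cvg_lim => //; apply: cvgeZr => //.
    exact: cvg_nnsfun_approx.
  under eq_integral => x _ do rewrite FE.
  apply: monotone_convergence => //.
  - move=> n; apply: emeasurable_funM; apply/measurable_EFinP => //.
    by apply: measurableT_comp.
  - by move=> n x _ /=; rewrite mule_ge0// lee_fin.
  - move=> x _ a b ab; rewrite lee_wpmul2r ?lee_fin//.
    exact/lefP/nd_nnsfun_approx.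
suff suf n : (\int[mu]_x (EFin \o h n) x =
    \int[nu]_y ((h n (Phi y))%:E * (W y)%:E))%E.
  by under eq_fun do rewrite suf.
transitivity (\int[mu]_x
   (\sum_(y \in range (h n)) (y * \1_(h n @^-1` [set y]) x)%:E))%E.
  by apply: eq_integral => t tE; rewrite /= fimfunE -fsumEFin.
rewrite ge0_integral_fsum//; last 2 first.
- by move=> r; apply/measurable_EFinP; exact: measurable_funM.
- by move=> m y _; exact: nnfun_muleindic_ge0.
transitivity (\int[nu]_y (\sum_(r \in range (h n))
    (r * \1_(h n @^-1` [set r]) (Phi y))%:E * (W y)%:E))%E; last first.
  apply: eq_integral => y _.
  rewrite -ge0_mule_fsuml => [|r]; last exact: nnfun_muleindic_ge0.
  by rewrite fsumEFin // -(fimfunE (h n) (Phi y)).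
rewrite ge0_integral_fsum//; last 2 first.
- move=> r; apply: emeasurable_funM; apply/measurable_EFinP => //.
  apply: measurable_funM => //.
  by apply: (@measurableT_comp _ _ _ _ _ _ (\1_(h n @^-1` [set r]) : X -> R)).
- by move=> m y _; apply: mule_ge0; [exact: nnfun_muleindic_ge0|rewrite lee_fin].
apply: eq_fsbigr => r rhn.
have mr : measurable (h n @^-1` [set r]) by [].
have r0 : 0 <= r by move: rhn; rewrite inE => -[x _ <-].
under eq_integral do rewrite EFinM.
rewrite ge0_integralZl//; last by apply: measurableT_comp.
under [RHS]eq_integral do rewrite EFinM -muleA.
rewrite ge0_integralZl//; last 2 first.
- apply: emeasurable_funM; apply/measurable_EFinP => //.
  by apply: (@measurableT_comp _ _ _ _ _ _ (\1_(h n @^-1` [set r]) : X -> R)).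
- by move=> x _; apply: mule_ge0; rewrite lee_fin.
congr (_ * _)%E.
rewrite integral_indic// setIT muW// [LHS]integral_mkcond.
apply: eq_integral => y _; rewrite patchE indicE.
have -> : (Phi y \in h n @^-1` [set r]) = (y \in Phi @^-1` (h n @^-1` [set r])).
  by apply/idP/idP; rewrite !inE.
by case: ifP => _; rewrite ?mul1e ?mul0e.
Qed.

Lemma weighted_image_integrable Phi W (f : X -> R) : weighted_image Phi W ->
  mu.-integrable setT (EFin \o f) ->
  nu.-integrable setT (EFin \o (fun y => f (Phi y) * W y)).
Proof.
move=> [mPhi mW W0 FE] /integrableP[mf foo]; apply/integrableP; split.
  apply/measurable_EFinP/measurable_funM => //.
  by apply: measurableT_comp => //; exact/measurable_EFinP.
move: foo; rewrite FE//; last exact: measurableT_comp.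
congr (_ < _)%E; apply: eq_integral => y _ /=.
by rewrite normrM EFinM (ger0_norm (W0 y)).
Qed.

Lemma weighted_image_Rintegral Phi W (f : X -> R) : weighted_image Phi W ->
  mu.-integrable setT (EFin \o f) ->
  \int[mu]_x f x = \int[nu]_y (f (Phi y) * W y).
Proof.
move=> [mPhi mW W0 FE] /integrableP[mf foo]; congr fine.
rewrite integralE [RHS]integralE.
rewrite !FE//; [|exact: measurable_funeneg|exact: measurable_funepos].
congr (_ - _)%E; apply: eq_integral => y _ /=.
- rewrite !funeposE /= EFinM -[in RHS](@mul0e _ (W y)%:E).
  by rewrite maxe_pMl ?lee_fin.
- rewrite !funenegE /= -mulNr EFinM -[in RHS](@mul0e _ (W y)%:E).
  by rewrite maxe_pMl ?lee_fin.
Qed.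

End weighted_image.

Section Rintegral_fubini.
Context d1 d2 (X : measurableType d1) (Y : measurableType d2) (R : realType).
Variables (m1 : {sigma_finite_measure set X -> \bar R}).
Variables (m2 : {sigma_finite_measure set Y -> \bar R}).
Implicit Type f : X * Y -> R.

Lemma measurable_Rintegral_section f : measurable_fun setT f ->
  measurable_fun setT (fun x => \int[m2]_y f (x, y)).
Proof.
move=> mf; have mEf : measurable_fun setT (EFin \o f) by exact/measurable_EFinP.
apply: measurableT_comp => //.
rewrite (_ : (fun x => _) = (fun x => \int[m2]_y (EFin \o f)^\+ (x, y) -
    \int[m2]_y (EFin \o f)^\- (x, y))%E); last first.
  apply/funext => x; rewrite integralE.
  by congr (_ - _)%E; apply: eq_integral => y _; rewrite ?funeposE ?funenegE.
apply: emeasurable_funB.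
- by apply: measurable_fun_fubini_tonelli_F => //; exact: measurable_funepos.
- by apply: measurable_fun_fubini_tonelli_F => //; exact: measurable_funeneg.
Qed.

(** The real-valued inner integral is 0 where the extended one is infinite, so
    that it is dominated by the latter. *)
Lemma integrable_Rintegral_section f : (m1 \x m2)%E.-integrable setT (EFin \o f) ->
  m1.-integrable setT (EFin \o (fun x => \int[m2]_y f (x, y))).
Proof.
move=> intf; have iF := integrable_fubini_F intf.
apply: (le_integrable _ _ _ iF) => //.
  apply/measurable_EFinP/measurable_Rintegral_section/measurable_EFinP.
  exact: measurable_int intf.
move=> x _ /=; rewrite /Rintegral /fubini_F /=.
by case: (integral _ _ _) => //=; rewrite ?normr0 ?leey.
Qed.

Lemma Rintegral_prod f : (m1 \x m2)%E.-integrable setT (EFin \o f) ->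
  \int[(m1 \x m2)%E]_z f z = \int[m1]_x \int[m2]_y f (x, y).
Proof.
move=> intf; have iF := integrable_fubini_F intf.
congr fine; rewrite -integral12_prod_meas1//.
apply: ae_eq_integral => //.
- exact: measurable_int iF.
- exact: measurable_int (integrable_Rintegral_section intf).
- have := integrable_ae measurableT iF; apply: filterS => x /(_ I) Fx _.
  by rewrite /Rintegral fineK.
Qed.

End Rintegral_fubini.

Section Rintegral_fubini_swap.
Context d1 d2 (X : measurableType d1) (Y : measurableType d2) (R : realType).
Variables (m1 : {sigma_finite_measure set X -> \bar R}).
Variables (m2 : {sigma_finite_measure set Y -> \bar R}).

Lemma Rintegral_fubini (f : X -> Y -> R) :
  (m1 \x m2)%E.-integrable setT (EFin \o (fun z => f z.1 z.2)) ->
  \int[m1]_x \int[m2]_y f x y = \int[m2]_y \int[m1]_x f x y.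
Proof.
move=> intf; rewrite -(Rintegral_prod intf).
have mf : measurable_fun setT (fun z => f z.1 z.2).
  by apply/measurable_EFinP; exact: (measurable_int _ intf).
have mf' : measurable_fun setT (fun z : Y * X => f z.2 z.1).
  exact: (measurableT_comp mf (@measurable_swap _ _ Y X)).
have intf' : (m2 \x m1)%E.-integrable setT
    (EFin \o (fun z : Y * X => f z.2 z.1)).
  apply/integrable21ltyP; first exact/measurable_EFinP.
  have mEf := measurable_int _ intf.
  by have /(_ intf) := (integrable12ltyP m1 m2 mEf).1.
rewrite -(Rintegral_prod intf'); congr fine.
rewrite -(integral12_prod_meas1 intf) -(integral21_prod_meas1 intf').
by [].
Qed.

End Rintegral_fubini_swap.

Lemma measurable_fun_lt_le d (T : measurableType d) (R : realType) (f g h : T -> R) :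
  measurable_fun setT f -> measurable_fun setT g -> measurable_fun setT h ->
  measurable_fun setT (fun x => f x < g x <= h x).
Proof.
by move=> mf mg mh; apply: measurable_and;
  [exact: measurable_fun_ltr|exact: measurable_fun_ler].
Qed.

Section interval_integrals.
Context {R : realType}.
Local Notation leb := (@lebesgue_measure R).
Implicit Types (f F : R -> R) (a b : R).

Lemma is_derive1_expn n (x : R) :
  is_derive x 1 (fun u : R => u ^+ n) (n%:R * x ^+ n.-1).
Proof.
have -> : (fun u : R => u ^+ n) = (id : R -> R) ^+ n.
  by apply/funext => u; rewrite exprfctE.
by apply: is_derive_eq; rewrite /GRing.scale/= mulr1.
Qed.

Lemma integral_derive f F a b : a <= b ->
  (forall x, a <= x <= b -> is_derive x 1 F (f x)) ->
  (forall x, a <= x <= b -> {for x, continuous f}) ->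
  (\int[leb]_(x in `[a, b]) (f x)%:E = (F b - F a)%:E)%E.
Proof.
rewrite le_eqVlt => /predU1P[<- _ _|ab dF cf].
  by rewrite set_itv1 integral_set1 subrr.
have cF x : a <= x <= b -> {for x, continuous F}.
  move=> xab; apply: differentiable_continuous; apply/derivable1_diffP.
  by have [] := dF _ xab.
rewrite (@continuous_FTC2 _ f F)//.
- apply: continuous_in_subspaceT => x; rewrite inE/= in_itv/= => xab.
  exact: cf.
- split.
  + by move=> x; rewrite in_itv/= => /andP[ax xb]; have [] := dF x; rewrite ?(ltW ax) ?(ltW xb).
  + by apply: cvg_at_right_filter; apply: cF; rewrite lexx ltW.
  + by apply: cvg_at_left_filter; apply: cF; rewrite lexx ltW.
- move=> x; rewrite in_itv/= => /andP[ax xb].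
  have dFx : is_derive x 1 F (f x) by apply: dF; rewrite (ltW ax) (ltW xb).
  by rewrite derive1E; exact: derive_val.
Qed.

End interval_integrals.

(** * Changes of variables on the line *)

Section lebesgue_change_of_variables.
Context {R : realType}.
Local Notation leb := (@lebesgue_measure R).

Section from_intervals.
Variables (Phi W : R -> R).
Hypotheses (mPhi : measurable_fun setT Phi) (mW : measurable_fun setT W).
Hypothesis W0 : forall y, 0 <= W y.

Let nu (A : set (measurableTypeR R)) : \bar R :=
  (\int[leb]_(y in Phi @^-1` A) (W y)%:E)%E.

Let nu0 : nu set0 = 0%E.
Proof. by rewrite /nu preimage_set0 integral_set0. Qed.

Let nu_ge0 A : (0 <= nu A)%E.
Proof. by apply: integral_ge0 => y _; rewrite lee_fin. Qed.

Let nu_sigma_additive : semi_sigma_additive nu.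
Proof.
move=> /= F mF tF mUF; rewrite /nu; apply: cvg_toP.
  apply: ereal_nondecreasing_is_cvgn => m n mn.
  by apply: lee_sum_nneg_natr => // k _ _; exact: nu_ge0.
rewrite preimage_bigcup ge0_integral_bigcup//=.
- by move=> k; rewrite -[X in measurable X]setTI; apply: mPhi => //; exact: mF.
- by apply: measurable_funTS; exact: measurableT_comp.
- by move=> x _; rewrite lee_fin.
- move=> i j _ _ [y [/= Fi Fj]]; apply: tF => //; by exists (Phi y).
Qed.

HB.instance Definition _ := isMeasure.Build _ _ _ nu nu0 nu_ge0 nu_sigma_additive.

(** The measure with density [W], transported by [Phi], is identified with the
    Lebesgue measure by its values on half-open intervals. *)
Lemma lebesgue_weighted_image :
  (forall a b, a < b ->
    (\int[leb]_(y in Phi @^-1` `]a, b]) (W y)%:E = (b - a)%:E)%E) ->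
  weighted_image leb leb Phi W.
Proof.
move=> nuE; apply: weighted_image_indic => // A mA.
apply: (@lebesgue_measure_unique _ nu) => // X /ocitvP[->|[[a b] /= ab ->]].
  by rewrite !measure0.
by rewrite lebesgue_measure_itv /= lte_fin ab; exact/esym/nuE.
Qed.

End from_intervals.

Lemma lebesgue_affine (a b : R) : 0 < a ->
  weighted_image leb leb (fun x => a * x + b) (cst a).
Proof.
move=> a0; apply: lebesgue_weighted_image => //.
- by apply: measurable_funD => //; exact: measurable_funM.
- by move=> y; rewrite /cst ltW.
move=> u v uv.
have -> : (fun x => a * x + b) @^-1` `]u, v] = `](u - b) / a, (v - b) / a]%classic.
  apply/seteqP; split => x /=; rewrite !in_itv/=;
    by rewrite ltr_pdivrMr// ler_pdivlMr// ltrBlDr lerBrDr mulrC.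
rewrite (integral_cst _ _ a%:E)//= lebesgue_measure_itv/= lte_fin ltr_pM2r ?invr_gt0//.
rewrite ltrD2r uv; congr EFin; field.
by rewrite gt_eqF.
Qed.

Lemma lebesgue_opp : weighted_image leb leb (fun x => - x) (cst 1).
Proof.
apply: lebesgue_weighted_image => //; first exact: oppr_measurable.
move=> u v uv.
have -> : -%R @^-1` `]u, v] = `[- v, - u[%classic :> set R.
  by apply/seteqP; split => x /=; rewrite !in_itv/= ltrNr lerNl andbC.
rewrite (integral_cst _ _ 1%E)//= lebesgue_measure_itv/= lte_fin ltrN2 uv mul1e.
by congr EFin; ring.
Qed.

(** The identity extends squaring on the positive half-line to a bijection of
    the line, so that the substitution v = u^2 needs no restricted domain. *)
Definition sqr_or_id (u : R) := if 0 < u then u ^+ 2 else u.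

Lemma lebesgue_sqr_or_id :
  weighted_image leb leb sqr_or_id (fun u => if 0 < u then 2 * u else 1).
Proof.
have mpos : measurable_fun setT (fun u : R => 0 < u) by exact: measurable_fun_ltr.
have mW : measurable_fun setT (fun u : R => if 0 < u then 2 * u else 1).
  by apply: measurable_fun_ifT => //; exact: measurable_funM.
have W0 (u : R) : 0 <= (if 0 < u then 2 * u else 1).
  by case: ifPn => // /ltW u0; rewrite mulr_ge0.
have mPhi : measurable_fun setT sqr_or_id by apply: measurable_fun_ifT.
apply: lebesgue_weighted_image => //.
have neg (a b : R) : a <= b -> b <= 0 ->
    (\int[leb]_(u in sqr_or_id @^-1` `]a, b]) (if 0 < u then 2 * u else 1)%:E
     = (b - a)%:E)%E.
  move=> ab b0.
  have -> : sqr_or_id @^-1` `]a, b] = `]a, b]%classic.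
    apply/seteqP; split => x /=; rewrite !in_itv/= /sqr_or_id.
      case: ifPn => // x0 /andP[_ /le_trans/(_ b0)].
      by rewrite leNgt exprn_gt0.
    by case: ifPn => // x0 /andP[_ /le_trans/(_ b0)]; rewrite leNgt x0.
  rewrite (eq_integral (cst 1%E)) ?integral_cst//=.
    rewrite mul1e lebesgue_measure_itv/= lte_fin.
    by move: ab; rewrite le_eqVlt => /predU1P[->|->]//; rewrite ltxx subrr.
  move=> x; rewrite inE/= in_itv/= => /andP[_ xb].
  by rewrite ltNge (le_trans xb b0).
have pos (a b : R) : a <= b -> 0 <= a ->
    (\int[leb]_(u in sqr_or_id @^-1` `]a, b]) (if 0 < u then 2 * u else 1)%:E
     = (b - a)%:E)%E.
  move=> ab a0; have b0 := le_trans a0 ab.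
  have -> : sqr_or_id @^-1` `]a, b] = `]Num.sqrt a, Num.sqrt b]%classic.
    apply/seteqP; split => x /=; rewrite !in_itv/= /sqr_or_id.
      case: ifPn => [x0|]; last by move=> + /andP[ax _]; rewrite (le_lt_trans a0 ax).
      move=> /andP[ax xb]; rewrite -{1 2}(ger0_norm (ltW x0)) -sqrtr_sqr.
      by rewrite ltr_sqrt ?exprn_gt0// ax ler_wsqrtr.
    move=> /andP[ax xb]; have x0 : 0 < x by rewrite (le_lt_trans _ ax) ?sqrtr_ge0.
    rewrite x0; move: ax xb; rewrite -{1 2}(ger0_norm (ltW x0)) -sqrtr_sqr.
    by rewrite ltr_sqrt ?exprn_gt0// ler_sqrt// => -> ->.
  transitivity (\int[leb]_(u in `]Num.sqrt a, Num.sqrt b]) (2 * u)%:E)%E.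
    apply: eq_integral => x; rewrite inE/= in_itv/= => /andP[ax xb].
    by rewrite (le_lt_trans _ ax) ?sqrtr_ge0.
  rewrite integral_itv_obnd_cbnd; last first.
    by apply/measurable_EFinP; exact: measurable_funM.
  transitivity ((Num.sqrt b ^+ 2 - Num.sqrt a ^+ 2)%:E); last by rewrite !sqr_sqrtr.
  apply: (@integral_derive _ (fun u : R => 2 * u) (fun u => u ^+ 2)).
  - by rewrite ler_wsqrtr.
  - by move=> x _; have := is_derive1_expn 2 x; rewrite expr1.
  - by move=> x _; apply: continuousM; [exact: cst_continuous|exact: cvg_id].
move=> a b ab; have [b0|b0] := leP b 0; first exact: neg (ltW ab) b0.
have [a0|a0] := leP 0 a; first exact: pos (ltW ab) a0.
rewrite (@itv_bndbnd_setU _ _ (BRight a) (BRight 0) (BRight b)) ?bnd_simp ?ltW//.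
rewrite preimage_setU ge0_integral_setU//.
- rewrite neg ?lexx ?ltW// pos ?lexx ?ltW// -EFinD; congr EFin; ring.
- by rewrite -[X in measurable X]setTI; apply: mPhi => //; exact: measurable_itv.
- by rewrite -[X in measurable X]setTI; apply: mPhi => //; exact: measurable_itv.
- by apply: measurable_funTS; exact: measurableT_comp.
- by move=> x _; rewrite lee_fin.
- rewrite disj_set2E; apply/eqP/seteqP; split => // x [/=].
  rewrite !in_itv/= => /andP[_ x0] /andP[x0' _].
  by move: x0'; rewrite ltNge x0.
Qed.

End lebesgue_change_of_variables.

(** * Euclidean space and its Lebesgue measure *)

Section euclidean_algebra.
Context {R : realType} {d : nat}.
Implicit Types x y z : Rn R d.

Definition dotv x y : R := \sum_(i < d) coord x i * coord y i.

Definition addv x y : Rn R d := [tuple coord x i + coord y i | i < d].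

Definition zerov : Rn R d := [tuple 0 | _ < d].

Lemma eq_coord x y : (forall i, coord x i = coord y i) -> x = y.
Proof. by move=> xy; apply/eq_from_tnth. Qed.

Lemma coord_scalev t x i : coord (scalev t x) i = t * coord x i.
Proof. by rewrite /coord tnth_mktuple. Qed.

Lemma coord_addv x y i : coord (addv x y) i = coord x i + coord y i.
Proof. by rewrite /coord tnth_mktuple. Qed.

Lemma coord_subv x y i : coord (subv x y) i = coord x i - coord y i.
Proof. by rewrite /coord tnth_mktuple. Qed.

Lemma coord_zerov i : coord zerov i = 0.
Proof. by rewrite /coord tnth_mktuple. Qed.

Lemma coord_translate x j t i :
  coord (translate x j t) i = coord x i + t *+ (j == i).
Proof. by rewrite /coord tnth_mktuple. Qed.

Definition coordE := (coord_scalev, coord_addv, coord_subv, coord_zerov, coord_translate).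

Lemma dotvC x y : dotv x y = dotv y x.
Proof. by apply: eq_bigr => i _; rewrite mulrC. Qed.

Lemma dotvDl x y z : dotv (addv x y) z = dotv x z + dotv y z.
Proof. by rewrite -big_split; apply: eq_bigr => i _; rewrite coordE mulrDl. Qed.

Lemma dotvDr x y z : dotv z (addv x y) = dotv z x + dotv z y.
Proof. by rewrite dotvC dotvDl !(dotvC z). Qed.

Lemma dotvBl x y z : dotv (subv x y) z = dotv x z - dotv y z.
Proof. by rewrite -sumrB; apply: eq_bigr => i _; rewrite coordE mulrBl. Qed.

Lemma dotvBr x y z : dotv z (subv x y) = dotv z x - dotv z y.
Proof. by rewrite dotvC dotvBl !(dotvC z). Qed.

Lemma dotvZl t x y : dotv (scalev t x) y = t * dotv x y.
Proof. by rewrite mulr_sumr; apply: eq_bigr => i _; rewrite coordE mulrA. Qed.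

Lemma dotvZr t x y : dotv x (scalev t y) = t * dotv x y.
Proof. by rewrite dotvC dotvZl dotvC. Qed.

Definition dotvE := (dotvDl, dotvDr, dotvBl, dotvBr, dotvZl, dotvZr).

Lemma dotvv_ge0 x : 0 <= dotv x x.
Proof. by apply: sumr_ge0 => i _; rewrite -expr2 sqr_ge0. Qed.

Lemma normv_dotv x : normv x = Num.sqrt (dotv x x).
Proof. by congr Num.sqrt; apply: eq_bigr => i _; rewrite expr2. Qed.

Lemma sqr_normv x : normv x ^+ 2 = dotv x x.
Proof. by rewrite normv_dotv sqr_sqrtr// dotvv_ge0. Qed.

Lemma normv_ge0 x : 0 <= normv x. Proof. exact: sqrtr_ge0. Qed.

Lemma normv0_eq0 x : normv x = 0 -> x = zerov.
Proof.
move=> x0; apply: eq_coord => i; rewrite coordE; apply/eqP; rewrite -sqrf_eq0.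
have : dotv x x == 0 by rewrite -sqr_normv x0 expr0n.
rewrite psumr_eq0 => [/allP/(_ i (mem_index_enum i))|j _]; last first.
  by rewrite -expr2 sqr_ge0.
by rewrite /= -expr2.
Qed.

Lemma normv_zerov : normv zerov = 0.
Proof.
rewrite normv_dotv /dotv big1 ?sqrtr0// => i _.
by rewrite coord_zerov mulr0.
Qed.

Lemma normv_gt0 x : (0 < normv x) = (x != zerov).
Proof.
rewrite lt_neqAle normv_ge0 andbT eq_sym; apply/idP/idP; apply: contraNN.
  by move/eqP->; rewrite normv_zerov.
by move/eqP/normv0_eq0 ->.
Qed.

Lemma normvZ t x : normv (scalev t x) = `|t| * normv x.
Proof.
rewrite !normv_dotv dotvZl dotvZr mulrA -expr2 sqrtrM ?sqr_ge0//.
by rewrite sqrtr_sqr.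
Qed.

(** Expand the square of the norm of |y| x - |x| y. *)
Lemma cauchy_schwarz x y : `|dotv x y| <= normv x * normv y.
Proof.
wlog xy0 : x / 0 <= dotv x y.
  move=> H; have [/H//|/ltW xy0] := leP 0 (dotv x y).
  have := H (scalev (-1) x); rewrite dotvZl normvZ normrM normrN normr1 !mul1r.
  by rewrite mulN1r oppr_ge0; exact.
rewrite ger0_norm//; have [->|x0] := eqVneq x zerov.
  by rewrite normv_zerov mul0r /dotv big1// => i _; rewrite coord_zerov mul0r.
have [->|y0] := eqVneq y zerov.
  by rewrite normv_zerov mulr0 /dotv big1// => i _; rewrite coord_zerov mulr0.
rewrite -normv_gt0 in x0; rewrite -normv_gt0 in y0.
have := dotvv_ge0 (subv (scalev (normv y) x) (scalev (normv x) y)).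
rewrite !dotvE -!sqr_normv (dotvC y x) => H.
have {}H : 0 <= (normv x * normv y) * (normv x * normv y - dotv x y) by nra.
by move: H; rewrite pmulr_rge0 ?mulr_gt0// subr_ge0.
Qed.

Lemma normv_add_le x y : normv (addv x y) <= normv x + normv y.
Proof.
rewrite -(@ler_pXn2r _ 2) ?nnegrE ?addr_ge0 ?normv_ge0//.
rewrite sqr_normv !dotvE sqrrD -!sqr_normv (dotvC y x).
have := le_trans (ler_norm _) (cauchy_schwarz x y); lra.
Qed.

Lemma normv_subC x y : normv (subv x y) = normv (subv y x).
Proof.
rewrite -[RHS]mul1r -(normr1 R) -normrN -normvZ; congr normv.
by apply: eq_coord => i; rewrite !coordE; ring.
Qed.

Lemma subvKC x y : addv y (subv x y) = x.
Proof. by apply: eq_coord => i; rewrite !coordE; ring. Qed.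

Lemma addvKC x y : subv (addv y x) y = x.
Proof. by apply: eq_coord => i; rewrite !coordE; ring. Qed.

Lemma normv_le_sub x y : normv x <= normv y + normv (subv x y).
Proof. by rewrite -{1}(subvKC x y) normv_add_le. Qed.

Lemma normv_sub_le x y : normv (subv x y) <= normv x + normv y.
Proof.
have := normv_add_le x (scalev (-1) y); rewrite normvZ normrN normr1 mul1r.
by congr (normv _ <= _); apply: eq_coord => i; rewrite !coordE; ring.
Qed.

End euclidean_algebra.

Section euclidean_measurability.
Context {R : realType} {d : nat}.
Context d' (T : measurableType d').
Implicit Types f g : T -> Rn R d.

Lemma measurable_coord f i : measurable_fun setT f ->
  measurable_fun setT (fun x => coord (f x) i).
Proof. by move=> mf; exact: (measurableT_comp (measurable_tnth i) mf). Qed.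

Lemma measurable_mktuple (h : 'I_d -> T -> R) :
  (forall i, measurable_fun setT (h i)) ->
  measurable_fun setT (fun x => [tuple h i x | i < d] : Rn R d).
Proof.
move=> mh; apply/measurable_fun_tnthP => i.
by apply: (eq_measurable_fun (h i)) => // x _ /=; rewrite tnth_mktuple.
Qed.

Lemma measurable_dotv f g : measurable_fun setT f -> measurable_fun setT g ->
  measurable_fun setT (fun x => dotv (f x) (g x)).
Proof.
move=> mf mg; apply: measurable_sum => i.
by apply: measurable_funM; exact: measurable_coord.
Qed.

Lemma measurable_normv f : measurable_fun setT f ->
  measurable_fun setT (fun x => normv (f x)).
Proof.
move=> mf; rewrite (_ : (fun _ => _) = (fun x => Num.sqrt (dotv (f x) (f x)))).
  apply: (@measurableT_comp _ _ _ _ _ _ (@Num.sqrt R)); last exact: measurable_dotv.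
  by apply: continuous_measurable_fun; exact: sqrt_continuous.
by apply/funext => x; rewrite normv_dotv.
Qed.

Lemma measurable_subv f g : measurable_fun setT f -> measurable_fun setT g ->
  measurable_fun setT (fun x => subv (f x) (g x)).
Proof.
move=> mf mg; apply: measurable_mktuple => i.
by apply: measurable_funB; exact: measurable_coord.
Qed.

Lemma measurable_addv f g : measurable_fun setT f -> measurable_fun setT g ->
  measurable_fun setT (fun x => addv (f x) (g x)).
Proof.
move=> mf mg; apply: measurable_mktuple => i.
by apply: measurable_funD; exact: measurable_coord.
Qed.

Lemma measurable_scalev (h : T -> R) f :
  measurable_fun setT h -> measurable_fun setT f ->
  measurable_fun setT (fun x => scalev (h x) (f x)).
Proof.
move=> mh mf; apply: measurable_mktuple => i.
by apply: measurable_funM => //; exact: measurable_coord.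
Qed.

Lemma measurable_inv_ge0 (h : T -> R) : (forall x, 0 <= h x) ->
  measurable_fun setT h -> measurable_fun setT (fun x => (h x)^-1).
Proof.
move=> h0 mh; rewrite (_ : (fun _ => _) = (fun x => h x `^ (-1))).
  exact: (measurableT_comp (measurable_powR (-1)) mh).
by apply/funext => x; rewrite powR_inv1.
Qed.

End euclidean_measurability.

Lemma measurable_normvT (R : realType) d :
  measurable_fun setT (fun x : Rn R d => normv x).
Proof. by apply: measurable_normv; exact: measurable_id. Qed.

Section lebesgue_Rn_integration.
Context {R : realType}.
Local Notation leb := (@lebesgue_measure R).

Lemma lebesgue_Rn_tonelli n (F : Rn R n.+1 -> \bar R) :
  measurable_fun setT F -> (forall x, (0 <= F x)%E) ->
  (\int[lebesgue_Rn n.+1]_x F x =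
   \int[leb]_a \int[lebesgue_Rn n]_t F (Rn_cons (a, t)))%E.
Proof.
move=> mF F0; have mc := @measurable_Rn_cons R n.
transitivity (\int[leb \x (lebesgue_Rn n)]_p F (Rn_cons p))%E.
  by rewrite (@ge0_integral_pushforward _ _ _ _ _ _ mc)// => x _; exact: F0.
rewrite fubini_tonelli1//; first exact: measurableT_comp.
Qed.

Lemma measurable_set1v n (y : Rn R n) : measurable [set y].
Proof.
rewrite (_ : [set y] =
    \bigcap_(i in [set: 'I_n]) (fun x => coord x i) @^-1` [set coord y i]).
  apply: fin_bigcap_measurable => // i _.
  by rewrite -[X in measurable X]setTI; apply: (measurable_tnth i).
apply/seteqP; split => [x ->//|x xy]; apply: eq_coord => i.
exact: xy.
Qed.

Lemma lebesgue_Rn_set1 n (y : Rn R n.+1) : lebesgue_Rn n.+1 [set y] = 0%E.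
Proof.
rewrite /= /lebesgue_Rn_succ /pushforward.
rewrite (_ : _ @^-1` _ = [set thead y] `*` [set [tuple of behead y]]).
  rewrite product_measure1E//; last exact: measurable_set1v.
  by rewrite [X in (X * _)%E](lebesgue_measure_set1 (thead y)) mul0e.
apply/seteqP; split => [[a t] /= <-|[a t] [/= -> ->]].
  by split => //=; exact/val_inj.
by rewrite [RHS]tuple_eta; exact/val_inj.
Qed.

Lemma Rn0_unique (x y : Rn R 0) : x = y.
Proof. by apply: eq_coord => -[]. Qed.

(** One coordinate at a time, by the definition of the measure as a product. *)
Lemma lebesgue_Rn_affine n (a : R) (y : Rn R n) : 0 < a ->
  weighted_image (lebesgue_Rn n) (lebesgue_Rn n)
    (fun z => addv (scalev a z) y) (cst (a ^+ n)).
Proof.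
move=> a0; split => //.
- by apply: measurable_addv => //; apply: measurable_scalev => //; exact: measurable_id.
- by move=> z; rewrite /cst exprn_ge0// ltW.
elim: n y => [|n IH] y F mF F0.
  apply: eq_integral => x _; rewrite /cst expr0 mule1; congr (F _).
  exact: Rn0_unique.
have [_ mW _ affE] := lebesgue_affine (coord y ord0) a0.
have mc := @measurable_Rn_cons R n.
have mFc : measurable_fun setT (fun p => F (Rn_cons p)) by exact: measurableT_comp.
rewrite lebesgue_Rn_tonelli//.
rewrite affE; last 2 first.
- exact: (measurable_fun_fubini_tonelli_F (fun p => F (Rn_cons p))).
- by move=> b; apply: integral_ge0 => t _.
have maff : measurable_fun setT (fun z : Rn R n.+1 => addv (scalev a z) y).
  by apply: measurable_addv => //; apply: measurable_scalev => //; exact: measurable_id.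
have mcst k m : measurable_fun [set: Rn R m] (fun z => (cst (a ^+ k) z)%:E).
  exact: (measurable_cst (a ^+ k)%:E).
have an0 k : (0 <= (a ^+ k)%:E)%E by rewrite lee_fin exprn_ge0// ltW.
rewrite [RHS]lebesgue_Rn_tonelli//; last 2 first.
- by apply: emeasurable_funM; [exact: measurableT_comp|exact: mcst].
- by move=> z; rewrite mule_ge0// an0.
apply: eq_integral => b _.
have mFb : measurable_fun setT (fun t => F (Rn_cons (a * b + coord y ord0, t))).
  exact: (measurableT_comp mFc (pair1_measurable (a * b + coord y ord0))).
rewrite (IH [tuple of behead y]); last 2 first.
- exact: mFb.
- by [].
rewrite -ge0_integralZr//; last 3 first.
- apply: emeasurable_funM; last exact: mcst.
  apply: (measurableT_comp mFb).
  by apply: measurable_addv => //; apply: measurable_scalev => //; exact: measurable_id.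
- by move=> t _; rewrite mule_ge0// an0.
- by rewrite lee_fin ltW.
apply: eq_integral => t _; rewrite /cst -muleA -EFinM -exprSr; congr (F _ * _)%E.
apply: eq_coord => i; rewrite !coordE /coord /Rn_cons /=.
case: (unliftP ord0 i) => [j ->|->]; rewrite ?tnthS ?tnth0//.
rewrite tnth_mktuple /coord; congr (_ + _).
  by rewrite tnth_mktuple.
by rewrite [in RHS](tuple_eta y) tnthS.
Qed.

End lebesgue_Rn_integration.

(** * Polar coordinates *)

Section inverse_powers.
Context {R : realType}.
Local Notation leb := (@lebesgue_measure R).

Lemma is_derive1_exprV n (x : R) : 0 < x ->
  is_derive x 1 (fun u : R => u ^- n) (- (n%:R * x ^- n.+1)).
Proof.
move=> x0.
have := is_deriveV (t := n%:R * x ^+ n.-1) (v := 1) _ (is_derive1_expn n x).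
rewrite expf_eq0 (gt_eqF x0) andbF => /(_ isT) dV.
apply: is_derive_eq; rewrite /GRing.scale/= mulNr; congr (- _).
case: n dV => [|n] _; first by rewrite !mul0r mulr0.
rewrite mulrCA; congr (_ * _) => /=.
have xn m : x ^+ m != 0 by rewrite expf_eq0 (gt_eqF x0) andbF.
by rewrite exprS [in RHS]exprS !exprS; field; rewrite xn gt_eqF.
Qed.

Lemma measurable_exprV n : measurable_fun setT (fun u : R => u ^- n).
Proof.
have mpos : measurable_fun setT (fun u : R => 0 < u) by exact: measurable_fun_ltr.
rewrite (_ : (fun _ => _) = (fun u : R => (-1) ^+ (if 0 < u then 0%N else n) * `|u| ^- n)).
  apply: measurable_funM.
    rewrite (_ : (fun _ => _) = (fun u : R => if 0 < u then 1 else (-1) ^+ n)).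
      exact: measurable_fun_ifT.
    by apply/funext => u; case: ifP.
  apply: measurable_inv_ge0; first by move=> u; rewrite exprn_ge0.
  by apply: measurable_funX; exact: normr_measurable.
apply/funext => u; case: ltP => u0; first by rewrite mul1r gtr0_norm.
by rewrite ler0_norm// [(- u) ^+ n]exprNn invfM mulrA mulfV ?signr_eq0// mul1r.
Qed.

Lemma cvg_exprV n : (u : R) ^- n.+1 @[u --> +oo] --> (0 : R).
Proof.
apply/gtr0_cvgV0.
  near=> u; rewrite exprn_gt0//; near: u; exact: nbhs_pinfty_gt.
apply/cvgryPge => M; near=> u.
have u1 : 1 <= u by near: u; apply: nbhs_pinfty_ge; rewrite num_real.
have uM : M <= u by near: u; apply: nbhs_pinfty_ge; rewrite num_real.
by rewrite (le_trans uM)// ler_eXnr.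
Unshelve. all: by end_near. Qed.

Lemma integral_exprV n (r : R) : 0 < r ->
  (\int[leb]_(t in `[r, +oo[) (n.+1%:R * (r ^+ n.+1 * t ^- n.+2))%:E = 1)%E.
Proof.
move=> r0; have rn m : r ^+ m != 0 by rewrite expf_eq0 (gt_eqF r0) andbF.
pose F (t : R) : R := - r ^+ n.+1 * t ^- n.+1.
have dF (t : R) : 0 < t -> is_derive t 1 F (n.+1%:R * (r ^+ n.+1 * t ^- n.+2)).
  move=> t0; have dV := is_derive1_exprV n.+1 t0.
  have -> : F = (- r ^+ n.+1) \*: (fun u : R => u ^- n.+1) by [].
  by apply: is_derive_eq; rewrite /GRing.scale/=; ring.
have cF (t : R) : 0 < t -> {for t, continuous F}.
  move=> t0; apply: differentiable_continuous; apply/derivable1_diffP.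
  by have [] := dF _ t0.
rewrite (@ge0_continuous_FTC2y _ _ F _ 0).
- by rewrite /F mulNr mulfV// -EFinB; congr EFin; ring.
- move=> x rx; rewrite !mulr_ge0// ?exprn_ge0 ?invr_ge0 ?exprn_ge0 ?(ltW r0)//.
  by rewrite (le_trans (ltW r0)).
- apply: continuous_in_subspaceT => x; rewrite inE/= in_itv/= andbT => rx.
  have x0 := lt_le_trans r0 rx.
  apply: cvgM; first exact: cvg_cst.
  apply: cvgM; first exact: cvg_cst.
  have : {for x, continuous (fun u : R => u ^- n.+2)}; last exact.
  apply: differentiable_continuous; apply/derivable1_diffP.
  by have [] := is_derive1_exprV n.+2 x0.
- rewrite -[X in _ --> X](mulr0 (- r ^+ n.+1)).
  by apply: cvgM; [exact: cvg_cst|exact: cvg_exprV].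
- by move=> x rx; have [] := dF _ (lt_trans r0 rx).
- by apply: cvg_at_right_filter; exact: cF.
- move=> x; rewrite in_itv/= andbT => rx.
  have dFx := dF _ (lt_trans r0 rx).
  by rewrite derive1E; exact: derive_val.
Qed.

End inverse_powers.

Section polar.
Context {R : realType} (n : nat).
Let d := n.+1.
Local Notation leb := (@lebesgue_measure R).
Local Notation lebn := (@lebesgue_Rn R d).
Implicit Types x z : Rn R d.

(** A direction is represented by any point of the punctured unit ball that
    normalizes to it. This keeps the sphere out of the change of variables:
    only the volume of the ball appears, d times which is the area. *)
Definition polar_map (p : Rn R d * R) : Rn R d := scalev (p.2 / normv p.1) p.1.

Definition polar_weight (p : Rn R d * R) : R :=
  if (0 < normv p.1 <= 1) && (0 < p.2) then d%:R * p.2 ^+ n else 0.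

Lemma normv_polar_map z s : 0 < normv z -> 0 < s -> normv (polar_map (z, s)) = s.
Proof.
move=> z0 s0; rewrite normvZ/= ger0_norm ?divr_ge0 ?(ltW s0) ?(ltW z0)//.
by rewrite divfK// gt_eqF.
Qed.

Lemma measurable_polar_map : measurable_fun setT polar_map.
Proof.
apply: measurable_scalev => //; apply: measurable_funM => //.
apply: measurable_inv_ge0; first by move=> p; exact: normv_ge0.
exact: measurable_normv.
Qed.

Lemma measurable_polar_weight : measurable_fun setT polar_weight.
Proof.
have mn : measurable_fun setT (fun p : Rn R d * R => normv p.1).
  exact: measurable_normv.
apply: measurable_fun_ifT => //.
  apply: measurable_and; last exact: measurable_fun_ltr.
  exact: measurable_fun_lt_le.
by apply: measurable_funM => //; exact: measurable_funX.
Qed.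

Lemma polar_weight_ge0 p : 0 <= polar_weight p.
Proof.
rewrite /polar_weight; case: ifPn => // /andP[_ p0].
by rewrite mulr_ge0// exprn_ge0// ltW.
Qed.

Let ker (t : R) x : R :=
  if (0 < normv x <= t) && (0 < t) then d%:R * (normv x ^+ d * t ^- d.+1) else 0.

Let ker' (t : R) z : R :=
  if (0 < normv z <= 1) && (0 < t) then d%:R * (normv z ^+ d * t ^+ n) else 0.

Let mker : measurable_fun setT (fun p : R * Rn R d => ker p.1 p.2).
Proof.
have mn : measurable_fun setT (fun p : R * Rn R d => normv p.2).
  exact: measurable_normv.
apply: measurable_fun_ifT => //.
  apply: measurable_and; last exact: measurable_fun_ltr.
  exact: measurable_fun_lt_le.
apply: measurable_funM => //; apply: measurable_funM; first exact: measurable_funX.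
apply: (@measurableT_comp _ _ _ _ _ _ (fun t : R => t ^- d.+1)) => //.
exact: measurable_exprV.
Qed.

Let mker' : measurable_fun setT (fun p : R * Rn R d => ker' p.1 p.2).
Proof.
have mn : measurable_fun setT (fun p : R * Rn R d => normv p.2).
  exact: measurable_normv.
apply: measurable_fun_ifT => //.
  apply: measurable_and; last exact: measurable_fun_ltr.
  exact: measurable_fun_lt_le.
by apply: measurable_funM => //; apply: measurable_funM; exact: measurable_funX.
Qed.

Let ker_ge0 t x : 0 <= ker t x.
Proof.
rewrite /ker; case: ifPn => // /andP[_ t0].
by rewrite !mulr_ge0 ?invr_ge0 ?exprn_ge0 ?normv_ge0 ?(ltW t0).
Qed.

Let ker'_ge0 t x : 0 <= ker' t x.
Proof.
rewrite /ker'; case: ifPn => // /andP[_ t0].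
by rewrite !mulr_ge0 ?exprn_ge0 ?normv_ge0 ?(ltW t0).
Qed.

Let integral_ker x : x != zerov -> (\int[leb]_t (ker t x)%:E = 1)%E.
Proof.
rewrite -normv_gt0 => x0; rewrite -(integral_exprV n x0) [RHS]integral_mkcond.
apply: eq_integral => t _; rewrite patchE /ker x0 /=.
have -> : (t \in `[normv x, +oo[%classic) = (normv x <= t).
  by apply/idP/idP; rewrite inE/= in_itv/= andbT.
case: (leP (normv x) t) => //= xt.
by rewrite (lt_le_trans x0 xt).
Qed.

(** For x != 0 the kernel d |x|^d t^(-d-1) has integral 1 over t >= |x|. Insert
    it under the integral of F, exchange the integrals, and rescale x = t z: the
    condition |x| <= t becomes |z| <= 1. The substitution s = t |z| finally
    makes s the radius of the point at which F is evaluated. *)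
Lemma polar_coordinates :
  weighted_image lebn (lebn \x leb)%E polar_map polar_weight.
Proof.
split; [exact: measurable_polar_map|exact: measurable_polar_weight|
  exact: polar_weight_ge0|].
move=> F mF F0.
have mF1 : measurable_fun setT (fun p : R * Rn R d => (F p.2 * (ker p.1 p.2)%:E)%E).
  by apply: emeasurable_funM; [exact: measurableT_comp|exact/measurable_EFinP].
have mFs : measurable_fun setT (fun p : R * Rn R d => F (scalev p.1 p.2)).
  by apply: measurableT_comp => //; exact: measurable_scalev.
have mF2 : measurable_fun setT
    (fun p : R * Rn R d => (F (scalev p.1 p.2) * (ker' p.1 p.2)%:E)%E).
  by apply: emeasurable_funM => //; exact/measurable_EFinP.
have F1_ge0 p : (0 <= F p.2 * (ker p.1 p.2)%:E)%E by rewrite mule_ge0 ?lee_fin.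
have F2_ge0 (p : R * Rn R d) : (0 <= F (scalev p.1 p.2) * (ker' p.1 p.2)%:E)%E.
  by rewrite mule_ge0 ?lee_fin.
transitivity (\int[lebn]_x \int[leb]_t (F x * (ker t x)%:E))%E.
  apply: ge0_ae_eq_integral => //.
  - exact: (measurable_fun_fubini_tonelli_G (m1 := leb) _ mF1 F1_ge0).
  - by move=> x _; apply: integral_ge0 => t _; exact: (F1_ge0 (t, x)).
  exists [set zerov]; split; [exact: measurable_set1v|exact: lebesgue_Rn_set1|].
  move=> x /= /not_implyP[_ xF]; apply: contrapT => /eqP x0; apply: xF.
  rewrite ge0_integralZl//.
  - by rewrite integral_ker// mule1.
  - apply/measurable_EFinP.
    exact: (measurableT_comp mker (@pair2_measurable _ _ _ _ x)).
  - by move=> t _; rewrite lee_fin.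
rewrite -[LHS](fubini_tonelli (m1 := leb) (m2 := lebn) _ mF1 F1_ge0).
transitivity (\int[leb]_t \int[lebn]_z (F (scalev t z) * (ker' t z)%:E))%E.
  apply: eq_integral => t _.
  have [t0|t0] := leP t 0.
    rewrite !integral0_eq// => x _.
      by rewrite /ker' (ltNge 0 t) t0 andbF mule0.
    by rewrite /ker (ltNge 0 t) t0 andbF mule0.
  have [_ _ _ ->//] := lebesgue_Rn_affine (zerov : Rn R d) t0; last first.
    exact: (measurableT_comp mF1 (@pair1_measurable _ _ _ _ t)).
  apply: eq_integral => z _; rewrite -muleA -EFinM.
  have -> : addv (scalev t z) zerov = scalev t z.
    by apply: eq_coord => i; rewrite !coordE addr0.
  congr (_ * _%:E)%E; rewrite /ker /ker' normvZ (gtr0_norm t0) pmulr_rgt0//.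
  rewrite ger_pMr// t0 !andbT; case: ifPn => [_|]; last by rewrite mul0r.
  rewrite /cst /d exprMn !(exprS t); field.
  by rewrite expf_eq0 (gt_eqF t0) andbF.
rewrite [LHS](fubini_tonelli (m1 := leb) (m2 := lebn) _ mF2 F2_ge0).
transitivity (\int[lebn]_z \int[leb]_s
   (F (polar_map (z, s)) * (polar_weight (z, s))%:E))%E; last first.
  rewrite fubini_tonelli1//.
    apply: emeasurable_funM; last first.
      by apply/measurable_EFinP; exact: measurable_polar_weight.
    exact: (measurableT_comp mF measurable_polar_map).
  by move=> p; rewrite mule_ge0 ?lee_fin ?polar_weight_ge0.
apply: eq_integral => z _; rewrite /ker' /polar_weight /=.
have [zB|zB] := boolP (0 < normv z <= 1); last first.
  by rewrite !integral0_eq// => t _; rewrite mule0.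
have z0 : 0 < normv z by case/andP: zB.
have iz0 : 0 < (normv z)^-1 by rewrite invr_gt0.
have [_ _ _ ->] := lebesgue_affine 0 iz0; last 2 first.
- have : measurable_fun setT (fun t : R => (F (scalev t z) * (ker' t z)%:E)%E).
    exact: (measurableT_comp mF2 (@pair2_measurable _ _ _ _ z)).
  by rewrite /ker' zB.
- by move=> t; have := F2_ge0 (t, z); rewrite /ker' /= zB.
apply: eq_integral => s _; rewrite addr0 -muleA -EFinM (mulrC _ s).
congr (_ * _%:E)%E; rewrite pmulr_lgt0//; case: ifPn => [s0|]; last by rewrite mul0r.
rewrite /cst expr_div_n exprS; field.
by rewrite expf_eq0 (gt_eqF z0) andbF.
Qed.

End polar.

Section radial_integration.
Context {R : realType} (n : nat).
Let d := n.+1.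
Local Notation leb := (@lebesgue_measure R).
Local Notation lebn := (@lebesgue_Rn R d).
Local Notation sigma := (sphere_area R d).

Lemma cone_unit_sphereE : cone unit_sphere = [set x : Rn R d | 0 < normv x <= 1].
Proof.
apply/seteqP; split => x /=.
  move=> [t [u [/andP[t0 t1] u1 ->]]].
  by rewrite normvZ u1 mulr1 gtr0_norm// t0.
move=> /andP[x0 x1]; exists (normv x), (scalev (normv x)^-1 x); split.
- by rewrite x0.
- by rewrite /unit_sphere/= normvZ gtr0_norm ?invr_gt0// mulVf// gt_eqF.
- by apply: eq_coord => i; rewrite !coordE mulrA divff ?mul1r// gt_eqF.
Qed.

Lemma measurable_cone_unit_sphere : measurable (cone (@unit_sphere R d)).
Proof.
rewrite cone_unit_sphereE.
have mn : measurable_fun setT (fun x : Rn R d => normv x).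
  exact: measurable_normvT.
rewrite -[X in measurable X]setTI.
have mb : measurable_fun setT (fun x : Rn R d => 0 < normv x <= 1).
  exact: measurable_fun_lt_le.
exact: (mb measurableT [set true]).
Qed.

Lemma radial_integral_surface (f : R -> \bar R) : measurable_fun setT f ->
  (forall s, (0 <= f s)%E) ->
  (\int[lebn]_x f (normv x) = @surface_measure R d unit_sphere *
     \int[leb]_s (f s * (if 0 < s then s ^+ n else 0)%:E))%E.
Proof.
move=> mf f0; have [mP mW W0 polarE] := @polar_coordinates R n.
have mn : measurable_fun setT (fun x : Rn R d => normv x).
  exact: measurable_normvT.
have mfn : measurable_fun setT (fun x : Rn R d => f (normv x)).
  exact: measurableT_comp.
rewrite polarE//.
rewrite fubini_tonelli1; last 2 first.
- apply: emeasurable_funM; first exact: (measurableT_comp mfn mP).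
  by apply/measurable_EFinP.
- by move=> p; rewrite mule_ge0 ?lee_fin.
rewrite /fubini_F; set I := (X in (_ * X)%E).
have I0 : (0 <= I)%E.
  apply: integral_ge0 => s _; rewrite mule_ge0// lee_fin.
  by case: ifPn => // /ltW s0; rewrite exprn_ge0.
have mfs : measurable_fun setT (fun s => f s * (if 0 < s then s ^+ n else 0)%:E)%E.
  apply: emeasurable_funM => //; apply/measurable_EFinP.
  apply: measurable_fun_ifT => //; exact: measurable_fun_ltr.
transitivity (\int[lebn]_z ((d%:R%:E * I) * (\1_(cone (@unit_sphere R d)) z)%:E))%E.
  apply: eq_integral => z _; rewrite indicE cone_unit_sphereE.
  have -> : (z \in [set x : Rn R d | 0 < normv x <= 1]) = (0 < normv z <= 1).
    by apply/idP/idP; rewrite inE.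
  rewrite /polar_weight/=.
  have [zB|zB] := boolP (0 < normv z <= 1); last first.
    by rewrite integral0_eq ?mule0// => s _; rewrite /= mule0.
  have z0 : 0 < normv z by case/andP: zB.
  rewrite mule1 -ge0_integralZl//; last first.
    move=> s _; rewrite mule_ge0// lee_fin.
    by case: ifPn => // /ltW s0; rewrite exprn_ge0.
  apply: eq_integral => s _ /=; case: ifPn => s0; last by rewrite !mule0.
  by rewrite normv_polar_map// EFinM muleCA.
rewrite ge0_integralZl//; last 2 first.
- by apply/measurable_EFinP/measurable_indicP; exact: measurable_cone_unit_sphere.
- by rewrite mule_ge0.
rewrite integral_indic//; last exact: measurable_cone_unit_sphere.
by rewrite setIT -muleA (muleC I) muleA.
Qed.

Lemma integral_gauss_Rn k :
  (\int[lebesgue_Rn k]_x (expR (- normv x ^+ 2))%:E = (Num.sqrt pi ^+ k)%:E :> \bar R)%E.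
Proof.
have mg m : measurable_fun setT (fun x : Rn R m => (expR (- normv x ^+ 2))%:E).
  apply/measurable_EFinP; apply: measurableT_comp => //.
  apply: measurable_funN; apply: measurable_funX; apply: measurable_normv.
  exact: measurable_id.
elim: k => [|k IH].
  rewrite /= integral_dirac//; last exact: mg.
  rewrite diracT mul1e sqr_normv /dotv big_ord0 oppr0 expR0.
  by rewrite expr0.
rewrite lebesgue_Rn_tonelli; [|exact: mg|by move=> x; rewrite lee_fin expR_ge0].
transitivity (\int[leb]_a ((expR (- a ^+ 2))%:E * (Num.sqrt pi ^+ k)%:E))%E.
  apply: eq_integral => a _; rewrite -IH -ge0_integralZl//; last exact: mg.
  apply: eq_integral => t _; rewrite -EFinM -expRD; congr (expR _)%:E.
  rewrite !sqr_normv /dotv big_ord_recl /coord tnth0.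
  rewrite -opprD expr2; congr (- (_ + _)).
  by apply: eq_bigr => i _; rewrite tnthS.
rewrite ge0_integralZr//.
- by rewrite integralT_gauss -EFinM exprS.
- by apply/measurable_EFinP; exact: measurable_gauss_fun.
Qed.

(** The integral of the Gaussian is known from its product structure. Written
    in polar coordinates it determines the area of the sphere, which is thereby
    seen to be positive and finite. *)
Lemma gauss_surface : (@surface_measure R d unit_sphere *
  \int[leb]_s ((expR (- s ^+ 2))%:E * (if 0 < s then s ^+ n else 0)%:E) =
  (Num.sqrt pi ^+ d)%:E)%E.
Proof.
rewrite -integral_gauss_Rn; apply/esym.
apply: (@radial_integral_surface (fun s : R => (expR (- s ^+ 2))%:E)).
  by apply/measurable_EFinP; exact: measurable_gauss_fun.
by move=> s; rewrite lee_fin expR_ge0.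
Qed.

Lemma surface_measure_gt0_fin :
  @surface_measure R d unit_sphere = sigma%:E /\ 0 < sigma.
Proof.
have S0 : (0 <= @surface_measure R d unit_sphere)%E by rewrite mule_ge0.
have := gauss_surface; set I := integral _ _ _ => SI.
have I0 : (0 <= I)%E.
  apply: integral_ge0 => s _; rewrite mule_ge0// lee_fin ?expR_ge0//.
  by case: ifPn => // /ltW s0; rewrite exprn_ge0.
have pi0 : 0 < Num.sqrt (pi : R) ^+ d by rewrite exprn_gt0// sqrtr_gt0 pi_gt0.
have In0 : I != 0%E.
  by apply/eqP => I00; move: SI; rewrite I00 mule0 => -[]; lra.
have Sn0 : @surface_measure R d unit_sphere != 0%E.
  by apply/eqP => S00; move: SI; rewrite S00 mul0e => -[]; lra.
have Sfin : @surface_measure R d unit_sphere \is a fin_num.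
  rewrite ge0_fin_numE// ltNge leye_eq; apply/negP => /eqP Soo.
  by move: SI; rewrite Soo gt0_mulye// lt_neqAle eq_sym In0.
split; first by rewrite fineK.
by rewrite fine_gt0// lt_neqAle eq_sym Sn0 S0 -ge0_fin_numE.
Qed.

Lemma sphere_area_gt0 : 0 < sigma. Proof. by have [] := surface_measure_gt0_fin. Qed.

Lemma radial_integral (f : R -> \bar R) : measurable_fun setT f ->
  (forall s, (0 <= f s)%E) ->
  (\int[lebn]_x f (normv x) =
     \int[leb]_s (f s * (if 0 < s then sigma * s ^+ n else 0)%:E))%E.
Proof.
move=> mf f0; rewrite radial_integral_surface//.
have [-> s0] := surface_measure_gt0_fin.
rewrite -ge0_integralZl//; last 3 first.
- apply: emeasurable_funM => //; apply/measurable_EFinP.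
  by apply: measurable_fun_ifT => //; exact: measurable_fun_ltr.
- move=> s _; rewrite mule_ge0// lee_fin.
  by case: ifPn => // /ltW ?; rewrite exprn_ge0.
- by rewrite lee_fin ltW.
apply: eq_integral => s _; rewrite muleCA -EFinM.
by congr (_ * _%:E)%E; case: ifP => _; rewrite ?mulr0.
Qed.

Lemma radial_Rintegral (f : R -> R) : measurable_fun setT f ->
  lebn.-integrable setT (fun x => (f (normv x))%:E) ->
  leb.-integrable setT (fun s => (f s * (if 0 < s then sigma * s ^+ n else 0))%:E) /\
  \int[lebn]_x f (normv x) =
     \int[leb]_s (f s * (if 0 < s then sigma * s ^+ n else 0)).
Proof.
move=> mf intf.
have mn : measurable_fun setT (fun x : Rn R d => normv x).
  exact: measurable_normvT.
have W : weighted_image (pushforward lebn (fun x : Rn R d => normv x)) leb id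
    (fun s => if 0 < s then sigma * s ^+ n else 0).
  split => //.
  - apply: measurable_fun_ifT => //; first exact: measurable_fun_ltr.
    exact: measurable_funM.
  - move=> s; case: ifPn => // /ltW s0; rewrite mulr_ge0 ?exprn_ge0//.
    by rewrite ltW// sphere_area_gt0.
  - move=> F mF F0; rewrite ge0_integral_pushforward//.
    by rewrite -radial_integral// preimage_setT.
have intf' : (pushforward lebn (fun x : Rn R d => normv x)).-integrable setT (EFin \o f).
  by apply/integrable_pushforward => //; exact/measurable_EFinP.
split; first exact: (weighted_image_integrable (W mn) intf').
rewrite -(weighted_image_Rintegral (W mn) intf'); congr fine.
rewrite [RHS](integral_pushforward mn)//; exact/measurable_EFinP.
Qed.

End radial_integration.

(** * Gauss' law *)

Section ray_integral.
Context {R : realType}.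
Local Notation leb := (@lebesgue_measure R).

Lemma integrable_bounded_support (f : R -> R) (C r : R) :
  measurable_fun setT f -> (forall s, `|f s| <= C) ->
  (forall s, r < `|s| -> f s = 0) -> leb.-integrable setT (EFin \o f).
Proof.
move=> mf fC f0.
have I : leb.-integrable `[- r, r] (EFin \o f).
  apply: measurable_bounded_integrable => //.
  - by rewrite /= lebesgue_measure_itv; case: ifP => _; rewrite ?ltry.
  - exact: measurable_funTS.
  - exists C; split; first exact: num_real.
    by move=> M CM s _; rewrite /= (le_trans (fC s))// ltW.
move: I; rewrite integrable_mkcond//; congr (_.-integrable _ _).
apply/funext => s; rewrite patchE; case: ifPn => // /negP rs.
rewrite /= f0// ltNge; apply/negP => sr; apply: rs.
by rewrite inE/= in_itv/= -ler_norml.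
Qed.

Lemma Rintegral_reflect_odd (f : R -> R) : leb.-integrable setT (EFin \o f) ->
  (forall s, f (- s) = - f s) -> \int[leb]_s f s = 0.
Proof.
move=> intf fN; have := weighted_image_Rintegral lebesgue_opp intf.
under [X in _ = X]eq_Rintegral do rewrite fN mulr1 -mulN1r.
by rewrite RintegralZl//; lra.
Qed.

Lemma eq_Rintegral_off (f g : R -> R) (a : R) : leb.-integrable setT (EFin \o f) ->
  leb.-integrable setT (EFin \o g) ->
  (forall s, s != a -> f s = g s) -> \int[leb]_s f s = \int[leb]_s g s.
Proof.
move=> intf intg fg; congr fine; apply: ae_eq_integral => //.
- exact: measurable_int intf.
- exact: measurable_int intg.
exists [set a]; split; [exact: measurable_set1|exact: lebesgue_measure_set1|].
move=> s /= /not_implyP[_ fgs]; apply: contrapT => /eqP sa; apply: fgs.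
by rewrite fg.
Qed.

Section bounded_profile.
Variables (alpha : R -> R) (C r : R).
Hypotheses (malpha : measurable_fun setT alpha).
Hypotheses (alphaC : forall s, `|alpha s| <= C) (alpha0 : forall s, r < s -> alpha s = 0).

Let msqrt : measurable_fun setT (@Num.sqrt R).
Proof. by apply: continuous_measurable_fun; exact: sqrt_continuous. Qed.

Let C0 : 0 <= C. Proof. exact: le_trans (alphaC 0). Qed.

(** On the ray from y in the unit direction w, with b = y.w, the squared norm is
    c + (s + b)^2 where c + b^2 = |y|^2. After the shift u = s + b the integrand
    is odd in u, so that a negative b may be replaced by |b|; then u |-> c + u^2
    turns c + b^2 < c + u^2 into a condition on the norm alone. The value
    depends on the ray only through |y|. *)
Lemma ray_integral (c b : R) : 0 <= c ->
  leb.-integrable setT (fun s => (if 0 < s then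
    alpha (Num.sqrt (c + (s + b) ^+ 2)) * (s + b) else 0)%:E) /\
  \int[leb]_s (if 0 < s then alpha (Num.sqrt (c + (s + b) ^+ 2)) * (s + b) else 0) =
  \int[leb]_s (if Num.sqrt (c + b ^+ 2) < s then alpha s * s else 0).
Proof.
move=> c0.
pose h (P : pred R) u := if P u then alpha (Num.sqrt (c + u ^+ 2)) * u else 0.
have large u : r < `|u| -> alpha (Num.sqrt (c + u ^+ 2)) = 0.
  move=> ru; apply: alpha0; rewrite (lt_le_trans ru)// -sqrtr_sqr.
  by rewrite ler_wsqrtr// lerDr.
have inth P : measurable_fun setT P -> leb.-integrable setT (EFin \o h P).
  move=> mP; apply: (@integrable_bounded_support _ (C * `|r|) r).
  - apply: measurable_fun_ifT => //; apply: measurable_funM => //.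
    apply: measurableT_comp => //; apply: measurableT_comp => //.
    by apply: measurable_funD => //; exact: measurable_funX.
  - move=> s; rewrite /h; case: ifPn => _; last by rewrite normr0 mulr_ge0.
    have [sr|/large ->] := leP `|s| r; last by rewrite mul0r normr0 mulr_ge0.
    by rewrite normrM ler_pM// (le_trans sr)// ler_norm.
  - by move=> s /large hs; rewrite /h hs mul0r if_same.
have mgt a : measurable_fun setT (fun u : R => a < u).
  exact: measurable_fun_ltr.
have mge a : measurable_fun setT (fun u : R => a <= u).
  exact: measurable_fun_ler.
have mlt a : measurable_fun setT (fun u : R => u < a).
  exact: measurable_fun_ltr.
have hE s : h (fun u => b < u) (1 * s + b) * cst 1 s =
    if 0 < s then alpha (Num.sqrt (c + (s + b) ^+ 2)) * (s + b) else 0.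
  by rewrite mulr1 mul1r /h -ltrBlDr subrr.
split.
  have := weighted_image_integrable (lebesgue_affine b ltr01) (inth _ (mgt b)).
  by congr (_.-integrable _ _); apply/funext => s /=; rewrite hE.
transitivity (\int[leb]_u h (fun u => b < u) u).
  rewrite (weighted_image_Rintegral (lebesgue_affine b ltr01) (inth _ (mgt b))).
  by apply: eq_Rintegral => s _; rewrite hE.
transitivity (\int[leb]_u h (fun u => `|b| < u) u).
  have [b0|b0] := leP 0 b; first by rewrite ger0_norm.
  have mb : measurable_fun setT (fun u : R => b < u < - b) by exact: measurable_and.
  transitivity (\int[leb]_u (h (fun u => b < u < - b) u + h (fun u => - b <= u) u)).
    apply: eq_Rintegral => u _; rewrite /h.
    case: (ltP u (- b)) => ub; first by rewrite andbT addr0.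
    rewrite andbF add0r ifT//; lra.
  rewrite RintegralD//; [|exact: inth|exact: inth].
  rewrite [X in X + _]Rintegral_reflect_odd ?add0r; last 2 first.
  - exact: inth.
  - move=> s; rewrite /h sqrrN ltrN2 ltrNr andbC mulrN.
    by case: ifP => _; rewrite ?oppr0.
  rewrite ltr0_norm//; apply: (@eq_Rintegral_off _ _ (- b)); [exact: inth|exact: inth|].
  by move=> s sb; rewrite /h le_eqVlt eq_sym (negbTE sb).
pose G (v : R) : R := if c + b ^+ 2 < v then alpha (Num.sqrt v) / 2 else 0.
have intG : leb.-integrable setT (EFin \o G).
  apply: (@integrable_bounded_support _ C (r ^+ 2)).
  - apply: measurable_fun_ifT => //; apply: measurable_funM => //.
    exact: measurableT_comp.
  - move=> v; rewrite /G; case: ifPn => _; last by rewrite normr0.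
    have := alphaC (Num.sqrt v); rewrite normrM [`|2^-1|]ger0_norm//.
    have := normr_ge0 (alpha (Num.sqrt v)); lra.
  - move=> v rv; rewrite /G; case: ifPn => // cv.
    have v0 : 0 < v by rewrite (le_lt_trans _ cv)// addr_ge0 ?sqr_ge0.
    rewrite gtr0_norm// in rv; rewrite alpha0 ?mul0r//.
    by rewrite (le_lt_trans (ler_norm r))// -sqrtr_sqr ltr_sqrt.
transitivity (\int[leb]_v G v).
  rewrite (weighted_image_Rintegral (lebesgue_affine c ltr01) intG).
  have intGc := weighted_image_integrable (lebesgue_affine c ltr01) intG.
  rewrite (weighted_image_Rintegral lebesgue_sqr_or_id intGc).
  apply: eq_Rintegral => u _; rewrite /h /G /sqr_or_id mul1r /cst mulr1.
  have [u0|u0] := ltP 0 u.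
    have -> : (c + b ^+ 2 < u ^+ 2 + c) = (`|b| < u).
      rewrite (addrC (u ^+ 2)) ltrD2l -(real_normK (num_real b)).
      by rewrite ltr_pXn2r ?nnegrE// ltW.
    by rewrite (addrC (u ^+ 2)); case: ifP => _; [field|rewrite mul0r].
  rewrite ltNge (le_trans u0)//= ifF ?mul0r//; apply/negbTE; rewrite -leNgt.
  by have := sqr_ge0 b; lra.
rewrite (weighted_image_Rintegral lebesgue_sqr_or_id intG).
apply: eq_Rintegral => u _; rewrite /G /sqr_or_id.
have cb0 : 0 <= c + b ^+ 2 by rewrite addr_ge0 ?sqr_ge0.
have [u0|u0] := ltP 0 u.
  have -> : (c + b ^+ 2 < u ^+ 2) = (Num.sqrt (c + b ^+ 2) < u).
    by rewrite -(ltr_sqrt _ (exprn_gt0 2 u0)) sqrtr_sqr (ger0_norm (ltW u0)).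
  rewrite sqrtr_sqr (ger0_norm (ltW u0)).
  by case: ifP => _; [field|rewrite mul0r].
rewrite !ifF ?mul0r//; apply/negbTE; rewrite -leNgt (le_trans u0)//.
Qed.

End bounded_profile.
End ray_integral.

Section riesz_kernel.
Context {R : realType} (n : nat).
Let d := n.+1.
Local Notation leb := (@lebesgue_measure R).
Local Notation lebn := (@lebesgue_Rn R d).
Local Notation sigma := (sphere_area R d).
Implicit Types x y z : Rn R d.

Lemma lebesgue_Rn_translate y : weighted_image lebn lebn (addv y) (cst 1).
Proof.
have := lebesgue_Rn_affine y ltr01; rewrite expr1n.
congr (weighted_image _ _ _ _); apply/funext => z.
by apply: eq_coord => i; rewrite !coordE mul1r addrC.
Qed.

Let mnormv : measurable_fun setT (fun x : Rn R d => normv x).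
Proof. exact: measurable_normvT. Qed.

Let msubv y : measurable_fun setT (fun x : Rn R d => subv x y).
Proof. by apply: measurable_subv => //; exact: measurable_id. Qed.

Lemma measurable_normv_exprV k (d' : measure_display) (T : measurableType d')
    (f : T -> Rn R d) : measurable_fun setT f ->
  measurable_fun setT (fun t => normv (f t) ^- k).
Proof.
move=> mf; apply: measurable_inv_ge0; first by move=> t; rewrite exprn_ge0// normv_ge0.
by apply: measurable_funX; exact: measurable_normv.
Qed.

(** After a translation by y the ball lies in the one of radius r + |y|, on which
    the Jacobian of polar coordinates cancels the singularity. *)
Lemma riesz_ball_le y (r : R) : 0 <= r ->
  (\int[lebn]_x (if normv x <= r then normv (subv x y) ^- n else 0)%:E <=
   (sigma * (r + normv y))%:E)%E.
Proof.
move=> r0; have ry0 : 0 <= r + normv y by rewrite addr_ge0 ?normv_ge0.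
have [_ _ _ ->] := lebesgue_Rn_translate y; last 2 first.
- apply/measurable_EFinP; apply: measurable_fun_ifT => //.
    exact: measurable_fun_ler.
  exact: measurable_normv_exprV.
- by move=> x; rewrite lee_fin; case: ifP => // _; rewrite invr_ge0 exprn_ge0 ?normv_ge0.
pose g (s : R) : \bar R := (if s <= r + normv y then s ^- n else 0)%:E.
have mg : measurable_fun setT (fun s : R => if s <= r + normv y then `|s| ^- n else 0).
  apply: measurable_fun_ifT => //; first exact: measurable_fun_ler.
  apply: measurable_inv_ge0; first by move=> u; rewrite exprn_ge0.
  by apply: measurable_funX; exact: normr_measurable.
apply: (@le_trans _ _
   (\int[lebn]_z (if normv z <= r + normv y then `|normv z| ^- n else 0)%:E)%E).
  apply: ge0_le_integral => //.
  - move=> z _; rewrite mule1 lee_fin; case: ifP => // _.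
    by rewrite invr_ge0 exprn_ge0 ?normv_ge0.
  - rewrite (_ : (fun _ => _) = (fun z => (if normv (addv y z) <= r then normv z ^- n else 0)%:E)).
      apply/measurable_EFinP; apply: measurable_fun_ifT => //.
        apply: measurable_fun_ler => //; apply: measurable_normv.
        by apply: measurable_addv => //; exact: measurable_id.
      by apply: measurable_normv_exprV; exact: measurable_id.
    by apply/funext => z; rewrite mule1 addvKC.
  - apply/measurable_EFinP; exact: (measurableT_comp mg mnormv).
  move=> z _; rewrite mule1 lee_fin addvKC ger0_norm ?normv_ge0//.
  case: ifPn => zr; last by case: ifP => // _; rewrite invr_ge0 exprn_ge0 ?normv_ge0.
  rewrite ifT//; have := normv_le_sub z (addv y z).
  have -> : normv (subv z (addv y z)) = normv y; last lra.
  rewrite normv_subC; congr normv.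
  by apply: eq_coord => i; rewrite !coordE; ring.
rewrite (radial_integral n (f := fun s => (if s <= r + normv y then `|s| ^- n else 0)%:E)); last 2 first.
- exact/measurable_EFinP.
- by move=> s; rewrite lee_fin; case: ifP => // _; rewrite invr_ge0 exprn_ge0.
have s0 := @sphere_area_gt0 R n.
have J (q : R) : 0 <= q -> (\int[leb]_(s in `[0%R, q]) sigma%:E = (sigma * q)%:E)%E.
  move=> q0; rewrite integral_cst//= lebesgue_measure_itv/= lte_fin.
  case: ltP => [_|ry]; first by rewrite oppr0 adde0.
  have -> : q = 0 by apply/eqP; rewrite eq_le ry.
  by rewrite mule0 mulr0.
rewrite -J// [leRHS]integral_mkcond; apply: ge0_le_integral => //.
- move=> s _; rewrite -EFinM lee_fin mulr_ge0//.
    by case: ifP => // _; rewrite invr_ge0 exprn_ge0.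
  by case: ifPn => // u0; rewrite mulr_ge0 ?exprn_ge0 ?ltW.
- rewrite (_ : (fun _ => _) = EFin \o (fun s => (if s <= r + normv y then `|s| ^- n else 0) * (if 0 < s then sigma * s ^+ n else 0)))//.
  apply/measurable_EFinP; apply: measurable_funM => //.
  apply: measurable_fun_ifT => //; first exact: measurable_fun_ltr.
  by apply: measurable_funM => //; exact: measurable_funX.
- apply/(measurable_restrictT (cst sigma%:E)); first exact: measurable_itv.
  exact: measurable_cst.
move=> s _; rewrite patchE -EFinM.
have [s0'|s0'] := ltP 0 s; last first.
  by rewrite mulr0; case: ifP => // _; rewrite lee_fin ltW.
case: ifPn => sr; last by rewrite mul0r; case: ifP => // _; rewrite lee_fin ltW.
rewrite ifT; last by rewrite inE/= in_itv/= (ltW s0').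
rewrite lee_fin gtr0_norm// mulrCA mulVf ?mulr1//.
by rewrite expf_eq0 gt_eqF ?andbF.
Qed.

End riesz_kernel.

Section gauss_law.
Context {R : realType} (n : nat).
Let d := n.+1.
Local Notation leb := (@lebesgue_measure R).
Local Notation lebn := (@lebesgue_Rn R d).
Local Notation sigma := (sphere_area R d).
Implicit Types x y z : Rn R d.

Lemma riesz_integrable (k : Rn R d -> R) y (C r : R) : 0 <= r -> 0 <= C ->
  measurable_fun setT k ->
  (forall x, `|k x| <= C * (if normv x <= r then normv (subv x y) ^- n else 0)) ->
  lebn.-integrable setT (EFin \o k) /\
  (\int[lebn]_x `|k x|%:E <= (C * (sigma * (r + normv y)))%:E)%E.
Proof.
move=> r0 C0 mk kC.
have mK : measurable_fun setT
    (fun x => (if normv x <= r then normv (subv x y) ^- n else 0)).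
  apply: measurable_fun_ifT => //.
    apply: measurable_fun_ler => //; apply: measurable_normv; exact: measurable_id.
  apply: measurable_normv_exprV; apply: measurable_subv => //; exact: measurable_id.
have K0 x : 0 <= (if normv x <= r then normv (subv x y) ^- n else 0).
  by case: ifP => // _; rewrite invr_ge0 exprn_ge0 ?normv_ge0.
have B : (\int[lebn]_x `|k x|%:E <= (C * (sigma * (r + normv y)))%:E)%E.
  apply: (@le_trans _ _ (\int[lebn]_x (C%:E *
      (if normv x <= r then normv (subv x y) ^- n else 0)%:E))%E).
    apply: ge0_le_integral => //.
    - by apply/measurable_EFinP; exact: measurableT_comp.
    - by apply: emeasurable_funM => //; exact/measurable_EFinP.
    - by move=> x _; rewrite -EFinM lee_fin.
  rewrite ge0_integralZl//; last 2 first.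
  - exact/measurable_EFinP.
  - by move=> x _; rewrite lee_fin.
  by rewrite EFinM lee_wpmul2l ?lee_fin ?riesz_ball_le.
split => //; apply/integrableP; split; first exact/measurable_EFinP.
by rewrite (le_lt_trans B)// ltry.
Qed.

Lemma dotv_exprV_le x z : `|dotv x z * normv z ^- d| <= normv x * normv z ^- n.
Proof.
rewrite normrM [`|_ ^- _|]ger0_norm ?invr_ge0 ?exprn_ge0 ?normv_ge0//.
have [z0|z0] := eqVneq (normv z) 0.
  by rewrite z0 /d exprS mul0r invr0 mulr0 mulr_ge0 ?normv_ge0 ?invr_ge0 ?exprn_ge0.
have zp : 0 < normv z by rewrite lt_neqAle eq_sym z0 normv_ge0.
rewrite ler_pdivrMr ?exprn_gt0// (le_trans (cauchy_schwarz x z))//.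
rewrite /d exprS -mulrA ler_wpM2l ?normv_ge0// mulrCA mulVf ?mulr1//.
by rewrite expf_eq0 (negbTE z0) andbF.
Qed.

Section profile.
Variables (alpha : R -> R) (C r : R).
Hypotheses (malpha : measurable_fun setT alpha) (r0 : 0 <= r).
Hypotheses (alphaC : forall s, `|alpha s| <= C) (alpha0 : forall s, r < s -> alpha s = 0).

(** Up to the factor - 1 / sigma, the vector field alpha(|x|) x paired with the
    gradient at x of the potential of a unit charge at y. *)
Definition flux_density y x : R :=
  alpha (normv x) * (dotv x (subv x y) * normv (subv x y) ^- d).

Let C0 : 0 <= C. Proof. exact: le_trans (alphaC 0). Qed.

Lemma measurable_flux_density :
  measurable_fun setT (fun p : Rn R d * Rn R d => flux_density p.2 p.1).
Proof.
have ms : measurable_fun setT (fun p : Rn R d * Rn R d => subv p.1 p.2).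
  exact: measurable_subv.
apply: measurable_funM.
  by apply: measurableT_comp => //; exact: measurable_normv.
by apply: measurable_funM; [exact: measurable_dotv|exact: measurable_normv_exprV].
Qed.

Lemma flux_density_le y x : `|flux_density y x| <=
  (C * r) * (if normv x <= r then normv (subv x y) ^- n else 0).
Proof.
rewrite /flux_density normrM; case: ifPn => [xr|]; last first.
  by rewrite -ltNge => /alpha0 ->; rewrite normr0 mul0r mulr0.
rewrite -mulrA ler_pM// (le_trans (dotv_exprV_le _ _))//.
by rewrite ler_wpM2r// invr_ge0 exprn_ge0// normv_ge0.
Qed.

Lemma integrable_flux_density y :
  lebn.-integrable setT (EFin \o flux_density y).
Proof.
have [] // := @riesz_integrable (flux_density y) y (C * r) r r0.
- by rewrite mulr_ge0.
- exact: (measurableT_comp measurable_flux_density (@pair2_measurable _ _ _ _ y)).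
- exact: flux_density_le.
Qed.

(** In polar coordinates centred at y the Jacobian cancels |x - y|^(1 - d), and
    by [ray_integral] every ray contributes the same amount. This is the weak
    form of the statement that a sphere of radius s emits flux exactly from the
    charges that it encloses. *)
Lemma gauss_law y : \int[lebn]_x flux_density y x =
  sigma * \int[leb]_s (if normv y < s then alpha s * s else 0).
Proof.
have int1 := integrable_flux_density y.
rewrite (weighted_image_Rintegral (lebesgue_Rn_translate y) int1).
have int2 := weighted_image_integrable (lebesgue_Rn_translate y) int1.
rewrite (weighted_image_Rintegral (@polar_coordinates R n) int2).
have int3 := weighted_image_integrable (@polar_coordinates R n) int2.
rewrite (Rintegral_prod int3).
set J := (X in sigma * X).
have [Sfin s0] := @surface_measure_gt0_fin R n.
have mB := @measurable_cone_unit_sphere R n.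
transitivity (\int[lebn]_z ((d%:R * J) * \1_(cone (@unit_sphere R d)) z)); last first.
  have dB : (d%:R%:E * lebn (cone (@unit_sphere R d)) = sigma%:E)%E by [].
  have Bfin : (lebn (cone (@unit_sphere R d)) < +oo)%E.
    rewrite ltNge leye_eq; apply/negP => /eqP Boo.
    by move: dB; rewrite Boo gt0_muley// lte_fin.
  rewrite RintegralZl//; last first.
    apply/integrableP; split; first exact/measurable_EFinP/measurable_indicP.
    under eq_integral do rewrite /= ger0_norm//.
    by rewrite integral_indic// setIT.
  rewrite (_ : \int[lebn]_z _ = fine (lebn (cone (@unit_sphere R d)))); last first.
    by rewrite /Rintegral integral_indic// setIT.
  rewrite mulrAC; congr (_ * _).
  by rewrite -[RHS]/(fine sigma%:E) -dB fineM// ge0_fin_numE.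
apply: eq_Rintegral => z _.
rewrite indicE cone_unit_sphereE.
have -> : (z \in [set x : Rn R d | 0 < normv x <= 1]) = (0 < normv z <= 1).
  by apply/idP/idP; rewrite inE.
rewrite /polar_weight/=.
have [zB|zB] := boolP (0 < normv z <= 1); last first.
  by under eq_Rintegral do rewrite mulr0; rewrite Rintegral_cst// mul0r mulr0.
rewrite mulr1.
have z0 : 0 < normv z by case/andP: zB.
have [w wE] : exists w, w = scalev (normv z)^-1 z by eexists.
have w1 : normv w = 1 by rewrite wE normvZ gtr0_norm ?invr_gt0// mulVf// gt_eqF.
have ww : dotv w w = 1 by rewrite -sqr_normv w1 expr1n.
pose b := dotv y w; pose c := dotv y y - b ^+ 2.
have c0 : 0 <= c.
  rewrite subr_ge0 -sqr_normv -(real_normK (num_real b)) lerXn2r ?nnegrE ?normv_ge0//.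
  by have := cauchy_schwarz y w; rewrite w1 mulr1.
have yE : normv y = Num.sqrt (c + b ^+ 2) by rewrite subrK normv_dotv.
have [Iint Jint] := ray_integral malpha alphaC alpha0 b c0.
rewrite -yE -/J in Jint.
transitivity (\int[leb]_s (d%:R * (if 0 < s then
    alpha (Num.sqrt (c + (s + b) ^+ 2)) * (s + b) else 0))); last first.
  by rewrite RintegralZl// Jint.
apply: eq_Rintegral => s _; rewrite /= mulr1.
case: ifPn => [sp|]; last by rewrite !mulr0.
have -> : polar_map (z, s) = scalev s w.
  by apply: eq_coord => i; rewrite wE !coordE/= mulrA.
rewrite /flux_density.
have -> : subv (addv y (scalev s w)) y = scalev s w.
  by apply: eq_coord => i; rewrite !coordE; ring.
rewrite normvZ w1 mulr1 gtr0_norm//.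
have -> : normv (addv y (scalev s w)) = Num.sqrt (c + (s + b) ^+ 2).
  rewrite normv_dotv !dotvE ww (dotvC w y) -/b; congr Num.sqrt.
  by rewrite /c; ring.
rewrite !dotvE ww -/b /d (exprS s n); move: (alpha _) => q; field.
by rewrite expf_eq0 gt_eqF// andbF.
Qed.

End profile.
End gauss_law.

Section sphere_area_two.
Context {R : realType}.
Local Notation leb := (@lebesgue_measure R).

(** The Gaussian integral over the plane, since exp (- s^2) s has a primitive. *)
Lemma sphere_area2 : sphere_area R 2 = 2 * pi.
Proof.
have := @gauss_surface R 1; have [-> _] := @surface_measure_gt0_fin R 1.
rewrite sqr_sqrtr ?pi_ge0//.
have -> : (\int[leb]_s ((expR (- s ^+ 2))%:E * (if 0 < s then s ^+ 1 else 0)%:E) = (2^-1)%:E)%E.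
  pose F (s : R) : R := - 2^-1 * expR (- s ^+ 2).
  have dF (s : R) : is_derive s 1 F (expR (- s ^+ 2) * s).
    have d2 := is_derive1_expn 2 s.
    have dN : is_derive s 1 (fun u : R => - u ^+ 2) (- (2%:R * s ^+ 1)).
      exact: is_deriveN.
    have dE := @is_derive1_comp _ expR (fun u : R => - u ^+ 2) s _ _ (is_derive_expR _) dN.
    have -> : F = (- 2^-1 : R) \*: (expR \o (fun s : R => - s ^+ 2)) by [].
    by apply: is_derive_eq; rewrite /GRing.scale/=; field.
  have cF (s : R) : {for s, continuous F}.
    apply: differentiable_continuous; apply/derivable1_diffP.
    by have [] := dF s.
  transitivity (\int[leb]_(s in `[0%R, +oo[) (expR (- s ^+ 2) * s)%:E)%E.
    rewrite [RHS]integral_mkcond; apply: eq_integral => s _; rewrite patchE -EFinM.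
    have [s0|s0] := ltP 0 s; first by rewrite expr1 ifT// inE/= in_itv/= (ltW s0).
    rewrite mulr0; case: ifPn => //; rewrite inE/= in_itv/= andbT => s1.
    have -> : s = 0 by apply/eqP; rewrite eq_le s0.
    by rewrite mulr0.
  rewrite (@ge0_continuous_FTC2y _ _ F _ 0).
  - by rewrite /F expr0n/= oppr0 expR0 -EFinB; congr EFin; ring.
  - by move=> s s0; rewrite mulr_ge0// expR_ge0.
  - apply: continuous_in_subspaceT => s _.
    apply: cvgM; last exact: cvg_id.
    exact: (@continuous_gauss_fun R).
  - rewrite -[X in _ --> X](mulr0 (- 2^-1)).
    by apply: cvgM; [exact: cvg_cst|exact: (@cvg_gauss_fun R)].
  - by move=> s _; have [] := dF s.
  - by apply: cvg_at_right_filter; exact: cF.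
  - by move=> s _; have dFs := dF s; rewrite derive1E; exact: derive_val.
rewrite -EFinM => -[E]; lra.
Qed.

End sphere_area_two.

(** * Primitives of bounded densities on the line *)

Section primitive.
Context {R : realType}.
Local Notation leb := (@lebesgue_measure R).

Definition primitive (psi : R -> R) (s : R) : R :=
  \int[leb]_u (if u <= s then psi u else 0).

Variables (psi : R -> R) (L r : R).
Hypotheses (mpsi : measurable_fun setT psi) (psiL : forall s, `|psi s| <= L).
Hypotheses (psi0 : forall s, r < `|s| -> psi s = 0).

Let L0 : 0 <= L. Proof. exact: le_trans (psiL 0). Qed.

Lemma integrable_restricted (P : pred R) : measurable_fun setT P ->
  leb.-integrable setT (fun u => (if P u then psi u else 0)%:E).
Proof.
move=> mP; apply: (@integrable_bounded_support _ _ L r).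
- exact: measurable_fun_ifT.
- by move=> s; case: ifP => _ //; rewrite normr0.
- by move=> s /psi0 ->; rewrite if_same.
Qed.

Let mle (s : R) : measurable_fun setT (fun u : R => u <= s).
Proof. exact: measurable_fun_ler. Qed.

Let mitv (s t : R) : measurable_fun setT (fun u : R => s < u <= t).
Proof. exact: measurable_fun_lt_le. Qed.

Lemma primitiveB s t : s <= t ->
  primitive psi t - primitive psi s = \int[leb]_u (if s < u <= t then psi u else 0).
Proof.
move=> st; apply/eqP; rewrite subr_eq addrC -RintegralD//; last 2 first.
- exact: integrable_restricted (mle _).
- exact: integrable_restricted (mitv _ _).
apply/eqP/eq_Rintegral => u _.
have [us|su] := leP u s; last by rewrite add0r.
by rewrite (le_trans us st) addr0.
Qed.

Lemma Rintegral_itv_derive (G g : R -> R) (s t : R) : s <= t ->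
  (forall u, s <= u <= t -> is_derive u 1 G (g u)) ->
  (forall u, s <= u <= t -> {for u, continuous g}) ->
  leb.-integrable setT (fun u => (if s < u <= t then g u else 0)%:E) /\
  \int[leb]_u (if s < u <= t then g u else 0) = G t - G s.
Proof.
move=> st dG cg.
have cgw : {within `[s, t], continuous g}.
  apply: continuous_in_subspaceT => u; rewrite inE/= in_itv/=; exact: cg.
have intg : leb.-integrable `[s, t] (EFin \o g).
  by apply: continuous_compact_integrable => //; exact: segment_compact.
have intg' : leb.-integrable `]s, t] (EFin \o g).
  apply: (integrableS _ _ _ intg) => //.
  by apply: subset_itvr; rewrite bnd_simp.
have E : (fun u => (if s < u <= t then g u else 0)%:E) = (EFin \o g) \_ `]s, t].
  apply/funext => u; rewrite patchE; case: ifPn => ut.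
    by rewrite ifT// inE/= in_itv.
  by rewrite ifF//; apply/negP; rewrite inE/= in_itv/=; apply/negP.
split; first by rewrite E -integrable_mkcond.
rewrite /Rintegral E -integral_mkcond integral_itv_obnd_cbnd.
  by rewrite (integral_derive st dG cg).
exact: measurable_int intg'.
Qed.

(** Comparison with an explicit primitive stands in for the almost everywhere
    derivative of [primitive psi]. *)
Lemma primitive_ge (G g : R -> R) (s t : R) : s <= t ->
  (forall u, s <= u <= t -> is_derive u 1 G (g u)) ->
  (forall u, s <= u <= t -> {for u, continuous g}) ->
  (forall u, s < u <= t -> g u <= psi u) ->
  G t - G s <= primitive psi t - primitive psi s.
Proof.
move=> st dG cg gpsi; rewrite primitiveB//.
have [intg <-] := Rintegral_itv_derive st dG cg.
apply: le_Rintegral => //; first exact: integrable_restricted (mitv _ _).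
by move=> u _; case: ifPn => // /gpsi.
Qed.

Lemma primitive_le (G g : R -> R) (s t : R) : s <= t ->
  (forall u, s <= u <= t -> is_derive u 1 G (g u)) ->
  (forall u, s <= u <= t -> {for u, continuous g}) ->
  (forall u, s < u <= t -> psi u <= g u) ->
  primitive psi t - primitive psi s <= G t - G s.
Proof.
move=> st dG cg gpsi; rewrite primitiveB//.
have [intg <-] := Rintegral_itv_derive st dG cg.
apply: le_Rintegral => //; first exact: integrable_restricted (mitv _ _).
by move=> u _; case: ifPn => // /gpsi.
Qed.

Lemma is_derive1_scale (c u : R) : is_derive u 1 (fun v : R => c * v) c.
Proof.
have -> : (fun v : R => c * v) = c \*: (id : R -> R) by [].
by apply: is_derive_eq; rewrite /GRing.scale/= mulr1.
Qed.

Lemma primitive_ge_cst (c s t : R) : s <= t -> (forall u, s < u <= t -> c <= psi u) ->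
  c * (t - s) <= primitive psi t - primitive psi s.
Proof.
move=> st cpsi; rewrite mulrBr.
apply: (@primitive_ge (fun v => c * v) (cst c)) => // u _.
- exact: is_derive1_scale.
- exact: cst_continuous.
Qed.

Lemma primitive_le_cst (c s t : R) : s <= t -> (forall u, s < u <= t -> psi u <= c) ->
  primitive psi t - primitive psi s <= c * (t - s).
Proof.
move=> st cpsi; rewrite mulrBr.
apply: (@primitive_le (fun v => c * v) (cst c)) => // u _.
- exact: is_derive1_scale.
- exact: cst_continuous.
Qed.

Lemma primitive_lip s t : `|primitive psi t - primitive psi s| <= L * `|t - s|.
Proof.
wlog st : s t / s <= t.
  move=> H; have [/H//|/ltW ts] := leP s t.
  by rewrite distrC (distrC t); exact: H.
rewrite [`|t - s|]ger0_norm ?subr_ge0// ler_norml -mulNr.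
rewrite primitive_ge_cst ?primitive_le_cst// => u _.
- by have := psiL u; rewrite ler_norml => /andP[].
- by have := psiL u; rewrite ler_norml => /andP[].
Qed.

Lemma primitive_continuous : continuous (primitive psi).
Proof.
have L1 : 0 < L + 1 by rewrite ltr_wpDl.
move=> x; apply/cvgrPdist_lt => e e0; near=> t.
rewrite (le_lt_trans (primitive_lip t x))//.
rewrite (@le_lt_trans _ _ ((L + 1) * `|x - t|))//; first by rewrite ler_wpM2r// lerDl.
rewrite mulrC -ltr_pdivlMr//; near: t.
exists (e / (L + 1)).
  by apply: divr_gt0.
by move=> y.
Unshelve. all: by end_near. Qed.

Lemma measurable_primitive : measurable_fun setT (primitive psi).
Proof. by apply: continuous_measurable_fun; exact: primitive_continuous. Qed.

Lemma primitive_eq s t : s <= t -> (forall u, s < u < t -> psi u = 0) ->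
  primitive psi t = primitive psi s.
Proof.
move=> st psi00; apply/eqP; rewrite -subr_eq0 primitiveB//; apply/eqP.
transitivity (\int[leb]_u (cst 0 u : R)); last by rewrite Rintegral_cst// mul0r.
apply: (@eq_Rintegral_off _ _ _ t).
- exact: integrable_restricted (mitv _ _).
- exact: integrable0.
move=> u ut; case: ifPn => // /andP[su ut'].
by rewrite psi00// su lt_neqAle ut.
Qed.

Lemma primitive_nondecreasing s t : (forall u, 0 <= psi u) -> s <= t ->
  primitive psi s <= primitive psi t.
Proof.
move=> p0 st; rewrite -subr_ge0.
by have := @primitive_ge_cst 0 s t st (fun u _ => p0 u); rewrite mul0r.
Qed.

End primitive.

Section chain_rule.
Context {R : realType}.
Local Notation leb := (@lebesgue_measure R).

(** Cut the interval into m equal pieces: the total increment is at most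
    K (t - s)^2 / m. *)
Lemma quadratic_modulus_cst (J : R -> R) (K : R) :
  (forall s t, `|J t - J s| <= K * (t - s) ^+ 2) -> forall s t, J s = J t.
Proof.
move=> JK s t.
have K0 : 0 <= K by have := le_trans (normr_ge0 _) (JK 0 1); rewrite subr0 expr1n mulr1.
have step h m : `|J (s + m%:R * h) - J s| <= m%:R * (K * h ^+ 2).
  elim: m => [|m IH]; first by rewrite !mul0r addr0 subrr normr0.
  rewrite -(subrK (J (s + m%:R * h)) (J (s + m.+1%:R * h))) -addrA.
  have -> : m.+1%:R * (K * h ^+ 2) = K * h ^+ 2 + m%:R * (K * h ^+ 2).
    by rewrite -natr1; ring.
  rewrite (le_trans (ler_normD _ _))// lerD//.
  rewrite (le_trans (JK _ _))// (_ : _ - _ = h)//.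
  by rewrite -natr1; ring.
apply/eqP; rewrite eq_sym -subr_eq0 -normr_eq0 eq_le normr_ge0 andbT.
rewrite leNgt; apply/negP => J0.
pose M := K * (t - s) ^+ 2.
have M0 : 0 <= M by rewrite mulr_ge0// sqr_ge0.
have [m Mm] : exists m : nat, M < m.+1%:R * `|J t - J s|.
  exists (Num.truncn (M / `|J t - J s|)).
  by rewrite -ltr_pdivrMr// truncnS_gt.
have := step ((t - s) / m.+1%:R) m.+1.
have m0 : m.+1%:R != 0 :> R by rewrite pnatr_eq0.
have -> : s + m.+1%:R * ((t - s) / m.+1%:R) = t by field; rewrite addrC natr1.
have -> : m.+1%:R * (K * ((t - s) / m.+1%:R) ^+ 2) = M / m.+1%:R.
  by rewrite /M; field; rewrite addrC natr1.
by rewrite ler_pdivlMr ?ltr0n// mulrC leNgt Mm.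
Qed.

Variables (psi : R -> R) (L r : R).
Hypotheses (mpsi : measurable_fun setT psi) (psiL : forall s, `|psi s| <= L).
Hypotheses (psi0 : forall s, r < `|s| -> psi s = 0).
Variables (Theta theta : R -> R) (K M : R).
Hypothesis ThetaK : forall x y, `|Theta y - Theta x - theta x * (y - x)| <= K * (y - x) ^+ 2.
Hypothesis thetaK : forall x y, `|theta y - theta x| <= K * `|y - x|.
Hypothesis mtheta : measurable_fun setT theta.
Hypothesis thetaM : forall s, `|theta (primitive psi s)| <= M.

(** As [primitive psi] is only Lipschitz, the two sides are not differentiated.
    By Taylor's estimate their difference has a quadratic modulus of continuity,
    which makes it constant. *)
Lemma primitive_chain_rule s t :
  Theta (primitive psi t) - Theta (primitive psi s) =
  primitive (fun u => theta (primitive psi u) * psi u) t -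
  primitive (fun u => theta (primitive psi u) * psi u) s.
Proof.
set f := primitive psi; set g := fun u => _ * _.
have mg : measurable_fun setT g.
  apply: measurable_funM => //; apply: measurableT_comp => //.
  exact: (measurable_primitive mpsi psiL psi0).
have L0 : 0 <= L := le_trans (normr_ge0 _) (psiL 0).
have gL u : `|g u| <= M * L by rewrite normrM ler_pM.
have g0 u : r < `|u| -> g u = 0 by move=> /psi0 gu; rewrite /g gu mulr0.
pose J u := primitive g u - Theta (f u).
suff JE : J s = J t by move: JE; rewrite /J; lra.
apply: (@quadratic_modulus_cst J (2 * K * L ^+ 2)) => {}s {}t.
wlog st : s t / s <= t.
  move=> H; have [/H//|/ltW ts] := leP s t.
  have -> : (t - s) ^+ 2 = (s - t) ^+ 2 by ring.
  by rewrite distrC; exact: H.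
have K0 : 0 <= K.
  by have := le_trans (normr_ge0 _) (thetaK 0 1); rewrite subr0 normr1 mulr1.
have fst := primitive_lip mpsi psiL psi0 s t.
pose h u := (theta (f u) - theta (f s)) * psi u.
have -> : J t - J s = (primitive g t - primitive g s - theta (f s) * (f t - f s))
   - (Theta (f t) - Theta (f s) - theta (f s) * (f t - f s)) by rewrite /J; ring.
rewrite (le_trans (ler_normB _ _))//.
rewrite (_ : 2 * K * _ * _ = K * (L * `|t - s|) ^+ 2 + K * (L * `|t - s|) ^+ 2); last first.
  by rewrite exprMn real_normK ?num_real//; ring.
rewrite lerD//; last first.
  rewrite (le_trans (ThetaK _ _))// ler_wpM2l// -real_normK ?num_real//.
  by rewrite lerXn2r ?nnegrE// mulr_ge0.
rewrite (primitiveB mg gL g0)// (primitiveB mpsi psiL psi0)//.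
have mP : measurable_fun setT (fun u : R => s < u <= t).
  exact: measurable_fun_lt_le.
have ig := integrable_restricted mg gL g0 mP.
have ip := integrable_restricted mpsi psiL psi0 mP.
rewrite -RintegralZl// -RintegralB//; last first.
  by have := integrableZl measurableT (theta (f s)) ip.
pose c := K * (L * `|t - s|) * L.
have c0 : 0 <= c by rewrite !mulr_ge0.
have -> : K * (L * `|t - s|) ^+ 2 = c * (t - s).
  by rewrite /c [`|t - s|]ger0_norm ?subr_ge0//; ring.
rewrite mulrBr; have [ic <-] := @Rintegral_itv_derive _ (fun v => c * v) (cst c) s t st
  (fun u _ => is_derive1_scale c u) (fun u _ => @cst_continuous _ _ c u).
have ih : leb.-integrable setT (EFin \o (fun u => (if s < u <= t then g u else 0) -
    theta (f s) * (if s < u <= t then psi u else 0))).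
  have := integrableB measurableT ig (integrableZl measurableT (theta (f s)) ip).
  by apply: eq_integrable.
rewrite (le_trans (le_normr_Rintegral _ ih))//.
apply: le_Rintegral => //; first exact: (integrable_norm ih).
move=> u _; case: ifPn => [/andP[su ut]|]; last by rewrite mulr0 subr0 normr0.
rewrite /g /cst -mulrBl normrM /c ler_pM//.
rewrite (le_trans (thetaK _ _))// ler_wpM2l//.
rewrite (le_trans (primitive_lip mpsi psiL psi0 s u))// ler_wpM2l//.
by rewrite !ger0_norm ?subr_ge0 ?lerD2r ?(ltW su)// (le_trans (ltW su)).
Qed.

End chain_rule.

(** * The one-dimensional inequality *)

Section positive_part_square.
Context {R : realType}.
Implicit Types x y c : R.

Definition posr x : R := Num.max x 0.

Lemma posr_ge0 x : 0 <= posr x. Proof. by rewrite /posr le_max lexx orbT. Qed.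

Lemma posr_id x : 0 <= x -> posr x = x.
Proof. by move=> x0; rewrite /posr; apply/max_idPl. Qed.

Lemma posr_eq0 x : x <= 0 -> posr x = 0.
Proof. by move=> x0; rewrite /posr; apply/max_idPr. Qed.

Lemma posr_le_norm x : posr x <= `|x|.
Proof. by rewrite /posr ge_max normr_ge0 ler_norm. Qed.

Lemma le_posr x y : x <= y -> posr x <= posr y.
Proof. by move=> xy; rewrite /posr ge_max !le_max xy lexx orbT. Qed.

Lemma posr_sqr_split x : x ^+ 2 = posr x ^+ 2 + posr (- x) ^+ 2.
Proof.
have [x0|/ltW x0] := leP 0 x.
  by rewrite posr_id// [posr (- x)]posr_eq0 ?oppr_le0// expr0n addr0.
by rewrite posr_eq0// [posr (- x)]posr_id ?oppr_ge0// expr0n add0r sqrrN.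
Qed.

Lemma posr_lip x y : `|posr y - posr x| <= `|y - x|.
Proof.
have [x0|/ltW x0] := leP 0 x; have [y0|/ltW y0] := leP 0 y;
  rewrite ?(posr_id x0) ?(posr_id y0) ?(posr_eq0 x0) ?(posr_eq0 y0)//.
- by rewrite sub0r normrN (ger0_norm x0) distrC (le_trans _ (ler_norm _))//; lra.
- by rewrite subr0 (ger0_norm y0) (le_trans _ (ler_norm _))//; lra.
- by rewrite subrr normr0.
Qed.

Lemma posr_sqr_taylor x y :
  `|posr y ^+ 2 - posr x ^+ 2 - 2 * posr x * (y - x)| <= (y - x) ^+ 2.
Proof.
have sx := sqr_ge0 x; have sy := sqr_ge0 y; have sxy := sqr_ge0 (y - x).
have [x0|/ltW x0] := leP 0 x; have [y0|/ltW y0] := leP 0 y;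
  rewrite ?(posr_id x0) ?(posr_id y0) ?(posr_eq0 x0) ?(posr_eq0 y0) ?expr0n/=.
- by rewrite (_ : _ - _ = (y - x) ^+ 2) ?ger0_norm//; ring.
- have xy := mulr_ge0_le0 x0 y0.
  by rewrite ler_norml; apply/andP; split; nra.
- have xy := mulr_le0_ge0 x0 y0.
  by rewrite ler_norml; apply/andP; split; nra.
- by rewrite mulr0 mul0r !subr0 normr0.
Qed.

Lemma measurable_posr : measurable_fun setT posr.
Proof. by apply: measurable_maxr. Qed.

End positive_part_square.

Section radial_mass.
Context {R : realType} (n : nat).
Local Notation leb := (@lebesgue_measure R).

(** The density in the radius [u], up to the area of the unit sphere, of a
    radial measure of profile [phi]. *)
Definition radial_density (phi : R -> R) (u : R) : R :=
  if 0 < u then phi u * u ^+ n else 0.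

Definition radial_mass (phi : R -> R) : R -> R := primitive (radial_density phi).

Variables (phi : R -> R) (B r : R).
Hypotheses (mphi : measurable_fun setT phi) (phiB : forall s, `|phi s| <= B).
Hypotheses (r0 : 0 <= r) (phi0 : forall s, r < s -> phi s = 0).

Let B0 : 0 <= B. Proof. exact: le_trans (phiB 0). Qed.

Lemma measurable_radial_density : measurable_fun setT (radial_density phi).
Proof.
apply: measurable_fun_ifT => //; first exact: measurable_fun_ltr.
by apply: measurable_funM => //; exact: measurable_funX.
Qed.

Lemma radial_density_le s : `|radial_density phi s| <= B * r ^+ n.
Proof.
rewrite /radial_density; case: ifPn => s0; last by rewrite normr0 mulr_ge0 ?exprn_ge0.
have [sr|/phi0 ->] := leP s r; last by rewrite mul0r normr0 mulr_ge0 ?exprn_ge0.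
rewrite normrM ler_pM// ger0_norm ?exprn_ge0 ?(ltW s0)//.
by rewrite lerXn2r ?nnegrE// ltW.
Qed.

Lemma radial_density_eq0 s : r < `|s| -> radial_density phi s = 0.
Proof.
rewrite /radial_density; case: ifPn => // s0.
by rewrite gtr0_norm// => /phi0 ->; rewrite mul0r.
Qed.

Lemma radial_mass_le0 s : s <= 0 -> radial_mass phi s = 0.
Proof.
move=> s0; rewrite /radial_mass /primitive.
rewrite (_ : (fun _ => _) = cst 0); first by rewrite Rintegral_cst// mul0r.
apply/funext => u; case: ifPn => // us; rewrite /radial_density ifF//.
by apply/negbTE; rewrite -leNgt (le_trans us).
Qed.

Lemma radial_mass_ge s : r <= s -> radial_mass phi s = radial_mass phi r.
Proof.
move=> rs; apply: (primitive_eq measurable_radial_density radial_density_le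
  radial_density_eq0) => // u /andP[ru _].
by apply: radial_density_eq0; rewrite (lt_le_trans ru)// ler_norm.
Qed.

Lemma measurable_radial_mass : measurable_fun setT (radial_mass phi).
Proof.
exact: (measurable_primitive measurable_radial_density radial_density_le
  radial_density_eq0).
Qed.

Lemma radial_mass_norm_le s : 0 <= s -> `|radial_mass phi s| <= B * s ^+ n.+1.
Proof.
move=> s0; rewrite -[radial_mass phi s]subr0 -(radial_mass_le0 (lexx 0)).
have bd u : 0 < u <= s -> `|radial_density phi u| <= B * s ^+ n.
  move=> /andP[u0 us]; rewrite /radial_density u0 normrM ler_pM//.
  by rewrite ger0_norm ?exprn_ge0 ?(ltW u0)// lerXn2r ?nnegrE// ltW.
have H1 := @primitive_le_cst _ _ _ _ measurable_radial_density radial_density_le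
  radial_density_eq0 (B * s ^+ n) 0 s s0.
have H2 := @primitive_ge_cst _ _ _ _ measurable_radial_density radial_density_le
  radial_density_eq0 (- (B * s ^+ n)) 0 s s0.
rewrite subr0 mulNr -mulrA -exprSr in H2; rewrite subr0 -mulrA -exprSr in H1.
rewrite ler_norml; apply/andP; split.
- by apply: H2 => u /bd; rewrite ler_norml => /andP[].
- by apply: H1 => u /bd; rewrite ler_norml => /andP[].
Qed.

End radial_mass.

Lemma is_derive1_affine_sqr {R : realType} (A b c s : R) :
  is_derive s 1 (fun u : R => A * (b * u + c) ^+ 2) (2 * A * b * (b * s + c)).
Proof.
have -> : (fun u : R => A * (b * u + c) ^+ 2) =
    A \*: ((fun w : R => w ^+ 2) \o ((fun u : R => b * u) + cst c)) by [].
have d0 := is_derive1_scale b s.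
have d1 : is_derive s 1 ((fun u : R => b * u) + cst c) b.
  by apply: is_derive_eq; rewrite addr0.
have d2 := @is_derive1_comp _ (fun w : R => w ^+ 2) ((fun u : R => b * u) + cst c)
  s _ _ (is_derive1_expn 2 _) d1.
apply: is_derive_eq; rewrite /GRing.scale/= /cst addrfctE expr1; ring.
Qed.

Section one_dimensional_inequality.
Context {R : realType} (n : nat).
Local Notation leb := (@lebesgue_measure R).
Variables (a r A lam B : R) (p q : R -> R).
Hypotheses (a0 : 0 <= a) (ar : a < r) (lam0 : 0 < lam) (A0 : 0 < A).
Hypotheses (mp : measurable_fun setT p) (mq : measurable_fun setT q).
Hypotheses (p0 : forall s, 0 <= p s) (pB : forall s, p s <= B).
Hypotheses (pout : forall s, ~~ (a <= s <= r) -> p s = 0).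
Hypotheses (qin : forall s, a <= s <= r -> lam <= q s <= A).
Hypotheses (qout : forall s, ~~ (a <= s <= r) -> q s = 0).

Local Notation f := (radial_mass n p).
Local Notation F := (radial_mass n q).
Hypothesis massE : f r = F r.

Let r0 : 0 <= r. Proof. exact: le_trans (ltW ar). Qed.

Let pB' s : `|p s| <= B. Proof. by rewrite ger0_norm. Qed.

Let p0' s : r < s -> p s = 0.
Proof. by move=> rs; apply: pout; rewrite negb_and -!ltNge rs orbT. Qed.

Let qA' s : `|q s| <= A.
Proof.
have [/qin/andP[lq qA]|/qout ->] := boolP (a <= s <= r); last by rewrite normr0 ltW.
by rewrite ger0_norm// (le_trans (ltW lam0)).
Qed.

Let q0' s : r < s -> q s = 0.
Proof. by move=> rs; apply: qout; rewrite negb_and -!ltNge rs orbT. Qed.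

Let q0 s : 0 <= q s.
Proof.
have [/qin/andP[lq qA]|/qout ->//] := boolP (a <= s <= r).
by rewrite (le_trans (ltW lam0)).
Qed.

Let mdp := measurable_radial_density n mp.
Let dpL := radial_density_le n pB' r0 p0'.
Let dp0 := radial_density_eq0 n p0'.
Let mdq := measurable_radial_density n mq.
Let dqL := radial_density_le n qA' r0 q0'.
Let dq0 := radial_density_eq0 n q0'.
Let mf : measurable_fun setT f := measurable_radial_mass n mp pB' r0 p0'.
Let mF : measurable_fun setT F := measurable_radial_mass n mq qA' r0 q0'.

Let dp_ge0 u : 0 <= radial_density n p u.
Proof.
rewrite /radial_density; case: ifPn => // u0.
by rewrite mulr_ge0// exprn_ge0// ltW.
Qed.

Let dq_ge0 u : 0 <= radial_density n q u.
Proof.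
rewrite /radial_density; case: ifPn => // u0.
by rewrite mulr_ge0// exprn_ge0// ltW.
Qed.

Let f_homo s t : s <= t -> f s <= f t.
Proof. by move=> st; exact: (primitive_nondecreasing mdp dpL dp0). Qed.

Let F_homo s t : s <= t -> F s <= F t.
Proof. by move=> st; exact: (primitive_nondecreasing mdq dqL dq0). Qed.

Let f_ge0 s : 0 <= f s.
Proof. by apply: Rintegral_ge0 => u _; case: ifP. Qed.

Let F_ge0 s : 0 <= F s.
Proof. by apply: Rintegral_ge0 => u _; case: ifP. Qed.

Let f_le s : f s <= f r.
Proof.
have [/f_homo//|/ltW rs] := leP s r.
by rewrite (radial_mass_ge n mp pB' r0 p0' rs).
Qed.

(** Both lemmas integrate the derivative of a squared positive part of the
    mass function [f]; the first starts from the right end of the support,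
    where [f] has reached its total mass, the second from the centre. *)
Lemma posr_sqr_above c s : c <= f r -> s <= r ->
  ((posr (c - f s) ^+ 2)%:E = \int[leb]_u
     (if s < u <= r then 2 * posr (c - f u) * radial_density n p u else 0)%:E)%E.
Proof.
move=> cr sr.
pose theta v := 2 * posr (c - v).
have mtheta : measurable_fun setT theta.
  apply: measurable_funM => //; apply: (measurableT_comp measurable_posr).
  exact: measurable_funB.
have thetaM u : `|theta (f u)| <= 2 * `|c|.
  rewrite /theta normrM [`|2|]ger0_norm// [`|posr _|]ger0_norm ?posr_ge0// ler_wpM2l//.
  rewrite (le_trans _ (posr_le_norm c))// le_posr// lerBlDr lerDl.
  exact: f_ge0.
have mg : measurable_fun setT (fun u => theta (f u) * radial_density n p u).
  by apply: measurable_funM => //; exact: measurableT_comp.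
have gL u : `|theta (f u) * radial_density n p u| <= (2 * `|c|) * (B * r ^+ n).
  by rewrite normrM ler_pM.
have g0 u : r < `|u| -> theta (f u) * radial_density n p u = 0.
  by move=> /dp0 ->; rewrite mulr0.
have := @primitive_chain_rule _ _ _ _ mdp dpL dp0
  (fun v => - posr (c - v) ^+ 2) theta 2 _ _ _ mtheta thetaM s r.
rewrite (primitiveB mg gL g0)// posr_eq0 ?subr_le0// expr0n oppr0 sub0r opprK => -> //.
- rewrite /Rintegral fineK//; apply: integrable_fin_num => //.
  apply: (integrable_restricted mg gL g0).
  exact: measurable_fun_lt_le.
- move=> x y; have := posr_sqr_taylor (c - x) (c - y).
  rewrite (_ : c - y - (c - x) = - (y - x)) ?sqrrN; last by ring.
  have K2 : (y - x) ^+ 2 <= 2 * (y - x) ^+ 2.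
    by rewrite ler_peMl ?sqr_ge0// ler1n.
  move=> /le_trans/(_ K2); rewrite -normrN; congr (`|_| <= _).
  by rewrite /theta; ring.
- move=> x y; rewrite /theta -mulrBr normrM ger0_norm// ler_wpM2l//.
  rewrite (le_trans (posr_lip _ _))// (_ : c - y - (c - x) = - (y - x)) ?normrN//.
  by ring.
Qed.

Lemma posr_sqr_below c s : 0 <= c -> 0 <= s ->
  ((posr (f s - c) ^+ 2)%:E = \int[leb]_u
     (if 0 < u <= s then 2 * posr (f u - c) * radial_density n p u else 0)%:E)%E.
Proof.
move=> c0 s0.
pose theta v := 2 * posr (v - c).
have mtheta : measurable_fun setT theta.
  apply: measurable_funM => //; apply: (measurableT_comp measurable_posr).
  exact: measurable_funB.
have thetaM u : `|theta (f u)| <= 2 * f r.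
  rewrite /theta normrM [`|2|]ger0_norm// [`|posr _|]ger0_norm ?posr_ge0// ler_wpM2l//.
  rewrite /posr ge_max f_ge0 andbT (le_trans _ (f_le u))// lerBlDr lerDl.
  exact: c0.
have mg : measurable_fun setT (fun u => theta (f u) * radial_density n p u).
  by apply: measurable_funM => //; exact: measurableT_comp.
have gL u : `|theta (f u) * radial_density n p u| <= (2 * f r) * (B * r ^+ n).
  by rewrite normrM ler_pM.
have g0 u : r < `|u| -> theta (f u) * radial_density n p u = 0.
  by move=> /dp0 ->; rewrite mulr0.
have := @primitive_chain_rule _ _ _ _ mdp dpL dp0
  (fun v => posr (v - c) ^+ 2) theta 2 _ _ _ mtheta thetaM 0 s.
rewrite (primitiveB mg gL g0)// -/(f 0) (radial_mass_le0 n p (lexx 0)).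
rewrite [posr (0 - c)]posr_eq0 ?sub0r ?oppr_le0// expr0n subr0 => -> //.
- rewrite /Rintegral fineK//; apply: integrable_fin_num => //.
  apply: (integrable_restricted mg gL g0).
  exact: measurable_fun_lt_le.
- move=> x y; have := posr_sqr_taylor (x - c) (y - c).
  rewrite (_ : y - c - (x - c) = y - x); last by ring.
  have K2 : (y - x) ^+ 2 <= 2 * (y - x) ^+ 2.
    by rewrite ler_peMl ?sqr_ge0// ler1n.
  by move=> /le_trans/(_ K2).
- move=> x y; rewrite /theta -mulrBr normrM ger0_norm// ler_wpM2l//.
  rewrite (le_trans (posr_lip _ _))// (_ : y - c - (x - c) = y - x)//.
  by ring.
Qed.

(** Only the radii between v and u contribute, where v is the radius at which F
    has the value f u. There F s - F v <= A s^n (s - v) compensates s^(-n) and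
    leaves A (u - v)^2. The lower bound on q turns the length of the interval
    back into a difference of masses:
    lam / (n + 1) * u^n (u - v) <= F u - F v = F u - f u. *)
Lemma inner_bound_below u : a <= u <= r -> 0 < u ->
  (\int[leb]_s (if 0 < s < u then s ^- n * (2 * posr (F s - f u)) else 0)%:E <=
   (A * (n.+1%:R / lam) ^+ 2 * posr (F u - f u) ^+ 2 * (u ^- n) ^+ 2)%:E)%E.
Proof.
move=> /andP[au ur] u0.
have un0 : 0 < u ^+ n by rewrite exprn_gt0.
have [Fu|fu] := leP (F u) (f u).
  rewrite integral0_eq; last first.
    move=> s _; case: ifPn => // /andP[_ su].
    by rewrite posr_eq0 ?mulr0// subr_le0 (le_trans _ Fu)// F_homo// ltW.
  by rewrite lee_fin mulr_ge0 ?sqr_ge0// mulr_ge0 ?sqr_ge0// mulr_ge0 ?sqr_ge0 ?(ltW A0).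
have Fa : F a = 0.
  rewrite -(radial_mass_le0 n q (lexx 0)).
  apply: (primitive_eq mdq dqL dq0) => // v /andP[v0 va].
  by rewrite /radial_density v0 qout ?mul0r// negb_and -ltNge va.
(* v is the radius inside which q has the mass that p has inside u. *)
have [v /[!in_itv]/= /andP[av vu] Fv] : exists2 v, v \in `[a, u] & F v = f u.
  apply: IVT => //.
    by apply: continuous_subspaceT; exact: (primitive_continuous mdq dqL dq0).
  by rewrite Fa ge_min f_ge0 le_max (ltW fu) orbT.
have v0 : 0 <= v := le_trans a0 av.
have dq_in w : v < w -> w <= u -> radial_density n q w = q w * w ^+ n /\
    lam <= q w <= A.
  move=> vw wu; rewrite /radial_density (le_lt_trans v0 vw); split => //.
  by apply: qin; rewrite (le_trans av (ltW vw)) (le_trans wu).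
pose g s := (2 * A) * (s - v).
have dG (s : R) : is_derive s 1 (fun s => A * (1 * s + - v) ^+ 2) (g s).
  have -> : g s = 2 * A * 1 * (1 * s + - v) by rewrite /g; ring.
  exact: is_derive1_affine_sqr.
have cg (s : R) : {for s, continuous g}.
  apply: cvgM; first exact: cvg_cst.
  by apply: cvgB; [exact: cvg_id|exact: cvg_cst].
apply: (@le_trans _ _ (A * (u - v) ^+ 2)%:E).
  have -> : A * (u - v) ^+ 2 = A * (1 * u + - v) ^+ 2 - A * (1 * v + - v) ^+ 2.
    by ring.
  rewrite -(@integral_derive _ g (fun s => A * (1 * s + - v) ^+ 2) v u)//.
  rewrite [leRHS]integral_mkcond; apply: ge0_le_integral => //.
  - move=> s _; rewrite lee_fin; case: ifPn => // /andP[s0 _].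
    by rewrite mulr_ge0 ?invr_ge0 ?exprn_ge0 ?(ltW s0)// mulr_ge0// posr_ge0.
  - apply/measurable_EFinP; apply: measurable_fun_ifT => //.
      by apply: measurable_and; exact: measurable_fun_ltr.
    apply: measurable_funM; first exact: measurable_exprV.
    apply: measurable_funM => //; apply: (measurableT_comp measurable_posr).
    exact: measurable_funB.
  - apply/(measurable_restrictT (EFin \o g)); first exact: measurable_itv.
    apply/measurable_EFinP; apply: measurable_funTS; apply: continuous_measurable_fun.
    by move=> s; exact: cg.
  move=> s _; rewrite patchE.
  have [sv|vs] := leP s v.
    case: ifPn => [/andP[_ su]|_].
      rewrite [posr _]posr_eq0 ?mulr0; last by rewrite -Fv subr_le0 F_homo.
      case: ifPn => //; rewrite inE/= in_itv/= => /andP[vs _].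
      by rewrite lee_fin /g !mulr_ge0 ?subr_ge0// ltW.
    case: ifPn => //; rewrite inE/= in_itv/= => /andP[vs _].
    by rewrite lee_fin /g !mulr_ge0 ?subr_ge0// ltW.
  have s0 : 0 < s := le_lt_trans v0 vs.
  rewrite s0 /=; have [su|us] := ltP s u; last first.
    case: ifPn => //; rewrite inE/= in_itv/= => /andP[_ _].
    by rewrite lee_fin /g !mulr_ge0 ?subr_ge0// ltW.
  rewrite ifT; last by rewrite inE/= in_itv/= !ltW.
  have sn0 : 0 < s ^+ n by rewrite exprn_gt0.
  rewrite lee_fin mulrC ler_pdivrMr// /g -!mulrA ler_wpM2l//.
  rewrite posr_id ?subr_ge0 -Fv ?F_homo ?(ltW vs)//.
  rewrite mulrCA mulrC.
  apply: (primitive_le_cst mdq dqL dq0 (ltW vs)) => w /andP[vw ws].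
  have [-> /andP[_ qA]] := dq_in w vw (le_trans ws (ltW su)).
  have w0 : 0 <= w by rewrite (le_trans v0)// ltW.
  by rewrite ler_pM ?exprn_ge0// lerXn2r ?nnegrE// ltW.
have key : lam / n.+1%:R * (u ^+ n * (u - v)) <= F u - f u.
  rewrite -Fv.
  apply: (@le_trans _ _ (lam / n.+1%:R * u ^+ n.+1 - lam / n.+1%:R * v ^+ n.+1)).
    rewrite -mulrBr ler_wpM2l ?divr_ge0 ?(ltW lam0)//.
    rewrite mulrBr -exprSr lerD2l lerN2 [v ^+ n.+1]exprSr ler_wpM2r//.
    by rewrite lerXn2r ?nnegrE ?(ltW u0).
  apply: (@primitive_ge _ _ _ _ mdq dqL dq0
    (fun w => lam / n.+1%:R * w ^+ n.+1) (fun w => lam * w ^+ n) v u) => //.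
  - move=> w _.
    have -> : (fun w : R => lam / n.+1%:R * w ^+ n.+1) = (lam / n.+1%:R) \*: (fun w : R => w ^+ n.+1).
      by [].
    have dw := is_derive1_expn n.+1 w.
    apply: is_derive_eq; rewrite /GRing.scale/=; field.
    by rewrite addrC natr1 pnatr_eq0.
  - move=> w _; apply: cvgM; first exact: cvg_cst.
    exact: exprn_continuous.
  - move=> w /andP[vw wu]; have [-> /andP[lq _]] := dq_in w vw wu.
    by rewrite ler_wpM2r// exprn_ge0// (le_trans v0)// ltW.
have Fuv : 0 <= F u - f u by rewrite subr_ge0 ltW.
rewrite lee_fin posr_id//.
have -> : A * (n.+1%:R / lam) ^+ 2 * (F u - f u) ^+ 2 * (u ^- n) ^+ 2 =
    A * (n.+1%:R / lam * (F u - f u) / u ^+ n) ^+ 2 by rewrite !exprMn !mulrA.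
rewrite ler_wpM2l ?(ltW A0)//.
have nl0 : 0 <= n.+1%:R / lam by rewrite divr_ge0// ltW.
have H : u - v <= n.+1%:R / lam * (F u - f u) / u ^+ n.
  rewrite ler_pdivlMr//; have := ler_wpM2l nl0 key; congr (_ <= _).
  by field; rewrite (gt_eqF lam0) ?andbT /= addrC natr1 pnatr_eq0.
have uv0 : 0 <= u - v by rewrite subr_ge0.
by rewrite lerXn2r ?nnegrE// (le_trans uv0).
Qed.

(** For s > u both factors help: s^(-n) <= u^(-n), and F grows at least with the
    slope k = lam u^n, so that the integrand vanishes beyond u + x / k, where
    x = f u - F u. What remains is the integral of a linear function. *)
Lemma inner_bound_above u : a <= u <= r -> 0 < u ->
  (\int[leb]_s (if u <= s <= r then s ^- n * (2 * posr (f u - F s)) else 0)%:E <=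
   (lam^-1 * posr (f u - F u) ^+ 2 * (u ^- n) ^+ 2)%:E)%E.
Proof.
move=> /andP[au ur] u0.
have un0 : 0 < u ^+ n by rewrite exprn_gt0.
set x := f u - F u; have [x0|x0] := leP x 0.
  rewrite integral0_eq; last first.
    move=> s _; case: ifPn => // /andP[us _].
    rewrite [posr _]posr_eq0 ?mulr0//; rewrite /x in x0.
    by have := F_homo us; lra.
  by rewrite lee_fin mulr_ge0 ?sqr_ge0// mulr_ge0 ?sqr_ge0// invr_ge0 ltW.
pose k := lam * u ^+ n; have k0 : 0 < k by rewrite mulr_gt0.
(* Beyond v the linear lower bound on F exceeds f u. *)
pose v := u + x / k; have uv : u <= v by rewrite lerDl divr_ge0// ltW.
pose c := - (u ^- n / k).
pose g (s : R) := 2 * c * (- k) * (- k * s + (x + k * u)).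
have gE s : g s = u ^- n * (2 * (x - k * (s - u))).
  by rewrite /g /c; field; rewrite !gt_eqF.
have dG (s : R) : is_derive s 1 (fun s => c * (- k * s + (x + k * u)) ^+ 2) (g s).
  exact: is_derive1_affine_sqr.
have cg (s : R) : {for s, continuous g}.
  apply: cvgM; first exact: cvg_cst.
  apply: cvgD; last exact: cvg_cst.
  by apply: cvgM; [exact: cvg_cst|exact: cvg_id].
have -> : lam^-1 * posr x ^+ 2 * (u ^- n) ^+ 2 =
    c * (- k * v + (x + k * u)) ^+ 2 - c * (- k * u + (x + k * u)) ^+ 2.
  rewrite (posr_id (ltW x0)) (_ : - k * v + (x + k * u) = 0); last first.
    by rewrite /v; field; rewrite gt_eqF.
  rewrite (_ : - k * u + (x + k * u) = x); last by ring.
  by rewrite /c /k; field; rewrite !gt_eqF.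
rewrite -(@integral_derive _ g (fun s => c * (- k * s + (x + k * u)) ^+ 2) u v)//.
rewrite [leRHS]integral_mkcond; apply: ge0_le_integral => //.
- move=> s _; rewrite lee_fin; case: ifPn => // /andP[us _].
  have s0 := lt_le_trans u0 us.
  by rewrite mulr_ge0 ?invr_ge0 ?exprn_ge0 ?(ltW s0)// mulr_ge0// posr_ge0.
- apply/measurable_EFinP; apply: measurable_fun_ifT => //.
    by apply: measurable_and; exact: measurable_fun_ler.
  apply: measurable_funM; first exact: measurable_exprV.
  apply: measurable_funM => //; apply: (measurableT_comp measurable_posr).
  exact: measurable_funB.
- apply/(measurable_restrictT (EFin \o g)); first exact: measurable_itv.
  apply/measurable_EFinP; apply: measurable_funTS; apply: continuous_measurable_fun.
  by move=> s; exact: cg.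
move=> s _; rewrite patchE.
have [us|su] := leP u s; last first.
  by rewrite /=; case: ifPn => //; rewrite inE/= in_itv/= leNgt su.
have lin : k * (s - u) <= F s - F u \/ r < s.
  have [sr|] := leP s r; [left|by right].
  apply: (primitive_ge_cst mdq dqL dq0 us) => w /andP[uw ws].
  have w0 := lt_trans u0 uw.
  rewrite /radial_density w0 /k ler_pM ?(ltW lam0) ?exprn_ge0 ?(ltW u0)//.
    have wr : a <= w <= r by rewrite (le_trans au (ltW uw)) (le_trans ws).
    by have /andP[] := qin wr.
  by rewrite lerXn2r ?nnegrE ?(ltW u0) ?(ltW uw) ?(ltW w0).
have xs : s <= v -> 0 <= x - k * (s - u).
  move=> sv; rewrite subr_ge0 mulrC -ler_pdivlMr//.
  by rewrite lerBlDr addrC.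
case: ifPn => [/= sr|_]; last first.
  case: ifPn => //; rewrite inE/= in_itv/= => /andP[_ /xs xs0].
  by rewrite lee_fin gE mulr_ge0 ?invr_ge0 ?(ltW un0)// mulr_ge0.
case: lin => [lin|]; last by rewrite ltNge sr.
have [sv|vs] := leP s v.
  rewrite ifT; last by rewrite inE/= in_itv/= us.
  rewrite lee_fin gE ler_pM//.
  - by rewrite invr_ge0 exprn_ge0// (le_trans (ltW u0)).
  - by rewrite mulr_ge0// posr_ge0.
  - by rewrite lef_pV2 ?posrE ?exprn_gt0 ?(lt_le_trans u0 us)// lerXn2r ?nnegrE ?(ltW u0)// (le_trans (ltW u0)).
  - rewrite ler_wpM2l// /posr ge_max xs// andbT /x; lra.
rewrite [posr _]posr_eq0 ?mulr0; last first.
  have : x < k * (s - u).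
    by rewrite mulrC -ltr_pdivrMr// ltrBrDr addrC.
  rewrite /x; lra.
case: ifPn => //; rewrite inE/= in_itv/= => /andP[_ /xs xs0].
by rewrite lee_fin gE mulr_ge0 ?invr_ge0 ?(ltW un0)// mulr_ge0.
Qed.

(** If D^2 is an integral against the density of the mass f, then exchanging the
    integrals leaves that density, p u u^n, as the outer weight. A bound of the
    inner integral by D u^2 u^(-2 n) then yields the weight p u u^(-n), so that
    p appears on the right although it does not on the left. *)
Lemma mass_defect_tonelli (P : R -> pred R) (k : R -> R -> R) (D : R -> R) (c : R) :
  measurable_fun setT (fun z : R * R => P z.1 z.2) ->
  measurable_fun setT (fun z : R * R => k z.1 z.2) ->
  measurable_fun setT D -> 0 <= c -> (forall s u, 0 <= k s u) ->
  (forall s u, 0 < s <= r -> P s u -> 0 < u <= r) ->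
  (forall s, 0 < s <= r -> ((D s ^+ 2)%:E =
    \int[leb]_u (if P s u then k s u * radial_density n p u else 0)%:E)%E) ->
  (forall u, a <= u <= r -> 0 < u ->
    (\int[leb]_s (if (0 < s <= r) && P s u then s ^- n * k s u else 0)%:E <=
     (c * D u ^+ 2 * (u ^- n) ^+ 2)%:E)%E) ->
  (\int[leb]_s (if 0 < s <= r then D s ^+ 2 * s ^- n else 0)%:E <=
   c%:E * \int[leb]_s (if 0 < s <= r then p s * D s ^+ 2 * s ^- n else 0)%:E)%E.
Proof.
move=> mP mk mD c0 k0 Pr DE Dc.
have mr : measurable_fun setT (fun s : R => 0 < s <= r).
  exact: measurable_fun_lt_le.
have mV : measurable_fun setT (fun s : R => s ^- n) := measurable_exprV n.
pose K (z : R * R) : R := if (0 < z.1 <= r) && P z.1 z.2 then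
  z.1 ^- n * k z.1 z.2 * radial_density n p z.2 else 0.
have mK : measurable_fun setT K.
  apply: measurable_fun_ifT => //.
    by apply: measurable_and => //; exact: (measurableT_comp mr measurable_fst).
  apply: measurable_funM; last exact: (measurableT_comp mdp measurable_snd).
  by apply: measurable_funM => //; exact: (measurableT_comp mV measurable_fst).
have K0 z : (0 <= (K z)%:E)%E.
  rewrite lee_fin /K; case: ifPn => // /andP[/andP[s0 _] _].
  by rewrite mulr_ge0// mulr_ge0// invr_ge0 exprn_ge0 ?ltW.
have mEK : measurable_fun setT (EFin \o K) by exact/measurable_EFinP.
have -> : (\int[leb]_s (if 0 < s <= r then D s ^+ 2 * s ^- n else 0)%:E =
    \int[leb]_s \int[leb]_u (K (s, u))%:E)%E.
  apply: eq_integral => s _; have [sr|sr] := boolP (0 < s <= r); last first.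
    by rewrite integral0_eq// => u _; rewrite /K/= (negbTE sr).
  have sn0 : 0 <= s ^- n by case/andP: sr => s0 _; rewrite invr_ge0 exprn_ge0 ?ltW.
  rewrite mulrC EFinM DE// -ge0_integralZl//; last 2 first.
  - apply/measurable_EFinP; apply: measurable_fun_ifT => //.
      exact: (measurableT_comp mP (@pair1_measurable _ _ _ _ s)).
    apply: measurable_funM => //.
    exact: (measurableT_comp mk (@pair1_measurable _ _ _ _ s)).
  - by move=> u _; rewrite lee_fin; case: ifP => // _; rewrite mulr_ge0.
  apply: eq_integral => u _; rewrite /K/= sr -EFinM/=.
  by case: ifP => _; rewrite ?mulr0 ?mulrA.
rewrite (fubini_tonelli (m1 := leb) (m2 := leb) _ mEK K0).
rewrite -ge0_integralZl//; last 2 first.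
- apply/measurable_EFinP; apply: measurable_fun_ifT => //.
  by apply: measurable_funM => //; apply: measurable_funM => //; exact: measurable_funX.
- move=> u _; rewrite lee_fin; case: ifPn => // /andP[u0 _].
  by rewrite mulr_ge0 ?invr_ge0 ?exprn_ge0 ?(ltW u0)// mulr_ge0 ?sqr_ge0.
have mKs u : measurable_fun setT (fun s : R => if (0 < s <= r) && P s u then s ^- n * k s u else 0).
  apply: measurable_fun_ifT => //.
    apply: measurable_and => //.
    exact: (measurableT_comp mP (@pair2_measurable _ _ _ _ u)).
  apply: measurable_funM => //.
  exact: (measurableT_comp mk (@pair2_measurable _ _ _ _ u)).
apply: ge0_le_integral => //.
- by move=> u _; apply: integral_ge0 => s _; exact: K0.
- exact: (measurable_fun_fubini_tonelli_G (m1 := leb) _ mEK K0).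
- apply: emeasurable_funM => //; apply/measurable_EFinP; apply: measurable_fun_ifT => //.
  by apply: measurable_funM => //; apply: measurable_funM => //; exact: measurable_funX.
move=> u _ /=.
have [ur|ur] := boolP (0 < u <= r); last first.
  rewrite integral0_eq ?mule0// => s _; rewrite /K/=.
  case: ifPn => // /andP[sr Psu]; have := Pr s u sr Psu.
  by rewrite (negbTE ur).
have u0 : 0 < u by case/andP: ur.
have un0 : 0 < u ^+ n by rewrite exprn_gt0.
have [aur|aur] := boolP (a <= u <= r); last first.
  rewrite integral0_eq; last first.
    move=> s _; rewrite /K/= /radial_density u0 pout// mul0r mulr0.
    by rewrite if_same.
  by rewrite pout// !mul0r mule0.
rewrite (_ : (fun _ => _) = (fun s : R => (radial_density n p u)%:E *
    (if (0 < s <= r) && P s u then s ^- n * k s u else 0)%:E)%E); last first.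
  by apply/funext => s; rewrite /K/= -EFinM; case: ifP => _; rewrite ?mulr0// mulrC.
rewrite ge0_integralZl//; last 3 first.
- by apply/measurable_EFinP; exact: mKs.
- move=> s _; rewrite lee_fin; case: ifPn => // /andP[/andP[s0 _] _].
  by rewrite mulr_ge0// invr_ge0 exprn_ge0 ?ltW.
- by rewrite lee_fin.
apply: (@le_trans _ _ ((radial_density n p u)%:E *
    (c * D u ^+ 2 * (u ^- n) ^+ 2)%:E)%E).
  by rewrite lee_wpmul2l ?lee_fin// Dc.
rewrite -!EFinM lee_fin /radial_density u0 le_eqVlt; apply/orP; left; apply/eqP.
by field; rewrite gt_eqF.
Qed.

Lemma mass_defect_below :
  (\int[leb]_s (if 0 < s <= r then posr (F s - f s) ^+ 2 * s ^- n else 0)%:E <=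
   (A * (n.+1%:R / lam) ^+ 2)%:E *
   \int[leb]_s (if 0 < s <= r then p s * posr (F s - f s) ^+ 2 * s ^- n else 0)%:E)%E.
Proof.
apply: (@mass_defect_tonelli (fun s u => s < u <= r)
  (fun s u => 2 * posr (F s - f u)) (fun s => posr (F s - f s))).
- exact: measurable_fun_lt_le.
- apply: measurable_funM => //; apply: (measurableT_comp measurable_posr).
  apply: measurable_funB; [exact: (measurableT_comp mF measurable_fst)|].
  exact: (measurableT_comp mf measurable_snd).
- by apply: (measurableT_comp measurable_posr); exact: measurable_funB.
- by rewrite mulr_ge0 ?sqr_ge0// ltW.
- by move=> s u; rewrite mulr_ge0// posr_ge0.
- by move=> s u /andP[s0 _] /andP[su ->]; rewrite (lt_trans s0).
- move=> s /andP[s0 sr]; rewrite (posr_sqr_above _ sr)// massE F_homo//.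
move=> u aur u0; apply: le_trans (inner_bound_below aur u0).
rewrite le_eqVlt; apply/orP; left; apply/eqP; apply: eq_integral => s _.
case/andP: aur => _ ur; rewrite ur andbT.
congr ((if _ then _ else _)%:E).
have [su|] := ltP s u; last by rewrite !andbF.
by rewrite !andbT (le_trans (ltW su) ur) andbT.
Qed.

Lemma mass_defect_above :
  (\int[leb]_s (if 0 < s <= r then posr (f s - F s) ^+ 2 * s ^- n else 0)%:E <=
   (lam^-1)%:E *
   \int[leb]_s (if 0 < s <= r then p s * posr (f s - F s) ^+ 2 * s ^- n else 0)%:E)%E.
Proof.
apply: (@mass_defect_tonelli (fun s u => 0 < u <= s)
  (fun s u => 2 * posr (f u - F s)) (fun s => posr (f s - F s))).
- exact: measurable_fun_lt_le.
- apply: measurable_funM => //; apply: (measurableT_comp measurable_posr).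
  apply: measurable_funB; [exact: (measurableT_comp mf measurable_snd)|].
  exact: (measurableT_comp mF measurable_fst).
- by apply: (measurableT_comp measurable_posr); exact: measurable_funB.
- by rewrite invr_ge0 ltW.
- by move=> s u; rewrite mulr_ge0// posr_ge0.
- by move=> s u /andP[_ sr] /andP[-> us]; rewrite (le_trans us).
- by move=> s /andP[s0 _]; rewrite (posr_sqr_below (F_ge0 s) (ltW s0)).
move=> u aur u0; apply: le_trans (inner_bound_above aur u0).
rewrite le_eqVlt; apply/orP; left; apply/eqP; apply: eq_integral => s _.
rewrite u0/=; congr ((if _ then _ else _)%:E).
have [us|] := leP u s; last by rewrite !andbF.
by rewrite (lt_le_trans u0 us) andbT.
Qed.

(** The two signs of f - F are treated separately: excess mass of p is charged to
    the mass of p further inside, a deficit to the mass of p further outside,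
    which exists because the total masses agree. *)
Lemma mass_defect_le (C : R) : lam^-1 <= C -> A * (n.+1%:R / lam) ^+ 2 <= C ->
  (\int[leb]_s (if 0 < s <= r then (f s - F s) ^+ 2 * s ^- n else 0)%:E <=
   C%:E * \int[leb]_s (if 0 < s <= r then p s * (f s - F s) ^+ 2 * s ^- n else 0)%:E)%E.
Proof.
move=> C1 C2.
have C0 : 0 <= C by rewrite (le_trans _ C1)// invr_ge0 ltW.
have mV : measurable_fun setT (fun s : R => s ^- n) := measurable_exprV n.
have mP : measurable_fun setT (fun s : R => 0 < s <= r).
  exact: measurable_fun_lt_le.
(* Both integrands have this shape, with w = 1 and w = p. *)
pose I (w : R -> R) (D : R -> R) (s : R) : R := if 0 < s <= r then w s * D s ^+ 2 * s ^- n else 0.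
have split (w : R -> R) : measurable_fun setT w -> (forall s, 0 <= w s) ->
    (\int[leb]_s (I w (fun s => f s - F s) s)%:E =
     \int[leb]_s (I w (fun s => posr (f s - F s)) s)%:E +
     \int[leb]_s (I w (fun s => posr (F s - f s)) s)%:E)%E /\
    forall D, (0 <= \int[leb]_s (I w D s)%:E)%E.
  move=> mw w0; have I0 D s : (0 <= (I w D s)%:E)%E.
    rewrite lee_fin /I; case: ifPn => // /andP[s0 _].
    by rewrite mulr_ge0 ?invr_ge0 ?exprn_ge0 ?(ltW s0)// mulr_ge0 ?sqr_ge0.
  have mI (g h : R -> R) : measurable_fun setT g -> measurable_fun setT h ->
      measurable_fun setT (fun s => (I w (fun s => posr (g s - h s)) s)%:E).
    move=> mg mh; apply/measurable_EFinP; apply: measurable_fun_ifT => //.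
    apply: measurable_funM => //; apply: measurable_funM => //; apply: measurable_funX.
    by apply: (measurableT_comp measurable_posr); exact: measurable_funB.
  split; last by move=> D; exact: integral_ge0.
  rewrite -ge0_integralD//; [|exact: mI|exact: mI].
  apply: eq_integral => s _; rewrite -EFinD /I (posr_sqr_split (f s - F s)) opprB.
  by case: ifP => _; rewrite ?addr0// mulrDr mulrDl.
have one D : (\int[leb]_s (if 0 < s <= r then D s ^+ 2 * s ^- n else 0)%:E =
    \int[leb]_s (I (cst 1) D s)%:E)%E.
  by apply: eq_integral => s _; rewrite /I mul1r.
have [splitp p_ge0] := split p mp p0.
have [split1 _] := split (cst 1) (measurable_cst _) (fun=> ler01).
have below := mass_defect_below; rewrite (one (fun s => posr (F s - f s))) in below.
have above := mass_defect_above; rewrite (one (fun s => posr (f s - F s))) in above.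
rewrite (one (fun s => f s - F s)) split1 [X in (_ <= _ * X)%E]splitp.
rewrite ge0_muleDr ?p_ge0//; apply: leeD.
- by apply: (le_trans above); apply: lee_wpmul2r; [exact: p_ge0|rewrite lee_fin].
- by apply: (le_trans below); apply: lee_wpmul2r; [exact: p_ge0|rewrite lee_fin].
Qed.

End one_dimensional_inequality.

(** * The field of a radial charge *)

Section null_line.
Context {R : realType}.
Local Notation leb := (@lebesgue_measure R).

Lemma measurable_line n (w : Rn R n) :
  measurable [set y : Rn R n | dotv y w ^+ 2 = dotv y y].
Proof.
have m1 : measurable_fun setT (fun y : Rn R n => dotv y w ^+ 2 == dotv y y).
  apply: measurable_fun_eqr; first apply: measurable_funX.
    by apply: measurable_dotv => //; exact: measurable_id.
  by apply: measurable_dotv; exact: measurable_id.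
rewrite (_ : [set y | _] =
    setT `&` (fun y : Rn R n => dotv y w ^+ 2 == dotv y y) @^-1` [set true]).
  exact: m1.
by rewrite setTI; apply/seteqP; split => y /eqP.
Qed.

(** Equality in the Cauchy-Schwarz inequality puts y on the line spanned by w. A
    section with fixed first coordinate is at most one point if w has a nonzero
    first coordinate; otherwise all sections but one are empty. *)
Lemma negligible_line n (w : Rn R n.+2) : normv w = 1 ->
  lebesgue_Rn n.+2 [set y | dotv y w ^+ 2 = dotv y y] = 0%E.
Proof.
move=> w1; set Z := [set y | _].
have ww : dotv w w = 1 by rewrite -sqr_normv w1 expr1n.
have mZ : measurable Z := measurable_line w.
have Zline y : Z y -> y = scalev (dotv y w) w.
  move=> Zy; apply: eq_coord => i; apply/eqP; rewrite -subr_eq0 -coord_subv.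
  have : dotv (subv y (scalev (dotv y w) w)) (subv y (scalev (dotv y w) w)) = 0.
    by rewrite !dotvE ww (dotvC w y) -Zy; ring.
  rewrite -sqr_normv => /eqP; rewrite sqrf_eq0 => /eqP/normv0_eq0 ->.
  by rewrite coord_zerov.
rewrite -[LHS]mul1e -(@integral_cst _ _ _ _ _ mZ) integral_mkcond.
have mZ1 : measurable_fun setT (cst 1%E \_ Z : Rn R n.+2 -> \bar R).
  exact/(measurable_restrictT (cst 1%E)).
have Z10 y : (0 <= (cst 1%E \_ Z : Rn R n.+2 -> \bar R) y)%E.
  by rewrite patchE; case: ifP => // _; rewrite lee_fin.
rewrite lebesgue_Rn_tonelli//.
have mZc := measurableT_comp mZ1 (@measurable_Rn_cons R n.+1).
have sect (a : R) (t0 : Rn R n.+1) :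
    (forall t, Z (Rn_cons (a, t)) -> t = t0) ->
    (\int[lebesgue_Rn n.+1]_t ((cst 1%E \_ Z) (Rn_cons (a, t))) = 0 :> \bar R)%E.
  move=> Zt; rewrite (_ : 0%E = \int[lebesgue_Rn n.+1]_t (cst 0 t))%E; last first.
    by rewrite integral0.
  apply: ae_eq_integral => //.
    exact: (measurableT_comp mZc (@pair1_measurable _ _ _ _ a)).
  exists [set t0]; split; [exact: measurable_set1v|exact: lebesgue_Rn_set1|].
  move=> t /= /not_implyP[_ H]; apply: Zt; apply: contrapT => Zn; apply: H.
  by rewrite patchE memNset.
have c0 (a : R) t : coord (Rn_cons (a, t)) (ord0 : 'I_n.+2) = a by rewrite /coord tnth0.
have aE (a : R) t : Z (Rn_cons (a, t)) ->
    a = dotv (Rn_cons (a, t)) w * coord w ord0.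
  by move=> /Zline Zt; rewrite -{1}(c0 a t) {1}Zt coord_scalev.
have [w0|w0] := eqVneq (coord w ord0) 0.
  rewrite (_ : 0%E = \int[leb]_a (cst 0 a))%E; last by rewrite integral0.
  apply: ae_eq_integral => //.
    exact: (measurable_fun_fubini_tonelli_F (m2 := lebesgue_Rn n.+1) _ mZc
      (fun p => Z10 (Rn_cons p))).
  exists [set 0]; split; [exact: measurable_set1|exact: lebesgue_measure_set1|].
  move=> a /= /not_implyP[_ H]; apply: contrapT => a0; apply: H.
  apply: (@sect a [tuple 0 | _ < n.+1]) => t /aE.
  by rewrite w0 mulr0 => /a0.
rewrite integral0_eq// => a _.
apply: (@sect _ [tuple of behead (scalev (a / coord w ord0) w)]) => t Zt.
have -> : t = [tuple of behead (Rn_cons (a, t))] by exact/val_inj.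
rewrite [in LHS](Zline _ Zt); congr [tuple of behead (scalev _ w)].
by rewrite [in RHS](aE _ _ Zt) mulfK.
Qed.

End null_line.

Lemma Rintegral_sum_seq d' (T : measurableType d') (R : realType)
    (mu : {measure set T -> \bar R}) (I : Type) (s : seq I) (h : I -> T -> R) :
  (forall i, mu.-integrable setT (EFin \o h i)) ->
  mu.-integrable setT (EFin \o (fun x => \sum_(i <- s) h i x)) /\
  \int[mu]_x (\sum_(i <- s) h i x) = \sum_(i <- s) \int[mu]_x h i x.
Proof.
move=> ih; elim: s => [|i s [IHi IH]].
  split.
    by apply: eq_integrable (integrable0 _ _) => // x _; rewrite /= big_nil.
  under eq_Rintegral do rewrite big_nil.
  by rewrite big_nil Rintegral_cst// mul0r.
have E : (fun x => \sum_(j <- i :: s) h j x) = (fun x => h i x + \sum_(j <- s) h j x).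
  by apply/funext => x; rewrite big_cons.
rewrite E; split; first exact: (integrableD measurableT (ih i) IHi).
by rewrite RintegralD// IH big_cons.
Qed.

Lemma integrable_prod_restrict d1 d2 (X : measurableType d1) (Y : measurableType d2)
    (R : realType) (m1 : {sigma_finite_measure set X -> \bar R})
    (m2 : {sigma_finite_measure set Y -> \bar R})
    (f : X -> R) (g : Y -> R) (P : pred (X * Y)) :
  m1.-integrable setT (EFin \o f) -> m2.-integrable setT (EFin \o g) ->
  measurable_fun setT P ->
  (m1 \x m2)%E.-integrable setT (EFin \o (fun z => if P z then f z.1 * g z.2 else 0)).
Proof.
move=> /integrableP[mf fi] /integrableP[mg gi] mP.
have mf' : measurable_fun setT f by exact/measurable_EFinP.
have mg' : measurable_fun setT g by exact/measurable_EFinP.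
have mh : measurable_fun setT (fun z => if P z then f z.1 * g z.2 else 0).
  apply: measurable_fun_ifT => //; apply: measurable_funM.
    exact: (measurableT_comp mf' measurable_fst).
  exact: (measurableT_comp mg' measurable_snd).
apply/integrable12ltyP; first exact/measurable_EFinP.
apply: (@le_lt_trans _ _ (\int[m1]_x (`|(f x)%:E| * \int[m2]_y `|(g y)%:E|))%E).
  apply: ge0_le_integral => //.
  - by move=> x _; apply: integral_ge0.
  - have := measurable_fun_fubini_tonelli_F (m2 := m2)
      (fun z => `|(if P z then f z.1 * g z.2 else 0)%:E|%E).
    by apply => //; apply/measurable_EFinP; exact: measurableT_comp.
  - by apply: emeasurable_funM => //; exact: measurableT_comp.
  move=> x _; rewrite -ge0_integralZl//; last exact: measurableT_comp.
  apply: ge0_le_integral => //.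
  - apply: measurableT_comp => //; apply/measurable_EFinP.
    exact: (measurableT_comp mh (@pair1_measurable _ _ _ _ x)).
  - by apply: emeasurable_funM => //; exact: measurableT_comp.
  move=> y _ /=; case: ifP => _; first by rewrite normrM EFinM.
  by rewrite normr0 mule_ge0// lee_fin.
rewrite ge0_integralZr//; [|exact: measurableT_comp|exact: integral_ge0].
rewrite lte_mul_pinfty//; [exact: integral_ge0|].
rewrite ge0_fin_numE//; exact: integral_ge0.
Qed.

Lemma integrable_bounded_ball {R : realType} (n : nat) (h : Rn R n.+1 -> R) (M r : R) :
  measurable_fun setT h -> 0 <= r -> (forall x, `|h x| <= M) ->
  (forall x, r < normv x -> h x = 0) ->
  (lebesgue_Rn n.+1).-integrable setT (EFin \o h).
Proof.
move=> mh r0 hM h0; have s0 := @sphere_area_gt0 R n.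
have M0 : 0 <= M := le_trans (normr_ge0 _) (hM zerov).
apply/integrableP; split; first exact/measurable_EFinP.
pose b (s : R) : R := if s <= r then M else 0.
have mb : measurable_fun setT b.
  by apply: measurable_fun_ifT => //; exact: measurable_fun_ler.
have b0 s : 0 <= b s by rewrite /b; case: ifP.
apply: (@le_lt_trans _ _ (\int[lebesgue_Rn n.+1]_x (b (normv x))%:E)%E).
  apply: ge0_le_integral => //.
  - by apply: measurableT_comp => //; exact/measurable_EFinP.
  - apply/measurable_EFinP; apply: (measurableT_comp mb).
    exact: measurable_normvT.
  move=> x _; rewrite lee_fin /b; case: ifPn => //.
  by rewrite -ltNge => /h0 ->; rewrite normr0.
rewrite (@radial_integral R n (EFin \o b)); last 2 first.
- exact/measurable_EFinP.
- by move=> s; rewrite lee_fin.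
pose w (s : R) : R := b s * (if 0 < s then sphere_area R n.+1 * s ^+ n else 0).
have w0 s : 0 <= w s.
  rewrite mulr_ge0//; case: ifPn => // sp.
  by rewrite mulr_ge0 ?(ltW s0)// exprn_ge0// ltW.
have : (@lebesgue_measure R).-integrable setT (EFin \o w).
  apply: (@integrable_bounded_support _ _ (M * (sphere_area R n.+1 * r ^+ n)) r).
  - apply: measurable_funM => //; apply: measurable_fun_ifT => //.
      exact: measurable_fun_ltr.
    by apply: measurable_funM => //; exact: measurable_funX.
  - move=> s; rewrite ger0_norm// /w /b.
    case: ifPn => sr; last by rewrite mul0r !mulr_ge0 ?exprn_ge0 ?(ltW s0).
    rewrite ler_wpM2l//; case: ifPn => sp; last by rewrite !mulr_ge0 ?exprn_ge0 ?(ltW s0).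
    by rewrite ler_wpM2l ?(ltW s0)// lerXn2r ?nnegrE// ltW.
  - move=> s; rewrite /w /b; case: ifPn => sr; last by rewrite mul0r.
    case: ifPn => sp; last by rewrite mulr0.
    by rewrite gtr0_norm// ltNge sr.
move=> /integrableP[_]; congr (_ < _)%E; apply: eq_integral => s _ /=.
by rewrite ger0_norm// EFinM.
Qed.

Section radial_charge.
Context {R : realType} (n : nat).
Let d := n.+1.
Local Notation leb := (@lebesgue_measure R).
Local Notation lebn := (@lebesgue_Rn R d).
Local Notation sigma := (sphere_area R d).
Implicit Types w x y z : Rn R d.

(** The derivative along w, at the point z, of the potential of a unit charge at
    the origin. *)
Definition newton_flux w z : R := - (sigma^-1 * (dotv w z * normv z ^- d)).

(** The component along w of the gradient of the potential of the radial charge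
    of profile [p]. *)
Definition field_along (p : R -> R) w x : R :=
  \int[lebn]_y (newton_flux w (subv x y) * p (normv y)).

Let s0 : 0 < sigma := @sphere_area_gt0 R n.

Let mnormv : measurable_fun setT (fun x : Rn R d => normv x).
Proof. exact: measurable_normvT. Qed.

Lemma newton_flux_le w z : `|newton_flux w z| <= sigma^-1 * normv w * normv z ^- n.
Proof.
rewrite normrN normrM [`|sigma^-1|]ger0_norm ?invr_ge0 ?(ltW s0)// -mulrA.
by rewrite ler_wpM2l ?invr_ge0 ?(ltW s0)// dotv_exprV_le.
Qed.

Lemma measurable_newton_flux (d' : measure_display) (T : measurableType d')
    (fw fz : T -> Rn R d) : measurable_fun setT fw -> measurable_fun setT fz ->
  measurable_fun setT (fun t => newton_flux (fw t) (fz t)).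
Proof.
move=> mw mz; apply: measurable_funN; apply: measurable_funM => //.
by apply: measurable_funM; [exact: measurable_dotv|exact: measurable_normv_exprV].
Qed.

Variables (p : R -> R) (B r : R).
Hypotheses (mp : measurable_fun setT p) (pB : forall s, `|p s| <= B).
Hypotheses (r0 : 0 <= r) (p0 : forall s, r < s -> p s = 0).

Let B0 : 0 <= B. Proof. exact: le_trans (pB 0). Qed.

Let mpn : measurable_fun setT (fun y : Rn R d => p (normv y)).
Proof. exact: measurableT_comp. Qed.

Lemma field_along_integrable w x :
  lebn.-integrable setT (EFin \o (fun y => newton_flux w (subv x y) * p (normv y))) /\
  (\int[lebn]_y `|newton_flux w (subv x y) * p (normv y)|%:E <=
    (normv w * B * (r + normv x))%:E)%E.
Proof.
have [] // := @riesz_integrable R n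
  (fun y => newton_flux w (subv x y) * p (normv y)) x (sigma^-1 * normv w * B) r r0.
- by rewrite !mulr_ge0 ?invr_ge0 ?normv_ge0 ?(ltW s0).
- apply: measurable_funM => //; apply: measurable_newton_flux => //.
  by apply: measurable_subv => //; exact: measurable_id.
- move=> y; case: ifPn => [yr|]; last first.
    by rewrite -ltNge => /p0 ->; rewrite !mulr0 normr0.
  rewrite normrM mulrAC ler_pM//.
  by rewrite (le_trans (newton_flux_le _ _))// normv_subC.
move=> I1 I2; split => //; apply: (le_trans I2); rewrite lee_fin.
rewrite le_eqVlt; apply/orP; left; apply/eqP; field.
by rewrite gt_eqF.
Qed.

Lemma field_along_le w x : `|field_along p w x| <= normv w * B * (r + normv x).
Proof.
have [I1 I2] := field_along_integrable w x.
rewrite -lee_fin (le_trans _ I2)//.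
rewrite EFin_normr_Rintegral//.
by rewrite (le_trans (le_abse_integral _ _ _))//; exact: measurable_int I1.
Qed.

Lemma measurable_field_along (d' : measure_display) (T : measurableType d')
    (fw fx : T -> Rn R d) : measurable_fun setT fw -> measurable_fun setT fx ->
  measurable_fun setT (fun t => field_along p (fw t) (fx t)).
Proof.
move=> mw mx.
apply: (@measurable_Rintegral_section _ _ _ _ _ lebn (fun z : T * Rn R d =>
  newton_flux (fw z.1) (subv (fx z.1) z.2) * p (normv z.2))).
apply: measurable_funM; last exact: (measurableT_comp mpn measurable_snd).
apply: measurable_newton_flux; first exact: (measurableT_comp mw measurable_fst).
apply: measurable_subv; first exact: (measurableT_comp mx measurable_fst).
exact: measurable_snd.
Qed.

Lemma field_along_scale t w x : field_along p (scalev t w) x = t * field_along p w x.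
Proof.
have [I1 _] := field_along_integrable w x.
rewrite /field_along -RintegralZl//; apply: eq_Rintegral => y _.
by rewrite /newton_flux dotvZl; ring.
Qed.

Definition basisv (i : 'I_d) : Rn R d := translate zerov i 1.

Lemma dotv_basisv i x : dotv (basisv i) x = coord x i.
Proof.
rewrite /dotv (bigD1 i)//= coord_translate coord_zerov eqxx add0r mul1r.
rewrite big1 ?addr0// => j ji.
by rewrite coord_translate coord_zerov add0r eq_sym (negbTE ji) mul0r.
Qed.

Lemma sum_field_along w x :
  \sum_(i < d) coord w i * field_along p (basisv i) x = field_along p w x.
Proof.
rewrite /field_along.
have ih i : lebn.-integrable setT (EFin \o (fun y =>
    coord w i * (newton_flux (basisv i) (subv x y) * p (normv y)))).
  have [I1 _] := field_along_integrable (basisv i) x.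
  exact: (integrableZl measurableT (coord w i) I1).
have [_] := Rintegral_sum_seq (index_enum 'I_d) ih.
under [RHS]eq_bigr => i _.
  rewrite RintegralZl//; last by have [] := field_along_integrable (basisv i) x.
  over.
move=> <-; apply: eq_Rintegral => y _.
under eq_bigr => i _ do rewrite /newton_flux dotv_basisv.
rewrite /newton_flux [dotv w _]/dotv mulr_suml mulr_sumr -sumrN mulr_suml.
by apply: eq_bigr => i _; ring.
Qed.

Local Notation N := (radial_mass n p).

Section pairing.
Variables (q : R -> R) (Bq : R).
Hypotheses (mq : measurable_fun setT q) (qB : forall s, `|q s| <= Bq).

(** Gauss' law predicts the field - N s s^(-d) x at a point x with |x| = s;
    multiplied by x, this weight is - q times that field. *)
Definition pairing_weight (s : R) : R :=
  if 0 < s <= r then q s * N s * s ^- d else 0.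

Lemma measurable_pairing_weight : measurable_fun setT pairing_weight.
Proof.
apply: measurable_fun_ifT => //.
  exact: measurable_fun_lt_le.
apply: measurable_funM; last exact: measurable_exprV.
by apply: measurable_funM => //; exact: (measurable_radial_mass n mp pB r0 p0).
Qed.

Lemma pairing_weight_le s : `|pairing_weight s| <= Bq * B.
Proof.
have Bq0 : 0 <= Bq by exact: le_trans (qB 0).
rewrite /pairing_weight; case: ifPn => [/andP[sp _]|_]; last by rewrite normr0 mulr_ge0.
rewrite -mulrA normrM ler_pM// normrM [`|_ ^- _|]ger0_norm ?invr_ge0 ?exprn_ge0 ?(ltW sp)//.
rewrite ler_pdivrMr ?exprn_gt0//.
exact: (radial_mass_norm_le n mp pB r0 p0 (ltW sp)).
Qed.

Lemma pairing_weight_eq0 s : r < s -> pairing_weight s = 0.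
Proof. by move=> rs; rewrite /pairing_weight (leNgt s) rs andbF. Qed.

Let malpha := measurable_pairing_weight.
Let alphaB := pairing_weight_le.
Let alpha0 := pairing_weight_eq0.

Lemma flux_pairing_integrable : (lebn \x lebn)%E.-integrable setT (EFin \o
  (fun z : Rn R d * Rn R d => flux_density pairing_weight z.2 z.1 * p (normv z.2))).
Proof.
have Bq0 : 0 <= Bq by exact: le_trans (qB 0).
have mfd : measurable_fun setT (fun z : Rn R d * Rn R d =>
    flux_density pairing_weight z.2 z.1 * p (normv z.2)).
  apply: measurable_funM; first exact: measurable_flux_density.
  exact: (measurableT_comp mpn measurable_snd).
apply/integrable21ltyP; first exact/measurable_EFinP.
have Cr0 : 0 <= Bq * B * r by rewrite !mulr_ge0.
pose C := Bq * B * r * (sigma * (r + r)) * B.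
apply: (@le_lt_trans _ _ (\int[lebn]_y (C * (if normv y <= r then 1 else 0))%:E)%E).
  apply: ge0_le_integral => //.
  - by move=> y _; apply: integral_ge0.
  - have := measurable_fun_fubini_tonelli_G (m1 := lebn)
      (fun z : Rn R d * Rn R d => `|(flux_density pairing_weight z.2 z.1 * p (normv z.2))%:E|%E).
    apply => //; apply/measurable_EFinP; exact: measurableT_comp.
  - apply/measurable_EFinP; apply: measurable_funM => //.
    by apply: measurable_fun_ifT => //; exact: measurable_fun_ler.
  move=> y _ /=.
  have [yr|ry] := leP (normv y) r; last first.
    by rewrite integral0_eq ?mulr0// => x _; rewrite p0// mulr0 normr0.
  have [_ H] := @riesz_integrable R n (flux_density pairing_weight y) y _ r r0 Cr0
    (measurableT_comp (measurable_flux_density malpha) (@pair2_measurable _ _ _ _ y))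
    (flux_density_le alphaB alpha0 y).
  rewrite (_ : (fun _ => _) = (fun x => `|flux_density pairing_weight y x|%:E * `|p (normv y)|%:E)%E); last first.
    by apply/funext => x; rewrite normrM EFinM.
  rewrite ge0_integralZr//; last first.
    apply/measurable_EFinP; apply: measurableT_comp => //.
    exact: (measurableT_comp (measurable_flux_density malpha) (@pair2_measurable _ _ _ _ y)).
  rewrite mulr1 /C EFinM lee_pmul ?lee_fin//.
  - by apply: integral_ge0 => x _; rewrite lee_fin.
  - apply: (le_trans H); rewrite lee_fin ler_wpM2l// ler_wpM2l ?(ltW s0)//.
    by rewrite lerD2l.
have C0 : 0 <= C by rewrite !mulr_ge0 ?addr_ge0 ?(ltW s0).
have : lebn.-integrable setT (EFin \o (fun y => C * (if normv y <= r then 1 else 0))).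
  apply: (@integrable_bounded_ball _ n _ C r) => //.
  - apply: measurable_funM => //.
    by apply: measurable_fun_ifT => //; exact: measurable_fun_ler.
  - move=> y; rewrite ger0_norm; last by apply: mulr_ge0 => //; case: ifP.
    by case: ifP => _; rewrite ?mulr1 ?mulr0.
  - by move=> y yr; rewrite ifF ?mulr0//; apply/negbTE; rewrite -ltNge.
move=> /integrableP[_]; congr (_ < _)%E; apply: eq_integral => y _ /=.
by rewrite ger0_norm//; apply: mulr_ge0 => //; case: ifP.
Qed.

Lemma pairing_field_integrable :
  lebn.-integrable setT (EFin \o (fun x => pairing_weight (normv x) * field_along p x x)).
Proof.
have Bq0 : 0 <= Bq by exact: le_trans (qB 0).
have rr0 : 0 <= r * B * (r + r) by rewrite mulr_ge0 ?addr_ge0// mulr_ge0.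
apply: (@integrable_bounded_ball _ n _ (Bq * B * (r * B * (r + r))) r) => //.
- apply: measurable_funM; first exact: measurableT_comp.
  by apply: measurable_field_along; exact: measurable_id.
- move=> x; have [xr|rx] := leP (normv x) r; last first.
    by rewrite alpha0// mul0r normr0 mulr_ge0// mulr_ge0.
  rewrite normrM ler_pM// (le_trans (field_along_le _ _))//.
  by rewrite ler_pM ?mulr_ge0 ?addr_ge0 ?normv_ge0// ?ler_wpM2r// lerD2l.
- by move=> x rx; rewrite alpha0// mul0r.
Qed.

(** The field need not be computed pointwise. Exchanging the integrals over the
    point x and the charge y, Gauss' law replaces the inner integral by a tail
    integral over s > |y|; exchanging once more, the charges inside radius s add
    up to N s. *)
Lemma flux_pairing :
  \int[lebn]_x (pairing_weight (normv x) * field_along p x x) =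
  - (sigma * \int[leb]_s (if 0 < s <= r then q s * N s ^+ 2 * s ^- n else 0)).
Proof.
set alpha := pairing_weight.
have alpha0' s : r < s -> alpha s = 0 by exact: alpha0.
pose A1 t := \int[leb]_s (if t < s then alpha s * s else 0).
have Bq0 : 0 <= Bq by exact: le_trans (qB 0).
have alphas s : `|alpha s * s| <= Bq * B * r.
  have [s0'|sp] := leP s 0.
    by rewrite /alpha /pairing_weight (ltNge 0 s) s0' mul0r normr0 !mulr_ge0.
  have [sr|/alpha0' ->] := leP s r; last by rewrite mul0r normr0 !mulr_ge0.
  by rewrite normrM ler_pM// ger0_norm// ltW.
have malphas : measurable_fun setT (fun s => alpha s * s) by exact: measurable_funM.
have alphas0 s : r < `|s| -> alpha s * s = 0.
  have [s0'|sp] := leP s 0; first by rewrite /alpha /pairing_weight (ltNge 0 s) s0' mul0r.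
  by rewrite gtr0_norm// => /alpha0' ->; rewrite mul0r.
have mk2 : measurable_fun setT (fun z : R * R => if z.1 < z.2 then alpha z.2 * z.2 else 0).
  apply: measurable_fun_ifT => //; first exact: measurable_fun_ltr.
  exact: (measurableT_comp malphas measurable_snd).
have mA1 : measurable_fun setT A1.
  exact: (@measurable_Rintegral_section _ _ _ _ _ leb
    (fun z : R * R => if z.1 < z.2 then alpha z.2 * z.2 else 0)).
have mlt (t : R) : measurable_fun setT (fun s : R => t < s) by exact: measurable_fun_ltr.
have intA t := integrable_restricted malphas alphas alphas0 (mlt t).
have A1E y : \int[lebn]_x flux_density alpha y x = sigma * A1 (normv y).
  by have := gauss_law malpha r0 alphaB alpha0 y.
pose W (y : Rn R d) := p (normv y) * A1 (normv y).
have intW : lebn.-integrable setT (EFin \o W).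
  have mW : measurable_fun setT W.
    by apply: measurable_funM => //; exact: measurableT_comp.
  apply: (@integrable_bounded_ball _ n _ (B * (Bq * B * r * r)) r) => //; last first.
    by move=> y /p0 yr; rewrite /W yr mul0r.
  move=> y; have [yr|/p0 yr] := leP (normv y) r; last first.
    by rewrite /W yr mul0r normr0 !mulr_ge0.
  rewrite normrM ler_pM//.
  rewrite (_ : A1 _ = primitive (fun s => alpha s * s) r -
      primitive (fun s => alpha s * s) (normv y)); last first.
    rewrite (primitiveB malphas alphas alphas0 yr); apply: eq_Rintegral => s _.
    have [sr|rs] := leP s r; first by rewrite andbT.
    rewrite andbF; case: ifP => // _; apply: alphas0.
    by rewrite (lt_le_trans rs)// ler_norm.
  rewrite (le_trans (primitive_lip malphas alphas alphas0 _ _))// ler_wpM2l ?mulr_ge0//.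
  by rewrite ger0_norm ?subr_ge0// lerBlDr lerDl normv_ge0.
have step1 : \int[lebn]_x (alpha (normv x) * field_along p x x) = - \int[lebn]_y W y.
  transitivity (\int[lebn]_x \int[lebn]_y
      (- sigma^-1 * (flux_density alpha y x * p (normv y)))).
    apply: eq_Rintegral => x _; rewrite /field_along.
    have [I1 _] := field_along_integrable x x.
    rewrite -RintegralZl//; apply: eq_Rintegral => y _.
    by rewrite /newton_flux /flux_density; ring.
  have I := integrableZl measurableT (- sigma^-1) flux_pairing_integrable.
  rewrite (@Rintegral_fubini _ _ _ _ _ lebn lebn
    (fun x y => - sigma^-1 * (flux_density alpha y x * p (normv y))) I).
  transitivity (\int[lebn]_y (-1 * W y)).
    apply: eq_Rintegral => y _.
    under eq_Rintegral do rewrite (mulrC _ (p _)) mulrA.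
    rewrite RintegralZl//; last exact: (integrable_flux_density malpha r0 alphaB alpha0).
    rewrite A1E /W; field.
    by rewrite gt_eqF.
  by rewrite RintegralZl ?mulN1r.
rewrite step1; congr (- _).
pose w1 (t : R) := p t * A1 t.
have mw1 : measurable_fun setT w1 by exact: measurable_funM.
have [J1 ->] := @radial_Rintegral R n w1 mw1 intW.
pose dens := radial_density n p.
have mdens := measurable_radial_density n mp.
have densB := radial_density_le n pB r0 p0.
have dens0 := radial_density_eq0 n p0.
transitivity (\int[leb]_t (sigma * (dens t * A1 t))).
  apply: eq_Rintegral => t _; rewrite /w1 /dens /radial_density.
  by case: ifP => _; rewrite ?mulr0 ?mul0r ?mulr0//; ring.
have J2 : leb.-integrable setT (EFin \o (fun t => dens t * A1 t)).
  have := integrableZl measurableT (sigma^-1) J1.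
  apply: eq_integrable => // t _ /=; rewrite -EFinM; congr EFin.
  rewrite /w1 /dens /radial_density; case: ifP => _; last by rewrite !mulr0 mul0r.
  by field; rewrite gt_eqF.
rewrite RintegralZl//; congr (_ * _).
have K : (leb \x leb)%E.-integrable setT (EFin \o (fun z : R * R =>
    if z.1 < z.2 then dens z.1 * (alpha z.2 * z.2) else 0)).
  have idens := integrable_bounded_support mdens densB dens0.
  have ialpha := integrable_bounded_support malphas alphas alphas0.
  have mlt2 : measurable_fun setT (fun z : R * R => z.1 < z.2).
    exact: measurable_fun_ltr.
  exact: (integrable_prod_restrict idens ialpha mlt2).
transitivity (\int[leb]_t \int[leb]_s (if t < s then dens t * (alpha s * s) else 0)).
  apply: eq_Rintegral => t _; rewrite -RintegralZl//; last exact: intA.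
  by apply: eq_Rintegral => s _; case: ifP => _; rewrite ?mulr0.
rewrite (@Rintegral_fubini _ _ _ _ _ leb leb
  (fun t s => if t < s then dens t * (alpha s * s) else 0) K).
apply: eq_Rintegral => s _.
transitivity (\int[leb]_t ((alpha s * s) * (if t < s then dens t else 0))).
  by apply: eq_Rintegral => t _; case: ifP => _; rewrite ?mulr0// mulrC.
have ilt : leb.-integrable setT (fun t => (if t < s then dens t else 0)%:E).
  by apply: (integrable_restricted mdens densB dens0); exact: measurable_fun_ltr.
have ile : leb.-integrable setT (fun t => (if t <= s then dens t else 0)%:E).
  by apply: (integrable_restricted mdens densB dens0); exact: measurable_fun_ler.
rewrite RintegralZl//.
rewrite (@eq_Rintegral_off _ _ (fun t => if t <= s then dens t else 0) s ilt ile); last first.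
  by move=> t ts; rewrite lt_neqAle ts.
rewrite -/(primitive dens s) -/(N s) /alpha /pairing_weight.
case: ifPn => [/andP[sp _]|_]; last by rewrite !mul0r.
by rewrite /d exprS; field; rewrite expf_eq0 gt_eqF// andbF.
Qed.

End pairing.
End radial_charge.

(** * The potential along rays and the interaction energy *)

Section radial_potential.
Context {R : realType} (m : nat).
Let n := m.+1.
Let d := n.+1.
Local Notation leb := (@lebesgue_measure R).
Local Notation lebn := (@lebesgue_Rn R d).
Local Notation sigma := (sphere_area R d).
Implicit Types w x y z : Rn R d.

Variables (G : R -> R).
Hypotheses (mG : measurable_fun setT G).
Hypothesis dG : forall v : R, 0 < v -> is_derive v 1 G (- (sigma^-1 * v ^- n)).
Hypothesis Gle : forall rho, 0 <= rho -> exists2 C, 0 <= C &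
  forall v, 0 <= v <= rho -> `|G v| <= C * v ^- n.

Variables (p : R -> R) (B r : R).
Hypotheses (mp : measurable_fun setT p) (pB : forall s, `|p s| <= B).
Hypotheses (r0 : 0 <= r) (p0 : forall s, r < s -> p s = 0).

Let s0 : 0 < sigma := @sphere_area_gt0 R n.
Let B0 : 0 <= B. Proof. exact: le_trans (pB 0). Qed.
Let mnormv : measurable_fun setT (fun x : Rn R d => normv x).
Proof. exact: measurable_normvT. Qed.
Let mpn : measurable_fun setT (fun y : Rn R d => p (normv y)).
Proof. exact: measurableT_comp. Qed.

Definition potential x : R := \int[lebn]_y (G (normv (subv x y)) * p (normv y)).

Lemma potential_integrable (rho : R) : 0 <= rho -> exists C, forall x, normv x <= rho ->
  lebn.-integrable setT (EFin \o (fun y => G (normv (subv x y)) * p (normv y))) /\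
  `|potential x| <= C.
Proof.
move=> rho0; have [C C0 GC] := Gle (addr_ge0 rho0 r0).
exists (C * B * (sigma * (r + rho))) => x xrho.
have mh : measurable_fun setT (fun y => G (normv (subv x y)) * p (normv y)).
  apply: measurable_funM => //; apply: measurableT_comp => //.
  apply: measurable_normv; apply: measurable_subv => //; exact: measurable_id.
have [] // := @riesz_integrable R n _ x (C * B) r r0 (mulr_ge0 C0 B0) mh.
  move=> y; case: ifPn => [yr|]; last first.
    by rewrite -ltNge => /p0 ->; rewrite !mulr0 normr0.
  rewrite normrM mulrAC ler_pM// [normv (subv y x)]normv_subC GC// normv_ge0/=.
  by rewrite (le_trans (normv_sub_le _ _))// lerD.
move=> I1 I2; split => //; rewrite -lee_fin EFin_normr_Rintegral//.
rewrite (le_trans (le_abse_integral _ _ _))//; first exact: measurable_int I1.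
apply: (le_trans I2); rewrite lee_fin ler_wpM2l ?mulr_ge0// ler_wpM2l ?(ltW s0)//.
by rewrite lerD2l.
Qed.

Lemma measurable_potential (d' : measure_display) (T : measurableType d')
    (fx : T -> Rn R d) : measurable_fun setT fx ->
  measurable_fun setT (fun t => potential (fx t)).
Proof.
move=> mx.
apply: (@measurable_Rintegral_section _ _ _ _ _ lebn (fun z : T * Rn R d =>
  G (normv (subv (fx z.1) z.2)) * p (normv z.2))).
apply: measurable_funM; last exact: (measurableT_comp mpn measurable_snd).
apply: measurableT_comp => //; apply: measurable_normv.
apply: measurable_subv; first exact: (measurableT_comp mx measurable_fst).
exact: measurable_snd.
Qed.

(** Since y is off the line spanned by w, the kernel is smooth along the ray. *)
Lemma kernel_along_ray w y (s t : R) : normv w = 1 -> dotv y w ^+ 2 != dotv y y ->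
  s <= t ->
  leb.-integrable setT
    (fun u => (if s < u <= t then newton_flux w (subv (scalev u w) y) else 0)%:E) /\
  \int[leb]_u (if s < u <= t then newton_flux w (subv (scalev u w) y) else 0) =
  G (normv (subv (scalev t w) y)) - G (normv (subv (scalev s w) y)).
Proof.
move=> w1 yw st; have ww : dotv w w = 1 by rewrite -sqr_normv w1 expr1n.
have [b bE] : exists b, b = dotv y w by eexists.
pose D := dotv y y - b ^+ 2.
have D0 : 0 < D.
  rewrite subr_gt0 bE lt_neqAle yw/= -sqr_normv -(real_normK (num_real (dotv y w))).
  rewrite lerXn2r ?nnegrE ?normv_ge0//.
  by have := cauchy_schwarz y w; rewrite w1 mulr1.
pose P (u : R) := 1 * (1 * u + - b) ^+ 2 + D.
have P0 (u : R) : 0 < P u by rewrite /P mul1r ltr_wpDl// sqr_ge0.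
have nE (u : R) : normv (subv (scalev u w) y) = Num.sqrt (P u).
  rewrite normv_dotv !dotvE ww (dotvC w y) -bE; congr Num.sqrt.
  by rewrite /P /D; ring.
have dP (u : R) : is_derive u 1 P (2 * 1 * 1 * (1 * u + - b)).
  have -> : P = (fun u : R => 1 * (1 * u + - b) ^+ 2) + cst D by [].
  have dA := @is_derive1_affine_sqr R 1 1 (- b) u.
  by apply: is_derive_eq; rewrite addr0.
have sP (u : R) : 0 < Num.sqrt (P u) by rewrite sqrtr_gt0.
have dS (u : R) : is_derive u 1 (Num.sqrt \o P)
    ((2 * Num.sqrt (P u))^-1 * (2 * 1 * 1 * (1 * u + - b))).
  exact: (@is_derive1_comp _ (@Num.sqrt R) P u _ _ (is_derive1_sqrt (P0 u)) (dP u)).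
pose g (u : R) := - (sigma^-1 * ((u - b) * Num.sqrt (P u) ^- d)).
have gE (u : R) : newton_flux w (subv (scalev u w) y) = g u.
  by rewrite /newton_flux nE dotvBr dotvZr ww mulr1 (dotvC w y) -bE.
have dh (u : R) : is_derive u 1 (G \o (Num.sqrt \o P)) (g u).
  have dc := @is_derive1_comp _ G (Num.sqrt \o P) u _ _ (dG (sP u)) (dS u).
  apply: is_derive_eq; rewrite /g /d exprS /=; field.
  by rewrite !gt_eqF// ?exprn_gt0.
have cg (u : R) : {for u, continuous g}.
  apply: cvgN; apply: cvgM; first exact: cvg_cst.
  apply: cvgM; first by apply: cvgB; [exact: cvg_id|exact: cvg_cst].
  have dc := @is_derive1_comp _ (fun v : R => v ^- d) (Num.sqrt \o P) u _ _
    (is_derive1_exprV d (sP u)) (dS u).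
  have : {for u, continuous ((fun v : R => v ^- d) \o (Num.sqrt \o P))}; last exact.
  by apply: differentiable_continuous; apply/derivable1_diffP; case: dc.
rewrite !nE; have [I1 <-] := @Rintegral_itv_derive _ (G \o (Num.sqrt \o P)) g s t st
  (fun u _ => dh u) (fun u _ => cg u).
split; last by apply: eq_Rintegral => u _; rewrite gE.
by apply: eq_integrable I1 => // u _; rewrite gE.
Qed.

(** Integrate [kernel_along_ray] over the charges y; those on the line form a
    null set. *)
Lemma potential_along_ray w (s : R) : normv w = 1 -> 0 <= s <= r ->
  potential (scalev r w) - potential (scalev s w) =
  \int[leb]_u (if s < u <= r then field_along p w (scalev u w) else 0).
Proof.
move=> w1 /andP[sp sr].
have nsw u : 0 <= u -> normv (scalev u w) = u.
  by move=> u0; rewrite normvZ w1 mulr1 ger0_norm.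
have [C UC] := potential_integrable r0.
have hr : normv (scalev r w) <= r by rewrite nsw.
have hs : normv (scalev s w) <= r by rewrite nsw.
have [Ir _] := UC _ hr; have [Is _] := UC _ hs.
have Irs := integrableB measurableT Ir Is.
pose f y u := if s < u <= r then newton_flux w (subv (scalev u w) y) * p (normv y) else 0.
have mf : measurable_fun setT (fun z : Rn R d * R => f z.1 z.2).
  apply: measurable_fun_ifT => //.
    exact: measurable_fun_lt_le.
  apply: measurable_funM; last exact: (measurableT_comp mpn measurable_fst).
  apply: measurable_newton_flux => //; apply: measurable_subv; last exact: measurable_fst.
  by apply: measurable_scalev => //; exact: measurable_snd.
have intf : (lebn \x leb)%E.-integrable setT (EFin \o (fun z : Rn R d * R => f z.1 z.2)).
  apply/integrable21ltyP; first exact/measurable_EFinP.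
  pose b (u : R) : R := if s < u <= r then B * (r + r) else 0.
  have ib : leb.-integrable setT (EFin \o b).
    apply: (@integrable_bounded_support _ _ (B * (r + r)) r).
    - apply: measurable_fun_ifT => //.
      exact: measurable_fun_lt_le.
    - move=> u; rewrite /b; case: ifP => _; rewrite ?normr0 ?mulr_ge0 ?addr_ge0//.
      by rewrite ger0_norm// mulr_ge0// addr_ge0.
    - move=> u ru; rewrite /b; case: ifPn => // /andP[su ur].
      by move: ru; rewrite ger0_norm ?(le_trans sp (ltW su))// ltNge ur.
  move/integrableP : ib => [mb]; apply: le_lt_trans.
  apply: ge0_le_integral => //.
  - by move=> u _; apply: integral_ge0.
  - have := measurable_fun_fubini_tonelli_G (m1 := lebn)
      (fun z : Rn R d * R => `|(f z.1 z.2)%:E|%E).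
    by apply => //; apply/measurable_EFinP; exact: measurableT_comp.
  - exact: measurableT_comp.
  move=> u _; rewrite /= /b /f; case: ifPn => [/andP[su ur]|_]; last first.
    by rewrite integral0_eq// => y _; rewrite normr0.
  have [_ I2] := field_along_integrable mp pB r0 p0 w (scalev u w).
  apply: (le_trans I2); rewrite w1 mul1r nsw ?(le_trans sp (ltW su))//.
  by rewrite lee_fin (le_trans _ (ler_norm _))// ler_wpM2l// lerD2l.
rewrite /potential -RintegralB//.
transitivity (\int[lebn]_y \int[leb]_u f y u).
  congr fine; apply: ae_eq_integral => //.
  - exact: measurable_int Irs.
  - exact: measurable_int (integrable_Rintegral_section intf).
  exists [set y | dotv y w ^+ 2 = dotv y y]; split.
  - exact: measurable_line.
  - exact: negligible_line.
  move=> y /= /not_implyP[_ H]; apply: contrapT => /eqP yw; apply: H.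
  have [I1 I2] := kernel_along_ray w1 yw sr.
  rewrite -mulrBl -I2; congr EFin.
  under [in RHS]eq_Rintegral => u _.
    rewrite (_ : f y u = p (normv y) *
      (if s < u <= r then newton_flux w (subv (scalev u w) y) else 0)); last first.
      by rewrite /f; case: ifP => _; rewrite ?mulr0// mulrC.
    over.
  by rewrite RintegralZl// mulrC.
rewrite (@Rintegral_fubini _ _ _ _ _ lebn leb f intf).
apply: eq_Rintegral => u _; rewrite /f; case: ifP => // _.
by rewrite Rintegral_cst// mul0r.
Qed.

Local Notation N := (radial_mass n p).
Hypothesis Nr : N r = 0.

Let dens := radial_density n p.
Let mdens := measurable_radial_density n mp.
Let densB := radial_density_le n pB r0 p0.
Let dens0 := radial_density_eq0 n p0.

Let idens : leb.-integrable setT (EFin \o dens).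
Proof. exact: integrable_bounded_support mdens densB dens0. Qed.

Let mray w : measurable_fun setT (fun u : R => scalev u w).
Proof. by apply: measurable_scalev => //; exact: measurable_id. Qed.

Let nray w (u : R) : normv w = 1 -> 0 <= u -> normv (scalev u w) = u.
Proof. by move=> w1 u0; rewrite normvZ w1 mulr1 ger0_norm. Qed.

(** Integration by parts along the ray. The boundary term is the product of the
    potential at radius r and the total mass, which is zero. *)
Lemma energy_along_ray w : normv w = 1 ->
  \int[leb]_s (dens s * potential (scalev s w)) =
  - \int[leb]_u (if 0 < u <= r then field_along p w (scalev u w) * N u else 0).
Proof.
move=> w1.
pose nu (u : R) : R := if 0 < u <= r then field_along p w (scalev u w) else 0.
have mr : measurable_fun setT (fun u : R => 0 < u <= r).
  exact: measurable_fun_lt_le.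
have mnu : measurable_fun setT nu.
  by apply: measurable_fun_ifT => //; exact: (measurable_field_along mp).
have nuB u : `|nu u| <= B * (r + r).
  rewrite /nu; case: ifPn => [/andP[u0 ur]|_]; last first.
    by rewrite normr0 mulr_ge0// addr_ge0.
  rewrite (le_trans (field_along_le mp pB r0 p0 _ _))// w1 mul1r nray ?(ltW u0)//.
  by rewrite ler_wpM2l// lerD2l.
have nu0 u : r < `|u| -> nu u = 0.
  move=> ru; rewrite /nu; case: ifPn => // /andP[u0 ur].
  by move: ru; rewrite gtr0_norm// ltNge ur.
have inu : leb.-integrable setT (EFin \o nu).
  exact: integrable_bounded_support mnu nuB nu0.
have mlt2 : measurable_fun setT (fun z : R * R => z.1 < z.2) by exact: measurable_fun_ltr.
have K := integrable_prod_restrict idens inu mlt2.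
have iK := integrable_Rintegral_section K.
transitivity (\int[leb]_s (potential (scalev r w) * dens s -
    \int[leb]_u (if s < u then dens s * nu u else 0))).
  apply: eq_Rintegral => s _.
  have [sr|sr] := boolP (0 < s <= r); last first.
    have -> : dens s = 0.
      rewrite /dens /radial_density; case: ifPn => // sp.
      by rewrite p0 ?mul0r// ltNge; apply: contra sr => ->; rewrite sp.
    rewrite mul0r mulr0 sub0r (_ : (fun _ => _) = cst 0).
      by rewrite Rintegral_cst// mul0r oppr0.
    by apply/funext => u; rewrite mul0r if_same.
  have /andP[sp sr'] := sr.
  have sr0 : 0 <= s <= r by rewrite ltW.
  have E : potential (scalev s w) = potential (scalev r w) -
      \int[leb]_u (if s < u then nu u else 0).
    rewrite (_ : \int[leb]_u (if s < u then nu u else 0) =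
        potential (scalev r w) - potential (scalev s w)); first by ring.
    rewrite potential_along_ray//; apply: eq_Rintegral => u _; rewrite /nu.
    by case: ltP => //= su; rewrite (lt_trans sp su).
  rewrite E mulrBr mulrC -RintegralZl//; last first.
    by apply: (integrable_restricted mnu nuB nu0); exact: measurable_fun_ltr.
  by congr (_ - _); apply: eq_Rintegral => u _; case: ifP => _; rewrite ?mulr0.
rewrite RintegralB//; last exact: (integrableZl measurableT (potential (scalev r w)) idens).
rewrite RintegralZl//.
rewrite (_ : \int[leb]_s dens s = 0); last first.
  rewrite -Nr /radial_mass /primitive; apply: eq_Rintegral => u _.
  case: ifPn => //; rewrite -ltNge => ru.
  by rewrite /dens dens0// (lt_le_trans ru)// ler_norm.
rewrite mulr0 sub0r; congr (- _).
rewrite (@Rintegral_fubini _ _ _ _ _ leb leb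
  (fun s u => if s < u then dens s * nu u else 0) K).
apply: eq_Rintegral => u _.
transitivity (\int[leb]_s (nu u * (if s < u then dens s else 0))).
  by apply: eq_Rintegral => s _; case: ifP => _; rewrite ?mulr0// mulrC.
have ilt : leb.-integrable setT (fun t => (if t < u then dens t else 0)%:E).
  by apply: (integrable_restricted mdens densB dens0); exact: measurable_fun_ltr.
have ile : leb.-integrable setT (fun t => (if t <= u then dens t else 0)%:E).
  by apply: (integrable_restricted mdens densB dens0); exact: measurable_fun_ler.
rewrite RintegralZl//.
rewrite (@eq_Rintegral_off _ _ (fun t => if t <= u then dens t else 0) u ilt ile); last first.
  by move=> t tu; rewrite lt_neqAle tu.
rewrite -/(primitive dens u) -/(N u) /nu.
by case: ifP => _; rewrite ?mul0r.
Qed.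

(** In polar coordinates the energy is an average of the integrals along rays,
    and these assemble to the pairing of the field with the radial vector field
    of [flux_pairing] for q = 1. *)
Lemma energy_formula :
  lebn.-integrable setT (EFin \o (fun x => potential x * p (normv x))) /\
  \int[lebn]_x (potential x * p (normv x)) =
  sigma * \int[leb]_s (if 0 < s <= r then N s ^+ 2 * s ^- n else 0).
Proof.
have [C UC] := potential_integrable r0.
have mid : measurable_fun setT (fun x : Rn R d => x) by exact: measurable_id.
have I1 : lebn.-integrable setT (EFin \o (fun x => potential x * p (normv x))).
  apply: (@integrable_bounded_ball _ n _ (`|C| * B) r) => //.
  - by apply: measurable_funM => //; exact: measurable_potential.
  - move=> x; have [xr|/p0 ->] := leP (normv x) r; last by rewrite mulr0 normr0 mulr_ge0.
    rewrite normrM ler_pM//; have [_ H] := UC x xr.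
    by rewrite (le_trans H)// ler_norm.
  - by move=> x /p0 ->; rewrite mulr0.
split => //.
have q1 (s : R) : `|cst 1 s| <= 1 :> R by rewrite normr1.
have mq1 : measurable_fun [set: R] (cst 1 : R -> R) by [].
have FP := @flux_pairing R n p B r mp pB r0 p0 (cst 1) 1 mq1 q1.
have I2 := @pairing_field_integrable R n p B r mp pB r0 p0 (cst 1) 1 mq1 q1.
set alpha := pairing_weight n p r (cst 1) in FP I2.
transitivity (- \int[lebn]_x (alpha (normv x) * field_along p x x)); last first.
  rewrite FP opprK; congr (_ * _); apply: eq_Rintegral => s _.
  by case: ifP => // _; rewrite /cst mul1r.
have PC := @polar_coordinates R n.
rewrite (weighted_image_Rintegral PC I1) (weighted_image_Rintegral PC I2).
have J1 := weighted_image_integrable PC I1.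
have J2 := weighted_image_integrable PC I2.
rewrite (Rintegral_prod J1) (Rintegral_prod J2) -mulN1r -RintegralZl//; last first.
  exact: (integrable_Rintegral_section J2).
apply: eq_Rintegral => z _; rewrite /polar_weight/=.
have [zB|zB] := boolP (0 < normv z <= 1); last first.
  under eq_Rintegral do rewrite mulr0.
  under [in RHS]eq_Rintegral do rewrite mulr0.
  by rewrite Rintegral_cst// mul0r mulr0.
have z0 : 0 < normv z by case/andP: zB.
have [w wE] : exists w, w = scalev (normv z)^-1 z by eexists.
have w1 : normv w = 1 by rewrite wE normvZ gtr0_norm ?invr_gt0// mulVf// gt_eqF.
have pm s : polar_map (z, s) = scalev s w.
  by apply: eq_coord => i; rewrite wE !coordE/= mulrA.
transitivity (\int[leb]_s (d%:R * (dens s * potential (scalev s w)))).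
  apply: eq_Rintegral => s _; rewrite pm /= /dens /radial_density.
  case: ifPn => sp; last by rewrite mul0r !mulr0.
  by rewrite nray ?(ltW sp)// mulrCA -[X in _ * X]mulrA [X in _ * X]mulrC.
rewrite RintegralZl//; last first.
  apply: (@integrable_bounded_support _ _ ((B * r ^+ n) * `|C|) r).
  - by apply: measurable_funM => //; exact: measurable_potential.
  - move=> s; have [sr|sr] := boolP (0 < s <= r); last first.
      have -> : dens s = 0.
        rewrite /dens /radial_density; case: ifPn => // sp.
        by rewrite p0 ?mul0r// ltNge; apply: contra sr => ->; rewrite sp.
      by rewrite mul0r normr0 (mulr_ge0 (mulr_ge0 B0 (exprn_ge0 _ r0)) (normr_ge0 _)).
    have /andP[sp sr'] := sr.
    have H : normv (scalev s w) <= r by rewrite nray// ltW.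
    by rewrite normrM ler_pM// (le_trans (UC _ H).2)// ler_norm.
  - by move=> s /dens0 ds; rewrite /dens ds mul0r.
rewrite energy_along_ray//.
rewrite mulrN mulN1r; congr (- _); rewrite -RintegralZl//; last first.
  apply: (@integrable_bounded_support _ _ ((B * (r + r)) * (B * r ^+ n.+1)) r).
  - apply: measurable_fun_ifT => //.
      exact: measurable_fun_lt_le.
    apply: measurable_funM; first exact: (measurable_field_along mp).
    exact: (measurable_radial_mass n mp pB r0 p0).
  - move=> s; case: ifPn => [/andP[sp sr]|_]; last first.
      by rewrite normr0 (mulr_ge0 (mulr_ge0 B0 (addr_ge0 r0 r0)) (mulr_ge0 B0 (exprn_ge0 _ r0))).
    rewrite normrM ler_pM//.
      rewrite (le_trans (field_along_le mp pB r0 p0 _ _))// w1 mul1r nray ?(ltW sp)//.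
      by rewrite ler_wpM2l// lerD2l.
    rewrite (le_trans (radial_mass_norm_le n mp pB r0 p0 (ltW sp)))// ler_wpM2l//.
    by rewrite lerXn2r ?nnegrE// ltW.
  - move=> s rs; case: ifPn => // /andP[sp sr].
    by move: rs; rewrite gtr0_norm// ltNge sr.
apply: eq_Rintegral => s _; rewrite pm /=.
have [sp|sp] := ltP 0 s; last by rewrite /= !mulr0.
rewrite nray ?(ltW sp)// /alpha /pairing_weight sp /=.
case: ifP => _; last by rewrite !mul0r mulr0.
rewrite (field_along_scale mp pB r0 p0) /cst /d exprS; field.
by rewrite expf_eq0 gt_eqF// andbF.
Qed.

End radial_potential.

(** * The dissipation of a radial charge *)

Section dissipation_bound.
Context {R : realType} (n : nat).
Let d := n.+1.
Local Notation leb := (@lebesgue_measure R).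
Local Notation lebn := (@lebesgue_Rn R d).
Local Notation sigma := (sphere_area R d).

Variables (p : R -> R) (B r : R).
Hypotheses (mp : measurable_fun setT p) (pB : forall s, `|p s| <= B).
Hypotheses (r0 : 0 <= r) (p0 : forall s, r < s -> p s = 0).
Variables (q : R -> R).
Hypotheses (mq : measurable_fun setT q) (qB : forall s, `|q s| <= B).
Hypotheses (q_ge0 : forall s, 0 <= q s) (q0 : forall s, r < s -> q s = 0).
Local Notation N := (radial_mass n p).

Let B0 : 0 <= B. Proof. exact: le_trans (pB 0). Qed.
Let s0 : 0 < sigma := @sphere_area_gt0 R n.
Let mnormv : measurable_fun setT (fun x : Rn R d => normv x).
Proof. exact: measurable_normvT. Qed.

Definition field_sqr (x : Rn R d) : R :=
  \sum_(i < d) field_along p (basisv i) x ^+ 2.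

Lemma normv_basisv i : normv (basisv i : Rn R d) = 1.
Proof.
by rewrite normv_dotv dotv_basisv coord_translate coord_zerov eqxx add0r sqrtr1.
Qed.

Lemma measurable_field_sqr : measurable_fun setT field_sqr.
Proof.
apply: measurable_sum => i; apply: measurable_funX.
by apply: (measurable_field_along mp) => //; exact: measurable_id.
Qed.

Lemma field_sqr_ge0 x : 0 <= field_sqr x.
Proof. by apply: sumr_ge0 => i _; exact: sqr_ge0. Qed.

Lemma field_sqr_integrable :
  lebn.-integrable setT (EFin \o (fun x => field_sqr x * q (normv x))).
Proof.
apply: (@integrable_bounded_ball _ n _ (d%:R * (B * (r + r)) ^+ 2 * B) r) => //.
- by apply: measurable_funM; [exact: measurable_field_sqr|exact: measurableT_comp].
- move=> x; have [xr|/q0 ->] := leP (normv x) r; last first.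
    by rewrite mulr0 normr0 mulr_ge0// mulr_ge0// sqr_ge0.
  rewrite normrM ler_pM// ger0_norm ?field_sqr_ge0// /field_sqr.
  rewrite (le_trans (ler_sum _ (G := fun=> (B * (r + r)) ^+ 2) _))//.
    move=> i _; rewrite -real_normK ?num_real// lerXn2r ?nnegrE//.
      by rewrite mulr_ge0// addr_ge0.
    rewrite (le_trans (field_along_le mp pB r0 p0 _ _))// normv_basisv mul1r.
    by rewrite ler_wpM2l// lerD2l.
  by rewrite sumr_const card_ord mulr_natl.
- by move=> x /q0 ->; rewrite mulr0.
Qed.

(** Cauchy-Schwarz in the linearized form |V|^2 >= 2 V.w - |w|^2 reduces the
    dissipation to one pairing of the field with a radial vector field w; the
    choice w = V is the one given by Gauss' law. *)
Lemma dissipation_lower_bound :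
  ((sigma * \int[leb]_s (if 0 < s <= r then q s * N s ^+ 2 * s ^- n else 0))%:E <=
   \int[lebn]_x (field_sqr x * q (normv x))%:E)%E.
Proof.
pose beta (s : R) : R := if 0 < s <= r then N s * s ^- d else 0.
have betaE s : pairing_weight n p r q s = q s * beta s.
  by rewrite /pairing_weight /beta; case: ifP => _; rewrite ?mulr0 ?mulrA.
have mN : measurable_fun setT N := measurable_radial_mass n mp pB r0 p0.
have mbeta : measurable_fun setT beta.
  apply: measurable_fun_ifT => //.
    exact: measurable_fun_lt_le.
  by apply: measurable_funM => //; exact: measurable_exprV.
have betaB s : `|beta s| <= B.
  rewrite /beta; case: ifPn => [/andP[sp _]|_]; last by rewrite normr0.
  rewrite normrM [`|_ ^- _|]ger0_norm ?invr_ge0 ?exprn_ge0 ?(ltW sp)//.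
  rewrite ler_pdivrMr ?exprn_gt0//.
  exact: (radial_mass_norm_le n mp pB r0 p0 (ltW sp)).
set X := \int[leb]_s _.
have FP := @flux_pairing R n p B r mp pB r0 p0 q B mq qB.
have I1 := @pairing_field_integrable R n p B r mp pB r0 p0 q B mq qB.
pose b2 (s : R) : R := beta s ^+ 2 * s ^+ 2 * q s.
have mb2 : measurable_fun setT b2.
  by apply: measurable_funM => //; apply: measurable_funM; exact: measurable_funX.
have I2 : lebn.-integrable setT (fun x => (b2 (normv x))%:E).
  apply: (@integrable_bounded_ball _ n _ (B ^+ 2 * r ^+ 2 * B) r) => //.
  - exact: measurableT_comp.
  - move=> x; have [xr|/q0 rx] := leP (normv x) r; last first.
      by rewrite /b2 rx mulr0 normr0 mulr_ge0// mulr_ge0 ?sqr_ge0.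
    rewrite normrM ler_pM// normrM ler_pM// ger0_norm ?sqr_ge0//.
      by rewrite -real_normK ?num_real// lerXn2r ?nnegrE.
    by rewrite lerXn2r ?nnegrE ?normv_ge0.
  - by move=> x /q0 rx; rewrite /b2 rx mulr0.
have [J2 b2E] := @radial_Rintegral R n b2 mb2 I2.
have dE (s : R) : b2 s * (if 0 < s then sigma * s ^+ n else 0) =
    sigma * (if 0 < s <= r then q s * N s ^+ 2 * s ^- n else 0).
  rewrite /b2 /beta; have [sp|sp] := ltP 0 s; last by rewrite /= !mulr0.
  case: ifPn => /= sr; last by rewrite expr0n !mul0r mulr0.
  by rewrite /d (exprS s n); field; rewrite expf_eq0 gt_eqF// andbF.
have {}b2E : \int[lebn]_x b2 (normv x) = sigma * X.
  have iX : leb.-integrable setT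
     (fun s => (if 0 < s <= r then q s * N s ^+ 2 * s ^- n else 0)%:E).
    have := integrableZl measurableT (sigma^-1) J2.
    apply: eq_integrable => // s _ /=; rewrite -EFinM dE mulrA mulVf ?mul1r//.
    by rewrite gt_eqF.
  by rewrite b2E /X -RintegralZl//; apply: eq_Rintegral => s _; rewrite dE.
have I12 := integrableB measurableT (integrableZl measurableT (- 2) I1) I2.
have -> : sigma * X = \int[lebn]_x (- 2 * (pairing_weight n p r q (normv x) * field_along p x x)
    - b2 (normv x)).
  rewrite RintegralB//; last exact: (integrableZl measurableT (- 2) I1).
  have -> : \int[lebn]_x (-2 * (pairing_weight n p r q (normv x) * field_along p x x)) = -2 * - (sigma * X).
    by rewrite RintegralZl// FP.
  by rewrite b2E; lra.
rewrite /Rintegral fineK; last exact: integrable_fin_num.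
apply: le_integral => //; first exact: field_sqr_integrable.
move=> x _; rewrite lee_fin betaE.
rewrite -(sum_field_along mp pB r0 p0) /b2 sqr_normv.
set b := beta _; set Q := q _.
have -> : - 2 * (Q * b * \sum_(i < d) coord x i * field_along p (basisv i) x) -
    b ^+ 2 * dotv x x * Q = Q * \sum_(i < d)
     (- 2 * b * (coord x i * field_along p (basisv i) x) - b ^+ 2 * (coord x i * coord x i)).
  by rewrite sumrB -!mulr_sumr /dotv; ring.
rewrite mulrC ler_wpM2r// ?q_ge0//; apply: ler_sum => i _.
have := sqr_ge0 (field_along p (basisv i) x + b * coord x i); rewrite sqrrD; nra.
Qed.

End dissipation_bound.

(** * The Coulomb kernel as a radial function *)

Section coulomb_kernel.
Context {R : realType} (m : nat).
Let n := m.+1.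
Let d := n.+1.
Local Notation lebn := (@lebesgue_Rn R d).
Local Notation sigma := (sphere_area R d).
Implicit Types x : Rn R d.

Definition coulomb_profile (v : R) : R :=
  if d == 2%N then - (2 * pi)^-1 * ln v
  else ((d - 2)%N%:R * sigma)^-1 * v ^- (d - 2)%N.

Let s0 : 0 < sigma := @sphere_area_gt0 R n.

Lemma coulomb_normv x : coulomb x = coulomb_profile (normv x).
Proof. by []. Qed.

Lemma measurable_coulomb_profile : measurable_fun setT coulomb_profile.
Proof.
rewrite /coulomb_profile; case: (d == 2%N); apply: measurable_funM; try exact: measurable_cst.
  exact: measurable_ln.
exact: measurable_exprV.
Qed.

Lemma is_derive1_coulomb_profile (v : R) : 0 < v ->
  is_derive v 1 coulomb_profile (- (sigma^-1 * v ^- n)).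
Proof.
move=> v0; rewrite /coulomb_profile; case: (boolP (d == 2%N)) => [/eqP d2|d2].
  have dl := is_derive1_ln v0.
  have -> : sigma = 2 * pi by rewrite d2 sphere_area2.
  have -> : (fun u : R => - (2 * pi)^-1 * ln u) = (- (2 * pi)^-1) \*: (@ln R) by [].
  apply: is_derive_eq; rewrite /GRing.scale/= mulNr.
  have m0 : m = 0%N by case: d2.
  by rewrite /n m0 expr1.
have k0 : ((d - 2)%N%:R : R) != 0 by rewrite pnatr_eq0 /d /n subn2.
have dk := is_derive1_exprV (d - 2) v0.
have -> : (fun u : R => ((d - 2)%N%:R * sigma)^-1 * u ^- (d - 2)) =
    (((d - 2)%N%:R * sigma)^-1) \*: (fun u : R => u ^- (d - 2)) by [].
apply: is_derive_eq; rewrite /GRing.scale/= mulrN; congr (- _).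
rewrite (_ : (d - 2).+1 = n); last by rewrite /d /n subn2.
by field; rewrite k0 !gt_eqF// exprn_gt0.
Qed.

Lemma coulomb_profile_le (rho : R) : 0 <= rho -> exists2 C, 0 <= C &
  forall v, 0 <= v <= rho -> `|coulomb_profile v| <= C * v ^- n.
Proof.
move=> rho0; rewrite /coulomb_profile; case: (boolP (d == 2%N)) => [/eqP[m0]|d2].
  rewrite /n m0; have c0 : 0 <= (2 * pi)^-1 :> R by rewrite invr_ge0 mulr_ge0// pi_ge0.
  exists ((2 * pi)^-1 * (rho ^+ 2 + 1)); first by rewrite mulr_ge0// addr_ge0// sqr_ge0.
  move=> v /andP[]; rewrite le_eqVlt => /orP[/eqP <- _|v0 vr].
    by rewrite ln0// mulr0 normr0 expr1 invr0 mulr0.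
  rewrite normrM normrN (ger0_norm c0) -mulrA ler_wpM2l// expr1.
  rewrite (@le_trans _ _ (v + v^-1))//.
    rewrite ler_norml (ltW (lt_le_trans (ln_sublinear v0) _)) ?lerDl ?invr_ge0 ?(ltW v0)//.
    rewrite andbT lerNl -lnV// (ltW (lt_le_trans (ln_sublinear _) _)) ?invr_gt0//.
    by rewrite lerDr ltW.
  rewrite ler_pdivlMr// mulrDl mulVf ?gt_eqF// lerD2r -expr2.
  by rewrite lerXn2r ?nnegrE ?(ltW v0)// (le_trans (ltW v0)).
set c := _^-1; have c0 : 0 <= c by rewrite invr_ge0 mulr_ge0// ltW.
exists (c * rho); first exact: mulr_ge0.
rewrite (_ : (d - 2)%N = m); last by rewrite /d /n subn2.
move=> v /andP[]; rewrite le_eqVlt => /orP[/eqP <- _|v0 vr].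
  have m0 : m == 0%N = false by apply: contraNF d2 => /eqP m0; rewrite /d /n m0.
  by rewrite /n !expr0n m0 invr0 !mulr0 normr0.
rewrite ger0_norm; last by rewrite mulr_ge0// invr_ge0 exprn_ge0// ltW.
rewrite -mulrA ler_wpM2l// /n exprS invfM mulrA ler_peMl//.
  by rewrite invr_ge0 exprn_ge0// ltW.
by rewrite ler_pdivlMr// mul1r.
Qed.

Lemma translate_normv_sqr x i (t : R) :
  normv (translate x i t) = Num.sqrt (1 * (1 * t + coord x i) ^+ 2 + (dotv x x - coord x i ^+ 2)).
Proof.
have -> : translate x i t = addv x (scalev t (basisv i)).
  apply: eq_coord => j; rewrite !coordE/= add0r; case: (i == j).
    by rewrite !mulr1n mulr1.
  by rewrite !mulr0n mulr0.
rewrite normv_dotv !dotvE !(dotvC x) !dotv_basisv coord_translate coord_zerov eqxx add0r mulr1n.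
by congr Num.sqrt; ring.
Qed.

Lemma partial_coulomb x i : x != zerov ->
  partial coulomb i x = newton_flux (basisv i) x.
Proof.
rewrite -normv_gt0 => x0.
pose P (t : R) := 1 * (1 * t + coord x i) ^+ 2 + (dotv x x - coord x i ^+ 2).
have P0E : P 0 = normv x ^+ 2 by rewrite sqr_normv /P; ring.
have P0 : 0 < P 0 by rewrite P0E exprn_gt0.
have sP0 : Num.sqrt (P 0) = normv x by rewrite P0E sqrtr_sqr ger0_norm// ltW.
have dP : is_derive (0 : R) 1 P (2 * 1 * 1 * (1 * 0 + coord x i)).
  have -> : P = (fun u : R => 1 * (1 * u + coord x i) ^+ 2) +
      cst (dotv x x - coord x i ^+ 2) by [].
  have dA := @is_derive1_affine_sqr R 1 1 (coord x i) 0.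
  by apply: is_derive_eq; rewrite addr0.
have dS : is_derive (0 : R) 1 (Num.sqrt \o P)
    ((2 * Num.sqrt (P 0))^-1 * (2 * 1 * 1 * (1 * 0 + coord x i))).
  exact: (@is_derive1_comp _ (@Num.sqrt R) P 0 _ _ (is_derive1_sqrt P0) dP).
have sPp : 0 < (Num.sqrt \o P) 0 by rewrite /= sP0.
have dc := @is_derive1_comp _ coulomb_profile (Num.sqrt \o P) 0 _ _
  (is_derive1_coulomb_profile sPp) dS.
rewrite /partial (_ : (fun t => _) = coulomb_profile \o (Num.sqrt \o P)); last first.
  by apply/funext => t; rewrite coulomb_normv translate_normv_sqr.
rewrite derive1E (derive_val (is_derive := dc)) /newton_flux dotv_basisv /= sP0.
rewrite /d (exprS _ n); field.
by rewrite !gt_eqF// exprn_gt0.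
Qed.

Lemma measurable_partial_coulomb i : measurable_fun setT (partial (@coulomb R d) i).
Proof.
rewrite (_ : partial _ _ = fun x => if x \in [set zerov] then partial coulomb i zerov
    else newton_flux (basisv i) x); last first.
  apply/funext => x; case: ifPn; first by rewrite inE => ->.
  by move=> /negP H; apply: partial_coulomb; apply/eqP => x0; apply: H; rewrite inE.
apply: measurable_fun_ifT => //.
  apply: (measurable_fun_bool true).
  rewrite (_ : _ `&` _ = [set zerov]); first exact: measurable_set1v.
  by rewrite setTI; apply/seteqP; split => x /=; [exact: set_mem|exact: mem_set].
by apply: measurable_newton_flux => //; exact: measurable_id.
Qed.

End coulomb_kernel.

(** * The two functionals in terms of radial profiles *)

Section profile_functionals.
Context {R : realType} (m : nat).
Let n := m.+1.
Let d := n.+1.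
Local Notation leb := (@lebesgue_measure R).
Local Notation lebn := (@lebesgue_Rn R d).
Local Notation sigma := (sphere_area R d).
Implicit Types (k f g : Rn R d -> R) (x y : Rn R d).

Let mnormv : measurable_fun setT (fun x : Rn R d => normv x).
Proof. exact: measurable_normvT. Qed.

Lemma subv_eq0 x y : subv x y = zerov -> y = x.
Proof.
move=> xy; apply: eq_coord => i; have := congr1 (fun z => coord z i) xy.
by rewrite !coordE => /eqP; rewrite subr_eq0 => /eqP.
Qed.

(** The singularity of the kernel meets the charge only at y = x, a null set. *)
Lemma convolution_ae k1 k2 f g x : measurable_fun setT k1 -> measurable_fun setT k2 ->
  measurable_fun setT f -> measurable_fun setT g ->
  (forall z, z != zerov -> k1 z = k2 z) -> {ae lebn, forall y, f y = g y} ->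
  convolution k1 f x = convolution k2 g x.
Proof.
move=> mk1 mk2 mf mg k12 fg.
have msub : measurable_fun setT (fun y : Rn R d => subv x y).
  by apply: measurable_subv => //; exact: measurable_id.
congr fine; apply: ae_eq_integral => //.
- by apply/measurable_EFinP; apply: measurable_funM => //; exact: measurableT_comp.
- by apply/measurable_EFinP; apply: measurable_funM => //; exact: measurableT_comp.
have xae : {ae lebn, forall y, y != x}.
  exists [set x]; split; [exact: measurable_set1v|exact: lebesgue_Rn_set1|].
  by move=> y /= /negP; rewrite negbK => /eqP.
move: fg xae; apply: filterS2 => y fg yx _; rewrite fg k12//.
by apply: contra yx => /eqP /subv_eq0 ->.
Qed.

Variables (rho mu : Rn R d -> R) (q u : R -> R) (B r : R).
Hypotheses (mrho : measurable_fun setT rho) (mmu : measurable_fun setT mu).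
Hypotheses (rhoE : {ae lebn, forall x, rho x = q (normv x)}).
Hypotheses (muE : {ae lebn, forall x, mu x = u (normv x)}).
Hypotheses (mq : measurable_fun setT q) (mu_ : measurable_fun setT u).
Let p (s : R) := q s - u s.
Hypotheses (pB : forall s, `|p s| <= B) (r0 : 0 <= r) (p0 : forall s, r < s -> p s = 0).

Let mp : measurable_fun setT p. Proof. exact: measurable_funB. Qed.
Let mpn : measurable_fun setT (fun y : Rn R d => p (normv y)).
Proof. exact: measurableT_comp. Qed.
Let diffE : {ae lebn, forall x, (rho \- mu) x = p (normv x)}.
Proof. by move: rhoE muE; apply: filterS2 => x /= -> ->. Qed.
Let mdiff : measurable_fun setT (rho \- mu). Proof. exact: measurable_funB. Qed.
Let mcoulomb : measurable_fun setT (@coulomb R d).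
Proof. exact: (measurableT_comp (measurable_coulomb_profile m) mnormv). Qed.

Lemma convolution_coulomb_profile x :
  convolution coulomb (rho \- mu) x = potential (coulomb_profile m) p x.
Proof. exact: (convolution_ae x mcoulomb mcoulomb mdiff mpn). Qed.

Lemma convolution_partial_coulomb i x :
  convolution (partial coulomb i) (rho \- mu) x = field_along p (basisv i) x.
Proof.
apply: (convolution_ae x (k2 := newton_flux (basisv i)) _ _ mdiff mpn) => //.
- exact: measurable_partial_coulomb.
- by apply: measurable_newton_flux => //; exact: measurable_id.
- by move=> z; exact: partial_coulomb.
Qed.

Lemma MMD2_profile : radial_mass n p r = 0 ->
  MMD2 rho mu = (2^-1 * (sigma *
    \int[leb]_s (if 0 < s <= r then radial_mass n p s ^+ 2 * s ^- n else 0)))%:E.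
Proof.
move=> Nr; have [I1 <-] := energy_formula (measurable_coulomb_profile m)
  (@is_derive1_coulomb_profile R m) (@coulomb_profile_le R m) mp pB r0 p0 Nr.
rewrite EFinM /MMD2; congr (_ * _)%E; rewrite /Rintegral fineK; last exact: integrable_fin_num.
have mpot : measurable_fun setT (fun x => potential (coulomb_profile m) p x).
  by apply: (measurable_potential (measurable_coulomb_profile m) mp); exact: measurable_id.
transitivity (\int[lebn]_x (potential (coulomb_profile m) p x * (rho x - mu x))%:E)%E.
  by apply: eq_integral => x _; congr (_ * _)%:E; exact: convolution_coulomb_profile.
apply: ae_eq_integral => //; first 1 last.
- exact: measurable_int I1.
- by apply: filterS diffE => x /= -> _.
by apply/measurable_EFinP; exact: measurable_funM.
Qed.

Lemma dissipation_profile :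
  dissipation rho mu = (\int[lebn]_x (field_sqr p x * q (normv x))%:E)%E.
Proof.
rewrite /dissipation.
transitivity (\int[lebn]_x (field_sqr p x * rho x)%:E)%E.
  apply: eq_integral => x _; congr (_ * _)%:E; apply: eq_bigr => i _.
  by congr (_ ^+ 2); exact: convolution_partial_coulomb.
have mf := @measurable_field_sqr R n p mp.
apply: ae_eq_integral => //.
- by apply/measurable_EFinP; exact: measurable_funM.
- by apply/measurable_EFinP; apply: measurable_funM => //; exact: measurableT_comp.
by apply: filterS rhoE => x -> _.
Qed.

End profile_functionals.

(** * Supports and radial profiles of densities *)

Section supports.
Context {R : realType} (n : nat).
Let d := n.+1.
Local Notation leb := (@lebesgue_measure R).
Local Notation lebn := (@lebesgue_Rn R d).
Local Notation sigma := (sphere_area R d).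
Implicit Types (f h : Rn R d -> R) (x y c : Rn R d).

Lemma measurable_open_ballv c (rho : R) : measurable (open_ballv c rho).
Proof.
have mn : measurable_fun setT (fun y => normv (subv y c)).
  by apply: measurable_normv; apply: measurable_subv => //; exact: measurable_id.
rewrite -[X in measurable X]setTI.
rewrite (_ : open_ballv c rho = (fun y => normv (subv y c) < rho) @^-1` [set true]).
  by apply: measurable_fun_ltr => //.
by apply/seteqP; split.
Qed.

Lemma normv_le_coord x (e : R) : 0 <= e -> (forall i, `|coord x i| <= e) ->
  normv x <= d%:R * e.
Proof.
move=> e0 xe; have d0 : 0 <= d%:R * e by rewrite mulr_ge0.
rewrite -(@ler_pXn2r _ 2) ?nnegrE ?normv_ge0// sqr_normv /dotv.
rewrite (le_trans (ler_sum _ (G := fun=> e ^+ 2) _))//.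
  by move=> i _; rewrite -expr2 -real_normK ?num_real// lerXn2r ?nnegrE.
rewrite sumr_const card_ord exprMn -[_ *+ d]mulr_natl ler_wpM2r ?sqr_ge0//.
by rewrite expr2 ler_peMr// ler1n.
Qed.

(** The rational balls form a countable base. *)
Definition rational_ball (k : d.-tuple rat * rat) : set (Rn R d) :=
  open_ballv [tuple ratr (tnth k.1 i) | i < d] (ratr k.2).

Lemma rational_ball_in x (rho : R) : 0 < rho ->
  exists k, rational_ball k x /\ rational_ball k `<=` open_ballv x rho.
Proof.
move=> rho0; have d0 : 0 < d%:R :> R by rewrite ltr0n.
(* Coordinates within e put the centre within d * e = rho / 4 of x; the radius
   lies between rho / 4 and rho / 2. *)
pose e := rho / (4 * d%:R); have e0 : 0 < e by rewrite divr_gt0// mulr_gt0.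
have /choice[q qP] : forall i : 'I_d, exists q : rat,
    ratr q \in `]coord x i - e, coord x i + e[.
  by move=> i; apply: rat_in_itvoo; rewrite ltrBlDr -addrA ltrDl addr_gt0.
have [s] : exists s : rat, ratr s \in `]rho / 4, rho / 2[.
  by apply: rat_in_itvoo; rewrite ltr_pM2l// ltf_pV2 ?posrE// ltr_nat.
rewrite in_itv/= => /andP[s1 s2].
pose k : d.-tuple rat * rat := ([tuple q i | i < d], s).
have xc : normv (subv x [tuple ratr (tnth k.1 i) | i < d]) <= rho / 4.
  rewrite (_ : rho / 4 = d%:R * e); last by rewrite /e; field; rewrite gt_eqF.
  apply: normv_le_coord => [|i]; first exact: ltW.
  rewrite coord_subv {2}/coord !tnth_mktuple; have := qP i; rewrite in_itv/= => /andP[q1 q2].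
  by rewrite ler_norml; apply/andP; split; lra.
exists k; split; first exact: le_lt_trans xc s1.
move=> y; rewrite /rational_ball /open_ballv/= => yk.
set c := [tuple _ | i < d] in xc yk.
have -> : subv y x = addv (subv y c) (subv c x).
  by apply: eq_coord => i; rewrite !coordE; ring.
rewrite (le_lt_trans (normv_add_le _ _))// (normv_subC c); lra.
Qed.

(** Passing to the absolute value turns almost everywhere nonnegativity into
    nonnegativity, which monotonicity of the integral in the set requires. *)
Lemma integral_abs_ae f S : measurable S -> measurable_fun setT f ->
  {ae lebn, forall x, 0 <= f x} ->
  (\int[lebn]_(x in S) (f x)%:E = \int[lebn]_(x in S) `|(f x)%:E|)%E.
Proof.
move=> mS mf f0.
have mSf : measurable_fun S (EFin \o f).
  by apply/measurable_EFinP; exact: measurable_funTS.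
apply: ae_eq_integral => //; first exact: measurableT_comp.
by apply: filterS f0 => x f0 _; rewrite gee0_abs.
Qed.

Lemma ae_eq0_of_integral_eq0 f S : measurable S -> measurable_fun setT f ->
  {ae lebn, forall x, 0 <= f x} -> ~ (0 < \int[lebn]_(x in S) (f x)%:E)%E ->
  {ae lebn, forall x, S x -> f x = 0}.
Proof.
move=> mS mf f0 If.
have mSf : measurable_fun S (EFin \o f).
  by apply/measurable_EFinP; exact: measurable_funTS.
have /(ae_eq_integral_abs _ mS mSf) : (\int[lebn]_(x in S) `|(f x)%:E| = 0)%E.
  apply/eqP; rewrite eq_le integral_ge0// andbT leNgt; apply/negP.
  by rewrite -integral_abs_ae.
by apply: filterS => x /[swap] Sx /(_ Sx) -[].
Qed.

(** A set every point of which has a null neighbourhood is itself null: the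
    rational balls reduce it to countably many null sets. *)
Lemma ae_eq0_off_supp f : measurable_fun setT f -> {ae lebn, forall x, 0 <= f x} ->
  {ae lebn, forall x, ~ supp f x -> f x = 0}.
Proof.
move=> mf f0.
pose null k := ~ (0 < \int[lebn]_(x in rational_ball k) (f x)%:E)%E.
have H : {ae lebn, forall x, forall j : nat,
    if unpickle j is Some k then null k -> rational_ball k x -> f x = 0 else True}.
  apply: ae_foralln => j; case: (unpickle j) => [k|]; last by apply: filterS f0.
  have [nk|] := pselect (null k); last by move=> nk; apply: filterS f0.
  apply: filterS (ae_eq0_of_integral_eq0 (measurable_open_ballv _ _) mf f0 nk) => x.
  by [].
apply: filterS H => x Hx /existsNP[rho /not_implyP[rho0 If]].
have [k [kx ks]] := rational_ball_in x rho0.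
have /= := Hx (pickle k); rewrite pickleK; apply => //.
apply: contra_not If => /lt_le_trans; apply.
have mk : measurable (rational_ball k) by exact: measurable_open_ballv.
rewrite (integral_abs_ae mk mf f0) (integral_abs_ae (measurable_open_ballv x rho) mf f0).
apply: ge0_subset_integral => //; first exact: measurable_open_ballv.
by apply: measurableT_comp => //; apply/measurable_EFinP; exact: measurable_funTS.
Qed.

Lemma Lfun_infty_bounded f : f \in Lfun lebn +oo%E ->
  exists2 B, 0 <= B & {ae lebn, forall x, `|f x| <= B}.
Proof.
move=> /sub_Lfun_finLfun; rewrite inE /= /finite_norm unlock.
case: ifPn => [_|]; last first.
  rewrite -leNgt => l0 _; exists 0 => //; exists setT; split => //.
  by apply/eqP; rewrite eq_le l0 measure_ge0.
have := ess_sup_ge lebn (abse \o (EFin \o f)).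
set E := ess_sup _ _; case: E => [b| |] // H _.
  exists `|b| => //; apply: filterS H => x /=; rewrite lee_fin => /le_trans; apply.
  exact: ler_norm.
by exists 0 => //; apply: filterS H => x /=.
Qed.

Variables (a r : R).
Hypotheses (a0 : 0 <= a) (ar : a < r).

(** Truncating the profile to the interval [lo, hi] makes the almost everywhere
    bounds hold at every radius. *)
Lemma radial_profile f (lo hi : R) : lo <= hi ->
  prob_density f -> radial f -> supp f `<=` annulus a r ->
  {ae lebn, forall x, annulus a r x -> lo <= f x <= hi} ->
  exists q : R -> R, [/\ measurable_fun setT q,
    forall s, a <= s <= r -> lo <= q s <= hi,
    forall s, ~~ (a <= s <= r) -> q s = 0 &
    {ae lebn, forall x, f x = q (normv x)}].
Proof.
move=> lohi [mf f0 _] [h [mh fh hrad]] sf fb.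
pose e1 : Rn R d := basisv ord0.
pose g (s : R) := h (scalev s e1).
have mg : measurable_fun setT g.
  by apply: measurableT_comp => //; apply: measurable_scalev => //; exact: measurable_id.
have hg x : h x = g (normv x).
  by apply: hrad; rewrite normvZ normv_basisv mulr1 ger0_norm// normv_ge0.
exists (fun s => if a <= s <= r then Num.max lo (Num.min hi (g s)) else 0); split.
- apply: measurable_fun_ifT => //.
    by apply: measurable_and; exact: measurable_fun_ler.
  by apply: measurable_maxr => //; exact: measurable_minr.
- by move=> s ->; rewrite le_max lexx/= ge_max lohi ge_min lexx.
- by move=> s /negbTE ->.
have off := ae_eq0_off_supp mf f0.
have fhb : {ae lebn, forall x, f x = h x /\ (annulus a r x -> lo <= f x <= hi)}.
  by move: fh fb; apply: filterS2.
move: off fhb; apply: filterS2 => x off [fhx fbx].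
case: ifPn => [ax|/negP ax].
  have /andP[lf fh'] := fbx ax.
  by rewrite -hg -fhx (min_idPr fh') (max_idPr lf).
by apply: off => /sf.
Qed.

Lemma profile_mass f (q : R -> R) (B : R) : prob_density f ->
  measurable_fun setT q -> (forall s, 0 <= q s) -> (forall s, q s <= B) ->
  (forall s, r < s -> q s = 0) -> {ae lebn, forall x, f x = q (normv x)} ->
  radial_mass n q r = sigma^-1.
Proof.
move=> [mf _ f1] mq q0 qB qout fq.
have r0 : 0 <= r by exact: le_trans (ltW ar).
have s0 : 0 < sigma := @sphere_area_gt0 R n.
have qB' s : `|q s| <= B by rewrite ger0_norm.
have mdens := measurable_radial_density n mq.
have densB := radial_density_le n qB' r0 qout.
have dens0 := radial_density_eq0 n qout.
have idens : leb.-integrable setT (EFin \o radial_density n q).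
  exact: integrable_bounded_support mdens densB dens0.
have -> : radial_mass n q r = \int[leb]_s radial_density n q s.
  rewrite /radial_mass /primitive; apply: eq_Rintegral => u _.
  case: ifPn => //; rewrite -ltNge => ru.
  by rewrite dens0// (lt_le_trans ru)// ler_norm.
have sn0 : sigma != 0 by rewrite gt_eqF.
suff E : sigma * \int[leb]_s radial_density n q s = 1.
  by rewrite -[LHS](mulKf sn0) E mulr1.
rewrite -RintegralZl//; have -> : 1 = fine (\int[lebn]_x (f x)%:E)%E by rewrite f1.
rewrite (_ : (\int[lebn]_x (f x)%:E = \int[lebn]_x (EFin \o q) (normv x))%E); last first.
  have mn : measurable_fun setT (fun x : Rn R d => normv x).
    exact: measurable_normvT.
  apply: ae_eq_integral => //; first exact/measurable_EFinP.
    by apply: (measurableT_comp _ mn); exact/measurable_EFinP.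
  by apply: filterS fq => x -> _.
rewrite radial_integral//; last exact/measurable_EFinP.
congr fine; apply: eq_integral => s _; rewrite -EFinM /radial_density.
by case: ifP => _; rewrite ?mulr0// mulrCA.
Qed.

End supports.

(** * The inequality between the two functionals *)

Section functional_inequality.
Context {R : realType} (m : nat).
Let n := m.+1.
Let d := n.+1.
Local Notation leb := (@lebesgue_measure R).
Local Notation lebn := (@lebesgue_Rn R d).
Local Notation sigma := (sphere_area R d).

Lemma weighted_field_integrable (p w : R -> R) (B r : R) :
  measurable_fun setT p -> (forall s, `|p s| <= B) -> 0 <= r ->
  (forall s, r < s -> p s = 0) ->
  measurable_fun setT w -> (forall s, `|w s| <= B) ->
  leb.-integrable setT (EFin \o (fun s : R =>
    if 0 < s <= r then w s * radial_mass n p s ^+ 2 * s ^- n else 0)).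
Proof.
move=> mp pB r0 p0 mw wB; have B0 : 0 <= B := le_trans (normr_ge0 _) (pB 0).
apply: (@integrable_bounded_support _ _ (B * (B ^+ 2 * r ^+ (d + 1))) r).
- apply: measurable_fun_ifT => //.
    exact: measurable_fun_lt_le.
  apply: measurable_funM; last exact: measurable_exprV.
  apply: measurable_funM => //; apply: measurable_funX.
  exact: (measurable_radial_mass n mp pB r0 p0).
- move=> s; case: ifPn => [/andP[sp sr]|_]; last first.
    by rewrite normr0 mulr_ge0// mulr_ge0 ?sqr_ge0// exprn_ge0.
  rewrite -mulrA normrM ler_pM// ger0_norm; last first.
    by rewrite mulr_ge0 ?sqr_ge0// invr_ge0 exprn_ge0// ltW.
  rewrite ler_pdivrMr ?exprn_gt0//.
  rewrite (@le_trans _ _ ((B * s ^+ d) ^+ 2))//.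
    rewrite -real_normK ?num_real// lerXn2r ?nnegrE ?(mulr_ge0 B0 (exprn_ge0 d (ltW sp)))//.
    exact: (radial_mass_norm_le n mp pB r0 p0 (ltW sp)).
  rewrite exprMn -(mulrA (B ^+ 2) (r ^+ (d + 1)) (s ^+ n)) ler_wpM2l ?sqr_ge0//.
  rewrite [X in X <= _](_ : _ = s ^+ (d + 1) * s ^+ n); last first.
    by rewrite -exprM -exprD; congr (_ ^+ _); rewrite /d muln2 -addnn addn1 addnS !addSn.
  rewrite ler_wpM2r ?exprn_ge0 ?(ltW sp)// lerXn2r ?nnegrE// ltW//.
- move=> s rs; case: ifPn => // /andP[sp sr].
  by move: rs; rewrite gtr0_norm// ltNge sr.
Qed.

Lemma radial_massB (q u : R -> R) (B r s : R) :
  measurable_fun setT q -> measurable_fun setT u ->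
  (forall s, `|q s| <= B) -> (forall s, `|u s| <= B) -> 0 <= r ->
  (forall s, r < s -> q s = 0) -> (forall s, r < s -> u s = 0) ->
  radial_mass n (fun s => q s - u s) s = radial_mass n q s - radial_mass n u s.
Proof.
move=> mq mu_ qB uB r0 q0 u0; rewrite /radial_mass /primitive -RintegralB//.
- apply: eq_Rintegral => t _; rewrite /radial_density.
  by case: (t <= s); case: (0 < t); rewrite ?subr0// mulrBl.
- apply: (integrable_restricted (measurable_radial_density n mq)
    (radial_density_le n qB r0 q0) (radial_density_eq0 n q0)); exact: measurable_fun_ler.
- apply: (integrable_restricted (measurable_radial_density n mu_)
    (radial_density_le n uB r0 u0) (radial_density_eq0 n u0)); exact: measurable_fun_ler.
Qed.

(** Otherwise the support would be null, and the density would vanish. *)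
Lemma supp_bounds_le (mu : Rn R d -> R) (lam A : R) : prob_density mu ->
  {ae lebn, forall x, supp mu x -> lam <= mu x <= A} -> lam <= A.
Proof.
move=> [mf f0 f1] mub; rewrite leNgt; apply/negP => Alam.
have mu0 : {ae lebn, forall x, mu x = 0}.
  move: mub (ae_eq0_off_supp mf f0); apply: filterS2 => x mub; apply => /mub.
  by move=> /andP[/le_trans H /H]; rewrite leNgt Alam.
have : (\int[lebn]_x (mu x)%:E = 0)%E.
  rewrite -(integral0 lebn setT); apply: ae_eq_integral => //.
    exact/measurable_EFinP.
  by apply: filterS mu0 => x -> _.
by rewrite f1 => /eqP; rewrite eqe oner_eq0.
Qed.

(** MMD2 carries a factor 1 / 2 that the dissipation does not, so that the
    one-dimensional inequality is needed with the constant 2 C; then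
    2 C >= A (d / lam)^2 is exactly the second term of the maximum. *)
Lemma MMD2_le_dissipation (mu rho : Rn R d -> R) (a r A lam : R) :
  bounded_radial_density mu -> bounded_radial_density rho ->
  0 <= a -> a < r -> supp mu = annulus a r -> supp rho `<=` supp mu ->
  0 < lam -> {ae lebn, forall x, supp mu x -> lam <= mu x <= A} ->
  (MMD2 rho mu <= (constC d lam A)%:E * dissipation rho mu)%E.
Proof.
move=> [muP _ murad] [rhoP rhoL rhorad] a0 ar smu srho lam0 mub.
have lamA := supp_bounds_le muP mub.
have A0 : 0 < A := lt_le_trans lam0 lamA.
have r0 : 0 <= r := le_trans a0 (ltW ar).
have [M M0 rhoM] := Lfun_infty_bounded rhoL.
have [u [mu_ uin uout muE]] : exists u : R -> R, [/\ measurable_fun setT u,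
    forall s, a <= s <= r -> lam <= u s <= A,
    forall s, ~~ (a <= s <= r) -> u s = 0 &
    {ae lebn, forall x, mu x = u (normv x)}].
  by apply: radial_profile => //; rewrite -smu.
have [q [mq qin qout rhoE]] : exists q : R -> R, [/\ measurable_fun setT q,
    forall s, a <= s <= r -> 0 <= q s <= M,
    forall s, ~~ (a <= s <= r) -> q s = 0 &
    {ae lebn, forall x, rho x = q (normv x)}].
  apply: radial_profile => //; first by rewrite -smu.
  have [_ rho0 _] := rhoP; move: rho0 rhoM; apply: filterS2 => x rho0 rhoM _.
  by rewrite rho0 (le_trans (ler_norm _)).
pose B := M + A; have MB : M <= B by rewrite lerDl ltW.
have AB : A <= B by rewrite lerDr.
have q0 s : 0 <= q s.
  by have [/qin/andP[]|/qout ->] := boolP (a <= s <= r).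
have u0 s : 0 <= u s.
  have [/uin/andP[us _]|/uout ->//] := boolP (a <= s <= r).
  exact: le_trans (ltW lam0) us.
have qM s : q s <= M.
  by have [/qin/andP[]|/qout ->] := boolP (a <= s <= r).
have uA s : u s <= A.
  by have [/uin/andP[]|/uout ->] := boolP (a <= s <= r); rewrite // ltW.
have outr s : r < s -> ~~ (a <= s <= r) by rewrite negb_and -!ltNge orbC => ->.
have qr s : r < s -> q s = 0 by move=> /outr/qout.
have ur s : r < s -> u s = 0 by move=> /outr/uout.
have qB s : `|q s| <= B by rewrite ger0_norm// (le_trans (qM s)).
have uB s : `|u s| <= B by rewrite ger0_norm// (le_trans (uA s)).
have fq := profile_mass a0 ar rhoP mq q0 qM qr rhoE.
have fu := profile_mass a0 ar muP mu_ u0 uA ur muE.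
pose p (s : R) := q s - u s.
have mp : measurable_fun setT p by exact: measurable_funB.
have pr s : r < s -> p s = 0 by move=> rs; rewrite /p qr// ur// subr0.
have pB s : `|p s| <= B.
  by rewrite ler_norml; have := q0 s; have := u0 s; have := qM s; have := uA s;
    rewrite /p /B => *; apply/andP; split; lra.
have NE s : radial_mass n p s = radial_mass n q s - radial_mass n u s.
  exact: (radial_massB s mq mu_ qB uB r0 qr ur).
have Nr : radial_mass n p r = 0 by rewrite NE fq fu subrr.
pose C := constC d lam A.
have C1 : lam^-1 <= C by rewrite /C /constC le_max lexx.
have C2 : d%:R ^+ 2 * A / (2 * lam ^+ 2) <= C by rewrite /C /constC le_max lexx orbT.
have C0 : 0 <= C by rewrite (le_trans _ C1)// invr_ge0 ltW.
have H1 : lam^-1 <= 2 * C by lra.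
have H2 : A * (d%:R / lam) ^+ 2 <= 2 * C.
  rewrite (_ : A * _ = 2 * (d%:R ^+ 2 * A / (2 * lam ^+ 2))); first by rewrite ler_pM2l.
  by field; rewrite gt_eqF.
have [[mrho _ _] [mmu _ _]] := (rhoP, muP).
rewrite (MMD2_profile mrho mmu rhoE muE mq mu_ pB r0 pr Nr).
rewrite (dissipation_profile mrho mmu rhoE muE mq mu_).
have D := dissipation_lower_bound n mp pB r0 pr mq qB q0 qr.
have massE : radial_mass n q r = radial_mass n u r by rewrite fq fu.
have I := mass_defect_le a0 ar lam0 A0 mq mu_ q0 qM qout uin uout massE H1 H2.
set X := \int[leb]_s _; set Y := \int[leb]_s _ in D.
have s0 : 0 < sigma := @sphere_area_gt0 R n.
have XY : X <= 2 * C * Y.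
  have m1 : measurable_fun [set: R] (cst 1 : R -> R) by [].
  have [J1 J2] : leb.-integrable setT (EFin \o (fun s : R =>
      if 0 < s <= r then radial_mass n p s ^+ 2 * s ^- n else 0)) /\
    leb.-integrable setT (EFin \o (fun s : R =>
      if 0 < s <= r then q s * radial_mass n p s ^+ 2 * s ^- n else 0)).
    split; last exact: weighted_field_integrable mp pB r0 pr mq qB.
    have pB1 s : `|p s| <= B + 1 by rewrite (le_trans (pB s))// lerDl.
    have oneB s : `|(cst 1 : R -> R) s| <= B + 1.
      by rewrite normr1 lerDr addr_ge0// ltW.
    have := weighted_field_integrable mp pB1 r0 pr m1 oneB.
    by apply: eq_integrable => // s _ /=; rewrite mul1r.
  rewrite -lee_fin EFinM /X /Y /Rintegral !fineK; try exact: integrable_fin_num.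
  move: I; congr (_ <= _ * _)%E; apply: eq_integral => s _; by rewrite NE.
apply: (@le_trans _ _ (C%:E * (sigma * Y)%:E)%E); last by rewrite lee_wpmul2l// lee_fin.
rewrite -EFinM lee_fin.
have : sigma * X <= sigma * (2 * C * Y) by rewrite ler_wpM2l// ltW.
lra.
Qed.

End functional_inequality.

Theorem theorem1p12 (R : realType) (d : nat) (hd : (2 <= d)%N) :
  (forall (mu rho : Rn R d -> R) (a r A lam : R),
     bounded_radial_density mu -> bounded_radial_density rho ->
     0 <= a -> a < r -> supp mu = annulus a r ->
     supp rho `<=` supp mu ->
     0 < A -> 0 < lam ->
     {ae lebesgue_Rn d, forall x, supp mu x -> lam <= mu x <= A} ->
     (MMD2 rho mu <= (constC d lam A)%:E * dissipation rho mu)%E)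
  /\
  (forall (mu : Rn R d -> R) (r A lam : R),
     bounded_radial_density mu ->
     0 < r -> supp mu = centered_ball r ->
     0 < lam ->
     {ae lebesgue_Rn d, forall x, supp mu x -> lam <= mu x <= A} ->
     forall rho : Rn R d -> R,
       bounded_radial_density rho -> supp rho `<=` centered_ball r ->
       (MMD2 rho mu <= (constC d lam A)%:E * dissipation rho mu)%E).
Proof.
case: d hd => [//|[//|m]] _; split.
  move=> mu rho a r A lam muP rhoP a0 ar smu srho _ lam0 mub.
  exact: MMD2_le_dissipation muP rhoP a0 ar smu srho lam0 mub.
move=> mu r A lam muP r0 smu lam0 mub rho rhoP srho.
have ballE : centered_ball r = annulus 0 r :> set (Rn R m.+2).
  by apply/seteqP; split => x; rewrite /centered_ball /annulus/= normv_ge0.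
apply: (MMD2_le_dissipation muP rhoP (lexx 0) r0 _ _ lam0 mub).
  by rewrite smu ballE.
by rewrite smu.
Qed.
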